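(* Fix $k\ge 2$, distinct translations $t_1,\dots,t_k\in\mathbb C$, and a probability vector $\mathbf p=(p_1,\dots,p_k)$ with strictly positive entries. Then there exists a set $$E^{\mathbf p}_t\subset \mathcal R^{\mathbf p}_t:=\{\lambda=(\lambda_1,\dots,\lambda_k)\in\mathbb D_*^k:\ s(\lambda,\mathbf p)>2\}$$ of zero Lebesgue measure (in $\mathbb C^k\cong\mathbb R^{2k}$) such that for every $\lambda\in\mathcal R^{\mathbf p}_t\setminus E^{\mathbf p}_t$ the self-similar measure $\nu^{\mathbf p}_{\lambda,t}$ is absolutely continuous with respect to $2$-dimensional Lebesgue measure on $\mathbb C$.
   Context: $\mathbb D_*=\{z\in\mathbb C:0<|z|<1\}$. For $\lambda\in\mathbb D_*^k$ and $t\in\mathbb C^k$, let $g_i(z)=\lambda_i z+t_i$; $\nu^{\mathbf p}_{\lambda,t}$ is the unique Borel probability measure on $\mathbb C$ with $\nu=\sum_{i=1}^k p_i\, g_i\nu$ (pushforwards). The similarity dimension is $s(\lambda,\mathbf p)=\frac{\sum_i p_i\log p_i}{\sum_i p_i\log|\lambda_i|}$. *)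

(* Defs.v *)
(* C is modelled as R * R (real, imaginary part). *)
From HB Require Import structures.
From mathcomp Require Import all_boot all_order all_algebra.
From mathcomp Require Import all_classical all_reals all_analysis.
Set Implicit Arguments. Unset Strict Implicit. Unset Printing Implicit Defensive.
Import Order.TTheory GRing.Theory Num.Theory.
Local Open Scope classical_set_scope.
Local Open Scope ring_scope.

Section defs.
Variable R : realType.

Definition cmul (a b : R * R) : R * R :=
  (a.1 * b.1 - a.2 * b.2, a.1 * b.2 + a.2 * b.1).
Definition cadd (a b : R * R) : R * R := (a.1 + b.1, a.2 + b.2).
Definition cabs (a : R * R) : R := Num.sqrt (a.1 ^+ 2 + a.2 ^+ 2).

Definition simil (l t : R * R) (z : R * R) : R * R := cadd (cmul l z) t.

Definition punct_disc (z : R * R) : Prop := 0 < cabs z < 1.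

Definition sim_dim (k : nat) (lam : 'I_k -> R * R) (p : 'I_k -> R) : R :=
  (\sum_(i < k) p i * ln (p i)) / (\sum_(i < k) p i * ln (cabs (lam i))).

Definition region (k : nat) (p : 'I_k -> R) : set ('I_k -> R * R) :=
  [set lam | (forall i, punct_disc (lam i)) /\ 2 < sim_dim lam p].

Definition in_box (k : nat) (a b : 'I_k -> R * R) (x : 'I_k -> R * R) : Prop :=
  forall i, ((a i).1 <= (x i).1 <= (b i).1) /\ ((a i).2 <= (x i).2 <= (b i).2).

Definition box_vol (k : nat) (a b : 'I_k -> R * R) : R :=
  \prod_(i < k) (((b i).1 - (a i).1) * ((b i).2 - (a i).2)).

Definition leb_null (k : nat) (E : set ('I_k -> R * R)) : Prop :=
  forall eps : R, 0 < eps ->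
  exists a b : nat -> 'I_k -> R * R,
    (forall n i, (a n i).1 <= (b n i).1 /\ (a n i).2 <= (b n i).2) /\
    E `<=` \bigcup_n [set x | in_box (a n) (b n) x] /\
    (forall N, \sum_(n < N) box_vol (a n) (b n) <= eps).

Definition leb2 := ((@lebesgue_measure R) \x (@lebesgue_measure R))%E.

Definition self_similar (k : nat) (lam t : 'I_k -> R * R) (p : 'I_k -> R)
    (nu : probability (R * R)%type R) : Prop :=
  forall A : set (R * R), measurable A ->
    nu A = (\sum_(i < k) (p i)%:E * nu (simil (lam i) (t i) @^-1` A))%E.

End defs.

(* Main.v *)
(** A word u of length n codes the point pi_lam(u) up to the error |lam_u|. If, for infinitely many n, two
    independent typical words of length 2n have |pi(u) - pi(v)| <= E_n := exp (- chi n) with probability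
    O(E_n^2), Cauchy-Schwarz over the squares of side E_n bounds nu by Lebesgue measure, so nu is absolutely
    continuous. The words with a common prefix are harmless because the similarity dimension exceeds 2, and
    it remains to bound the energy of pairs with distinct first letters for almost every lam.

    Let f_l(u, v) be the l-th Taylor coefficient of the difference of the coded points under the scaling
    lam -> (1 + h) lam. For some S the coefficients f_0, ..., f_(S-1) are never simultaneously small. If
    f_0, ..., f_(s-1) are small but f_s is not, f_(s-1) is nearly affine in h, which confines h to a small
    disc; if f_s is small too, one more coefficient is under control. Averaging over h thus improves the decay
    exponent d_s of the event that f_0, ..., f_(s-1) are O(E_n), given d_(s+1) and d_s, outside a null set of
    lam. Starting from d_S = 4, iteration gives d_2 > 2 and d_1 = 2, and one last averaging step removes the
    subexponential losses. Almost-everywhere statements are expressed by covers with dyadic cells of a chart,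
    using Markov's inequality and the Borel-Cantelli lemma. *)

Require Import Defs.
From HB Require Import structures.
From mathcomp Require Import all_boot all_order all_algebra.
From mathcomp Require Import all_classical all_reals all_analysis.
From mathcomp Require Import measurable_realfun complex ring lra zify.
Set Implicit Arguments. Unset Strict Implicit. Unset Printing Implicit Defensive.
Import Order.TTheory GRing.Theory Num.Theory.
Local Open Scope ring_scope.

(** * Random words *)

(** The scaling direction is chosen because every letter receives the same factor: [lamw] at (1 + h)
    lam is (1 + h)^|u| times [lamw lam u]. The jets of a concatenation thus depend on those of the
    tail through a binomial unipotent matrix, which costs only powers of the word length, and
    splitting words is compatible with taking jets.

    The obstacle is the accumulation of losses. A tail of a word that is typical with constant K is
    typical only with a constant that grows like eps times the removed length, so decay claims are
    quantified over K. Each use of a claim multiplies the coefficient A of the loss A (K + eps n),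
    and in the end eps must be small compared with 1 / A. The bootstrapping is therefore run on an
    abstract predicate: A and the gain dlt depend only on S and on the exponents Chi (contraction)
    and H (entropy), and eps is fixed afterwards.

    Exponent 2 with a loss exp (A eps n) would not give absolute continuity. Exponent 2 + dlt for
    two jets makes the contributions of the scales i to the one-jet energy a convergent geometric
    series, so that exponent 2 is reached without loss. *)

Section WordExpectation.
Variables (R : realType) (k : nat) (p : 'I_k -> R).
Implicit Types (F G : seq 'I_k -> R) (n : nat).

Fixpoint Ew n F : R :=
  if n is n'.+1 then \sum_(i < k) p i * Ew n' (fun u => F (i :: u)) else F [::].

Lemma Ew_ext n F G : (forall u, size u = n -> F u = G u) -> Ew n F = Ew n G.
Proof.
elim: n F G => [|n IH] F G H /=; first exact: H.
by apply: eq_bigr => i _; congr (_ * _); apply: IH => u su; rewrite H //= su.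
Qed.

Lemma EwD n F G : Ew n (fun u => F u + G u) = Ew n F + Ew n G.
Proof.
elim: n F G => [//|n IH] F G /=; rewrite -big_split /=.
by apply: eq_bigr => i _; rewrite IH mulrDr.
Qed.

Lemma EwZ n c F : Ew n (fun u => c * F u) = c * Ew n F.
Proof.
elim: n F => [//|n IH] F /=; rewrite mulr_sumr.
by apply: eq_bigr => i _; rewrite IH mulrCA.
Qed.

Lemma Ew0 n : Ew n (fun=> 0) = 0.
Proof. by elim: n => [//|n IH] /=; rewrite big1 // => i _; rewrite IH mulr0. Qed.

Lemma Ew_sum n (I : Type) (r : seq I) (P : pred I) (F : I -> seq 'I_k -> R) :
  Ew n (fun u => \sum_(i <- r | P i) F i u) = \sum_(i <- r | P i) Ew n (F i).
Proof.
elim: r => [|i r IH].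
  by rewrite big_nil -[RHS](Ew0 n); apply: Ew_ext => u _; rewrite big_nil.
rewrite big_cons; case: ifP => Pi.
  by rewrite -IH -EwD; apply: Ew_ext => u _; rewrite big_cons Pi.
by rewrite -IH; apply: Ew_ext => u _; rewrite big_cons Pi.
Qed.

Lemma Ew_cat m n F : Ew (m + n) F = Ew m (fun u => Ew n (fun v => F (u ++ v))).
Proof. by elim: m F => [//|m IH] F /=; apply: eq_bigr => i _; rewrite IH. Qed.

Lemma Ew_exch m n (F : seq 'I_k -> seq 'I_k -> R) :
  Ew m (fun u => Ew n (fun v => F u v)) = Ew n (fun v => Ew m (fun u => F u v)).
Proof.
elim: m F => [//|m IH] F /=; rewrite Ew_sum.
by apply: eq_bigr => i _; rewrite IH EwZ.
Qed.

Hypothesis p_gt0 : forall i, 0 < p i.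
Hypothesis p_sum : \sum_(i < k) p i = 1.

Lemma Ew_le n F G : (forall u, size u = n -> F u <= G u) -> Ew n F <= Ew n G.
Proof.
elim: n F G => [|n IH] F G H /=; first exact: H.
apply: ler_sum => i _; apply: ler_wpM2l; first exact: ltW.
by apply: IH => u su; apply: H => /=; rewrite su.
Qed.

Lemma Ew_cst n c : Ew n (fun=> c) = c.
Proof.
elim: n => [//|n IH] /=.
by under eq_bigr do rewrite IH; rewrite -mulr_suml p_sum mul1r.
Qed.

Lemma Ew_ge0 n F : (forall u, size u = n -> 0 <= F u) -> 0 <= Ew n F.
Proof. by move=> H; rewrite -(Ew_cst n 0); apply: Ew_le. Qed.

Lemma Ew_le_cst n F c : (forall u, size u = n -> F u <= c) -> Ew n F <= c.
Proof. by move=> H; rewrite -(Ew_cst n c); apply: Ew_le. Qed.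

Definition pw (u : seq 'I_k) : R := \prod_(i <- u) p i.

Lemma pw_gt0 u : 0 < pw u.
Proof. by rewrite /pw; apply: prodr_gt0. Qed.

Lemma Ew_ge_pt n F v : (forall u, 0 <= F u) -> size v = n -> pw v * F v <= Ew n F.
Proof.
elim: n F v => [|n IH] F v F0; first by case: v => // _; rewrite /pw big_nil mul1r.
case: v => // i v [sv] /=; rewrite (bigD1 i) //= /pw big_cons -mulrA.
rewrite -[X in X <= _]addr0 lerD //.
  by apply: ler_wpM2l; [exact: ltW | apply: (IH (fun u => F (i :: u)))].
by apply: sumr_ge0 => j _; apply: mulr_ge0; [exact: ltW | apply: Ew_ge0].
Qed.

(* Weigh each related pair (u, v) by M u / b u + N v / a v, which is at least 2
   because M u >= a v and N v >= b u whenever u and v are related. *)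
Lemma Ew_rel_le n (rho relX relY : seq 'I_k -> seq 'I_k -> bool) :
  (forall u u' v, rho u v -> rho u' v -> relX u u') ->
  (forall u v v', rho u v -> rho u v' -> relY v v') ->
  2 * Ew n (fun u => Ew n (fun v => (rho u v)%:R)) <=
  Ew n (fun u => Ew n (fun u' => (relX u u')%:R)) +
  Ew n (fun v => Ew n (fun v' => (relY v v')%:R)).
Proof.
move=> HX HY.
pose M u := Ew n (fun u' => (relX u u')%:R).
pose N v := Ew n (fun v' => (relY v v')%:R).
pose a v := Ew n (fun u => (rho u v)%:R).
pose b u := Ew n (fun v => (rho u v)%:R).
have M0 u : 0 <= M u by apply: Ew_ge0.
have N0 u : 0 <= N u by apply: Ew_ge0.
have key u v : size u = n -> size v = n ->
    2 * (rho u v)%:R <= (M u / b u) * (rho u v)%:R + (N v / a v) * (rho u v)%:R.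
  move=> su sv; case ruv: (rho u v); last by rewrite !mulr0 addr0.
  rewrite !mulr1.
  have a0 : 0 < a v.
    apply: lt_le_trans (Ew_ge_pt (F := fun u => (rho u v)%:R) _ su) => //.
    by rewrite ruv mulr1 pw_gt0.
  have b0 : 0 < b u.
    apply: lt_le_trans (Ew_ge_pt (F := fun v => (rho u v)%:R) _ sv) => //.
    by rewrite ruv mulr1 pw_gt0.
  have aM : a v <= M u.
    apply: Ew_le => u' _; case ru'v: (rho u' v); last exact: ler0n.
    by rewrite (HX _ _ _ ruv ru'v).
  have bN : b u <= N v.
    apply: Ew_le => v' _; case ruv': (rho u v'); last exact: ler0n.
    by rewrite (HY _ _ _ ruv ruv').
  have h1 : a v / b u <= M u / b u by rewrite ler_pM2r ?invr_gt0.
  have h2 : b u / a v <= N v / a v by rewrite ler_pM2r ?invr_gt0.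
  apply: le_trans (lerD h1 h2).
  (* Arithmetic-geometric mean: a quotient and its inverse add up to at least 2. *)
  have -> : a v / b u + b u / a v = 2 + (a v - b u) ^+ 2 / (a v * b u).
    by field; rewrite !gt_eqF.
  by rewrite lerDl divr_ge0 ?sqr_ge0 // mulr_ge0 ?ltW.
have -> : 2 * Ew n (fun u => Ew n (fun v => (rho u v)%:R)) =
          Ew n (fun u => Ew n (fun v => 2 * (rho u v)%:R)).
  by rewrite -EwZ; apply: Ew_ext => u _; rewrite EwZ.
apply: (@le_trans _ _ (Ew n (fun u => Ew n (fun v =>
   (M u / b u) * (rho u v)%:R + (N v / a v) * (rho u v)%:R)))).
  by apply: Ew_le => u su; apply: Ew_le => v sv; exact: key.
have -> : Ew n (fun u => Ew n (fun v =>
   (M u / b u) * (rho u v)%:R + (N v / a v) * (rho u v)%:R)) =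
   Ew n (fun u => M u / b u * b u) + Ew n (fun v => N v / a v * a v).
  under Ew_ext => u _ do rewrite EwD.
  rewrite EwD; congr (_ + _); first by apply: Ew_ext => u _; rewrite EwZ.
  by rewrite Ew_exch; apply: Ew_ext => u _; rewrite EwZ.
apply: lerD; apply: Ew_le => u _.
  have [->|nz] := eqVneq (b u) 0; first by rewrite mulr0; (exact: M0 || exact: N0).
  by rewrite divfK.
have [->|nz] := eqVneq (a u) 0; first by rewrite mulr0; (exact: M0 || exact: N0).
by rewrite divfK.
Qed.

(** The value [true] on empty words lets [dif_cat] pass to prefixes of any length, including 0,
    where the first letters are no longer visible. *)
Definition dif (u v : seq 'I_k) : bool :=
  match u, v with i :: _, j :: _ => i != j | _, _ => true end.

(** Pairs are sorted by the length j of their common prefix w, cut off at n. That the second word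
    also starts with w costs one factor [pw w]; what remains is one expectation over w and two
    independent tails. *)
Lemma Ew_pair_decomp n L (F : seq 'I_k -> seq 'I_k -> R) : (n <= L)%N ->
  (forall u v, 0 <= F u v) ->
  Ew L (fun u => Ew L (fun v => F u v)) <=
  \sum_(j < n) Ew j (fun w => pw w * Ew (L - j) (fun u => Ew (L - j) (fun v =>
      (dif u v)%:R * F (w ++ u) (w ++ v)))) +
  Ew n (fun w => pw w * Ew (L - n) (fun u => Ew (L - n) (fun v => F (w ++ u) (w ++ v)))).
Proof.
elim: n L F => [|n IH] L F nL F0.
  by rewrite big_ord0 add0r subn0 /= /pw big_nil mul1r.
case: L nL => // L nL.
rewrite big_ord_recl /= /pw big_nil mul1r -/pw /=.
have -> : \sum_(i < k) p i * Ew L (fun u => \sum_(i0 < k) p i0 * Ew L (fun v => F (i :: u) (i0 :: v)))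
  = \sum_(i < k) p i * \sum_(j < k) p j * Ew L (fun u => Ew L (fun v => F (i :: u) (j :: v))).
  apply: eq_bigr => i _; congr (_ * _); rewrite Ew_sum; apply: eq_bigr => j _.
  by rewrite EwZ.
have -> : \sum_(i < k) p i * Ew L (fun u => \sum_(i0 < k) p i0 *
     Ew L (fun v => (i != i0)%:R * F (i :: u) (i0 :: v))) =
  \sum_(i < k) p i * \sum_(j < k) p j * ((i != j)%:R * Ew L (fun u => Ew L (fun v => F (i :: u) (j :: v)))).
  apply: eq_bigr => i _; congr (_ * _); rewrite Ew_sum; apply: eq_bigr => j _.
  rewrite EwZ; congr (_ * _); rewrite -EwZ; apply: Ew_ext => u _; by rewrite EwZ.
set T1 := \sum_(i < k) _ * _; set T2 := \sum_(i < k) _ * _.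
(* [T2] keeps the pairs with different first letters; the diagonal that remains carries p i twice,
   once for each word. *)
have -> : T1 = T2 + \sum_(i < k) p i * (p i * Ew L (fun u => Ew L (fun v => F (i :: u) (i :: v)))).
  rewrite /T1 /T2 -big_split /=; apply: eq_bigr => i _; rewrite -mulrDr; congr (_ * _).
  rewrite (bigD1 i) //= [X in _ = X + _](bigD1 i) //= eqxx mul0r mulr0 add0r addrC.
  by congr (_ + _); apply: eq_bigr => j; rewrite eq_sym => ->; rewrite mul1r.
rewrite -addrA lerD2l.
apply: (@le_trans _ _ (\sum_(i < k) p i * (p i * (
  \sum_(j < n) Ew j (fun w => pw w * Ew (L - j) (fun u => Ew (L - j) (fun v =>
      (dif u v)%:R * F (i :: w ++ u) (i :: w ++ v)))) +
  Ew n (fun w => pw w * Ew (L - n) (fun u => Ew (L - n) (fun v => F (i :: w ++ u) (i :: w ++ v)))))))).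
  apply: ler_sum => i _; do 2! (apply: ler_wpM2l; first exact: ltW).
  exact: (IH L (fun u v => F (i :: u) (i :: v))).
rewrite le_eqVlt; apply/orP; left; apply/eqP.
rewrite exchange_big /= -big_split /=; apply: eq_bigr => i _.
rewrite mulrDr mulrDr mulr_sumr mulr_sumr; congr (_ + _).
  apply: eq_bigr => j _; congr (_ * _); rewrite -EwZ; apply: Ew_ext => w _.
  by rewrite /pw big_cons -mulrA.
by congr (_ * _); rewrite -EwZ; apply: Ew_ext => w _; rewrite /pw big_cons -mulrA.


Qed.

End WordExpectation.

(** * Jets of coded points *)

Section ComplexNorm.
Variable R : realType.
Implicit Types x y : R[i].

(* The norm `|x| of x : R[i] lies in R[i]; nm x is the modulus as an element of R. *)
Definition nm x : R := Normc.normc x.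

Arguments nm : simpl never.

Lemma nm_ge0 x : 0 <= nm x.
Proof. by case: x => a b; rewrite /nm /= sqrtr_ge0. Qed.
Lemma nm0 : nm 0 = 0. Proof. exact: Normc.normc0. Qed.
Lemma nm1 : nm 1 = 1. Proof. exact: Normc.normc1. Qed.
Lemma nmM x y : nm (x * y) = nm x * nm y. Proof. exact: Normc.normcM. Qed.
Lemma nmV x : nm x^-1 = (nm x)^-1. Proof. exact: Normc.normcV. Qed.
Lemma nmD x y : nm (x + y) <= nm x + nm y. Proof. exact: (@le_normcD R x y). Qed.
Lemma nmN x : nm (- x) = nm x. Proof. exact: (@normcN R x). Qed.
Lemma nm_eq0 x : nm x = 0 -> x = 0. Proof. exact: Normc.eq0_normc. Qed.
Lemma nmB x y : nm (x - y) <= nm x + nm y.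
Proof. by rewrite -[nm y]nmN nmD. Qed.
Lemma nmBC x y : nm (x - y) = nm (y - x).
Proof. by rewrite -nmN opprB. Qed.
Lemma nm_tri x y : nm x <= nm y + nm (x - y).
Proof. by rewrite -{1}[x](subrK y) addrC nmD. Qed.
Lemma nmX x n : nm (x ^+ n) = nm x ^+ n.
Proof. by elim: n => [|n IH]; rewrite ?expr0 ?nm1 // !exprS nmM IH. Qed.
Lemma nm_nat n : nm n%:R = n%:R.
Proof.
rewrite -[n%:R]/(1 *+ n) /nm (@normcMn R 1 n).
by rewrite -/(nm 1) nm1.
Qed.
Lemma nm_prod (I : Type) (r : seq I) (F : I -> R[i]) :
  nm (\prod_(i <- r) F i) = \prod_(i <- r) nm (F i).
Proof. by elim/big_rec2: _ => [|i a b _ <-]; rewrite ?nm1 // nmM. Qed.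
Lemma nm_sum (I : Type) (r : seq I) (P : pred I) (F : I -> R[i]) :
  nm (\sum_(i <- r | P i) F i) <= \sum_(i <- r | P i) nm (F i).
Proof.
elim/big_rec2: _ => [|i a b _ H]; first by rewrite nm0.
by apply: le_trans (nmD _ _) _; rewrite lerD2l.
Qed.
Lemma nm_gt0 x : x != 0 -> 0 < nm x.
Proof.
move=> x0; rewrite lt_neqAle nm_ge0 andbT eq_sym; apply: contra x0 => /eqP h.
by apply/eqP/nm_eq0.
Qed.

End ComplexNorm.
Arguments nm {R} x : simpl never.

Section Jets.
Variables (R : realType) (k : nat).
Local Notation C := R[i].
Variable t : 'I_k -> C.
Implicit Types (lam : 'I_k -> C) (u v : seq 'I_k) (l n : nat).

(* [jet lam u l] is the coefficient of h^l in the point coded by u for the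
   parameter (1 + h) * lam. *)
Fixpoint jet lam u l : C :=
  if u is i :: u' then
    (l == 0)%:R * t i + lam i * (jet lam u' l + (if l is l'.+1 then jet lam u' l' else 0))
  else 0.

Definition lamw lam u : C := \prod_(i <- u) lam i.

(** The tail v enters through (1 + h)^|u| [lamw lam u]; the binomials are the Taylor coefficients of
    (1 + h)^|u|. *)
Lemma jet_cat lam u v l :
  jet lam (u ++ v) l =
  jet lam u l + lamw lam u * \sum_(i < l.+1) 'C(size u, l - i)%:R * jet lam v i.
Proof.
elim: u l => [|i u IH] l /=.
  rewrite /lamw big_nil mul1r add0r big_ord_recr /= subnn bin0 mul1r.
  rewrite big1 ?add0r // => j _; rewrite bin0n subn_eq0.
  by rewrite leqNgt ltn_ord mul0r.
rewrite /lamw big_cons -/(lamw lam u).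
have P : \sum_(i0 < l.+1) 'C((size u).+1, l - i0)%:R * jet lam v i0 =
   \sum_(i0 < l.+1) 'C(size u, l - i0)%:R * jet lam v i0 +
   (if l is l'.+1 then \sum_(i0 < l'.+1) 'C(size u, l' - i0)%:R * jet lam v i0 else 0).
  case: l => [|l]; first by rewrite !big_ord1 subnn !bin0 addr0.
  rewrite big_ord_recr [in RHS]big_ord_recr /= subnn !bin0 addrAC; congr (_ + _).
  rewrite -big_split /=; apply: eq_bigr => j _.
  by rewrite subSn ?binS ?natrD ?mulrDl // -ltnS.
rewrite P; case: l {P} => [|l]; rewrite !IH; ring.
Qed.

Lemma jet_oversize lam u l : (size u <= l)%N -> jet lam u l = 0.
Proof.
elim: u l => [//|i u IH] [//|l] /= H.
by rewrite !IH //; [ring | exact: leqW].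
Qed.

(** Scaling (1 + h) lam by 1 + h' is scaling lam by 1 + (h + (1 + h) h'). The sum is the polynomial
    re-expanded at h, and each power of h' brings one factor 1 + h. *)
Lemma jet_shift lam u l h N : (size u <= N)%N ->
  jet (fun i => (1 + h) * lam i) u l =
  (1 + h) ^+ l * \sum_(q < N) 'C(l + q, l)%:R * jet lam u (l + q) * h ^+ q.
Proof.
elim: u l N => [|i u IH] l N /= su.
  by rewrite big1 ?mulr0 // => q _; rewrite mulr0 mul0r.
case: N su => // N su.
have shiftE l' : \sum_(q < N.+1) 'C(l' + q, l')%:R * jet lam u (l' + q) * h ^+ q =
   \sum_(q < N) 'C(l' + q, l')%:R * jet lam u (l' + q) * h ^+ q.
  rewrite big_ord_recr /= [jet _ _ (_ + _)]jet_oversize ?mulr0 ?mul0r ?addr0 //; lia.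
case: l => [|l].
  rewrite (IH 0%N N su) !expr0 !mul1r addr0.
  rewrite big_ord_recl /= bin0 !mul1r expr0 mulr1 addr0.
  have -> : \sum_(i0 < N) 'C(bump 0 i0, 0)%:R * (0 * t i + lam i * (jet lam u (bump 0 i0) + jet lam u i0)) * h ^+ bump 0 i0
    = lam i * (\sum_(q < N) 'C(0 + bump 0 q, 0)%:R * jet lam u (0 + bump 0 q) * h ^+ bump 0 q
       + h * \sum_(q < N) 'C(0 + q, 0)%:R * jet lam u (0 + q) * h ^+ q).
    rewrite mulr_sumr -big_split mulr_sumr /=; apply: eq_bigr => q _.
    by rewrite !bin0 !add0n /bump /= add1n exprS; ring.
  have := shiftE 0%N; rewrite big_ord_recl /= bin0 expr0 mulr1 mul1r add0n => E.
  set A := \sum_(q < N) _ * h ^+ bump 0 q in E *.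
  rewrite -E; ring.
rewrite (IH l.+1 N su) (IH l N su) /= mul0r add0r.
rewrite [X in _ = _ * X](_ : _ =
   lam i * (\sum_(q < N.+1) 'C(l.+1 + q, l.+1)%:R * jet lam u (l.+1 + q) * h ^+ q
   + (\sum_(q < N.+1) 'C(l + q, l)%:R * jet lam u (l + q) * h ^+ q
   + \sum_(q < N.+1) 'C(l + q, l.+1)%:R * jet lam u (l + q) * h ^+ q))); last first.
  rewrite -!big_split mulr_sumr /=; apply: eq_bigr => q _.
  have -> : 'C(l.+1 + q, l.+1) = ('C(l + q, l) + 'C(l + q, l.+1))%N by rewrite addSn binS addnC.
  rewrite natrD /=; ring.
have -> : \sum_(q < N.+1) 'C(l + q, l.+1)%:R * jet lam u (l + q) * h ^+ q =
   h * \sum_(q < N) 'C(l.+1 + q, l.+1)%:R * jet lam u (l.+1 + q) * h ^+ q.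
  rewrite big_ord_recl /= addn0 bin_small ?mul0r ?add0r // mulr_sumr.
  apply: eq_bigr => q _; rewrite /bump /= add1n !addnS !addSn exprS; ring.
rewrite !shiftE exprS; ring.
Qed.

(** A truncated majorant: with norms of jets as coefficients, one bound for all N controls all jets
    at once and survives the recursion of [jet], where multiplication by 1 + h turns into
    [gen_shift]. *)
Definition gen (a : nat -> R) (x : R) N := \sum_(l < N) a l * x ^+ l.

Lemma gen_shift a x N : 0 <= x -> (forall l, 0 <= a l) ->
  gen (fun l => a l + (if l is l'.+1 then a l' else 0)) x N <= gen a x N + x * gen a x N.
Proof.
move=> x0 a0; rewrite /gen.
under eq_bigr do rewrite mulrDl; rewrite big_split /= lerD2l.
case: N => [|N]; first by rewrite !big_ord0 mulr0.
rewrite big_ord_recl mul0r add0r mulr_sumr [X in _ <= X]big_ord_recr /=.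
rewrite -[X in X <= _]addr0 lerD //.
  by apply: ler_sum => i _; rewrite /bump /= add1n exprS mulrCA.
by rewrite mulr_ge0 // mulr_ge0 // exprn_ge0.
Qed.

Lemma gen_le a b x N : 0 <= x -> (forall l, a l <= b l) -> gen a x N <= gen b x N.
Proof. by move=> x0 ab; apply: ler_sum => l _; rewrite ler_wpM2r ?exprn_ge0. Qed.

Lemma genD a b x N : gen (fun l => a l + b l) x N = gen a x N + gen b x N.
Proof. by rewrite /gen -big_split /=; apply: eq_bigr => l _; rewrite mulrDl. Qed.

Lemma genZ c a x N : gen (fun l => c * a l) x N = c * gen a x N.
Proof. by rewrite /gen mulr_sumr; apply: eq_bigr => l _; rewrite mulrA. Qed.

Lemma gen_coef a x N l : 0 <= x -> (forall l, 0 <= a l) -> (l < N)%N ->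
  a l * x ^+ l <= gen a x N.
Proof.
move=> x0 a0 lN; rewrite /gen (bigD1 (Ordinal lN)) //= lerDl sumr_ge0 // => i _.
by rewrite mulr_ge0 ?exprn_ge0.
Qed.

Lemma gen_delta c x N : 0 <= c -> gen (fun l => (l == 0)%:R * c) x N <= c.
Proof.
move=> c0; rewrite /gen; case: N => [|N]; first by rewrite big_ord0.
rewrite big_ord_recl /= expr0 mulr1 mul1r big1 ?addr0 // => l _.
by rewrite mul0r mul0r.
Qed.

Section Bounds.
Variables (rho tau x : R).
Hypotheses (rho0 : 0 <= rho) (x0 : 0 <= x) (rhox : rho * (1 + x) < 1).
Hypothesis t_le : forall i, nm (t i) <= tau.

(** One more letter turns a bound M into tau + rho (1 + x) M. The stated value is the fixed point of
    this affine map, hence independent of the word length. *)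
Lemma gen_jet lam u N : 0 <= tau -> (forall i, nm (lam i) <= rho) ->
  gen (fun l => nm (jet lam u l)) x N <= tau / (1 - rho * (1 + x)).
Proof.
move=> tau0 Hlam; set M := tau / _.
have d0 : 0 < 1 - rho * (1 + x) by rewrite subr_gt0.
have ME : M = tau + rho * (1 + x) * M.
  by rewrite /M; field; rewrite gt_eqF.
have M0 : 0 <= M by rewrite divr_ge0 // ltW.
elim: u => [|i u IH].
  by rewrite /gen big1 // => l _; rewrite /= nm0 mul0r.
apply: (@le_trans _ _ (gen (fun l => (l == 0)%:R * tau + rho *
   (nm (jet lam u l) + (if l is l'.+1 then nm (jet lam u l') else 0))) x N)).
  apply: gen_le => // l /=; apply: le_trans (nmD _ _) _; apply: lerD.
    by rewrite nmM nm_nat ler_wpM2l ?ler0n.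
  rewrite nmM; apply: ler_pM; rewrite ?nm_ge0 //.
  by case: l => [|l]; [rewrite !addr0 | exact: nmD].
rewrite genD genZ; rewrite [M]ME; apply: lerD.
  exact: gen_delta.
rewrite -mulrA ler_wpM2l //.
apply: le_trans (gen_shift _ _ _) _ => //; first by move=> l; exact: nm_ge0.
rewrite mulrDl mul1r lerD // ler_wpM2l //.
Qed.

(** Each letter adds an error e (1 + x) M, with M from [gen_jet], and contracts the previous error
    by rho (1 + x). The bound is again the fixed point. *)
Lemma gen_jet_lip lam lam' e u N : 0 <= tau -> 0 <= e ->
  (forall i, nm (lam i) <= rho) -> (forall i, nm (lam' i) <= rho) ->
  (forall i, nm (lam i - lam' i) <= e) ->
  gen (fun l => nm (jet lam u l - jet lam' u l)) x N <=
  e * ((1 + x) * (tau / (1 - rho * (1 + x))) / (1 - rho * (1 + x))).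
Proof.
move=> tau0 e0 Hlam Hlam' He; set M := tau / _.
have d0 : 0 < 1 - rho * (1 + x) by rewrite subr_gt0.
set B := (X in _ <= X).
have BE : B = e * ((1 + x) * M) + rho * ((1 + x) * B).
  by rewrite /B; field; rewrite gt_eqF.
have M0 : 0 <= M by rewrite divr_ge0 // ltW.
have B0 : 0 <= B.
  by rewrite mulr_ge0 // divr_ge0 ?(ltW d0) // mulr_ge0 // addr_ge0.
elim: u => [|i u IH].
  by rewrite /gen big1 // => l _; rewrite /= subr0 nm0 mul0r.
apply: (@le_trans _ _ (gen (fun l =>
   e * (nm (jet lam u l) + (if l is l'.+1 then nm (jet lam u l') else 0)) +
   rho * (nm (jet lam u l - jet lam' u l) +
     (if l is l'.+1 then nm (jet lam u l' - jet lam' u l') else 0))) x N)).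
  apply: gen_le => // l /=.
  have -> : (l == 0)%:R * t i + lam i * (jet lam u l + match l with 0 => 0 | l'.+1 => jet lam u l' end) -
    ((l == 0)%:R * t i + lam' i * (jet lam' u l + match l with 0 => 0 | l'.+1 => jet lam' u l' end)) =
    (lam i - lam' i) * (jet lam u l + match l with 0 => 0 | l'.+1 => jet lam u l' end) +
    lam' i * ((jet lam u l - jet lam' u l) + match l with 0 => 0 | l'.+1 => jet lam u l' - jet lam' u l' end).
    by case: l => [|l]; ring.
  apply: le_trans (nmD _ _) _; rewrite !nmM; apply: lerD; apply: ler_pM; rewrite ?nm_ge0 //.
    by case: l => [|l]; [rewrite !addr0 | exact: nmD].
  by case: l => [|l]; [rewrite !addr0 | exact: nmD].
rewrite genD !genZ BE; apply: lerD; apply: ler_wpM2l => //;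
  (apply: le_trans (gen_shift _ _ _) _ => //; first by move=> l; exact: nm_ge0).
  by rewrite -{1}[gen _ x N]mul1r -mulrDl ler_wpM2l ?addr_ge0 ?gen_jet.
by rewrite -{1}[gen _ x N]mul1r -mulrDl ler_wpM2l ?addr_ge0.
Qed.

End Bounds.

(** The binomials are at most 2^(l + q). This is why the majorant is taken at 2 x: the powers of 2
    reduce the radius to x, and the tail keeps the factor (|h| / x)^P. *)
Lemma taylor_tail (g : nat -> C) (x M : R) l h P N : 0 < x -> nm h <= x ->
  (forall N, gen (fun l => nm (g l)) (2 * x) N <= M) -> (P <= N)%N ->
  nm (\sum_(q < N) 'C(l + q, l)%:R * g (l + q)%N * h ^+ q -
      \sum_(q < P) 'C(l + q, l)%:R * g (l + q)%N * h ^+ q) <=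
  M * x ^- l * (nm h / x) ^+ P.
Proof.
move=> x0 hx HM PN.
have -> : \sum_(q < N) 'C(l + q, l)%:R * g (l + q)%N * h ^+ q -
      \sum_(q < P) 'C(l + q, l)%:R * g (l + q)%N * h ^+ q =
    \sum_(P <= q < N) 'C(l + q, l)%:R * g (l + q)%N * h ^+ q.
  rewrite -(big_mkord xpredT (fun q => 'C(l + q, l)%:R * g (l + q)%N * h ^+ q)).
  rewrite -(big_mkord xpredT (fun q => 'C(l + q, l)%:R * g (l + q)%N * h ^+ q)).
  by rewrite (@big_cat_nat _ _ _ P) //= addrAC subrr add0r.
apply: le_trans (nm_sum _ _ _) _.
have y0 : 0 <= nm h / x by rewrite divr_ge0 ?nm_ge0 // ltW.
have y1 : nm h / x <= 1 by rewrite ler_pdivrMr // mul1r.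
apply: (@le_trans _ _ (\sum_(P <= q < N) (nm (g (l + q)%N) * (2 * x) ^+ (l + q)) * (x ^- l * (nm h / x) ^+ P))).
  apply: ler_sum_nat => q /andP[Pq qN]; rewrite !nmM nm_nat nmX.
  have -> : nm h ^+ q = x ^+ (l + q) * (x ^- l * (nm h / x) ^+ q).
    by rewrite exprD exprMn exprVn; field; rewrite !expf_neq0 // gt_eqF.
  have bin2 : ('C(l + q, l)%:R : R) <= 2 ^+ (l + q).
    rewrite -natrX ler_nat -[2%N]/(1 + 1)%N expnDn.
    have lq : (l < (l + q).+1)%N by rewrite ltnS leq_addr.
    by rewrite (bigD1 (Ordinal lq)) //= !exp1n !muln1 leq_addr.
  have -> : 'C(l + q, l)%:R * nm (g (l + q)%N) * (x ^+ (l + q) * (x ^- l * (nm h / x) ^+ q)) =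
    'C(l + q, l)%:R * (nm (g (l + q)%N) * x ^+ (l + q)) * (x ^- l * (nm h / x) ^+ q) by ring.
  have -> : nm (g (l + q)%N) * (2 * x) ^+ (l + q) =
    2 ^+ (l + q) * (nm (g (l + q)%N) * x ^+ (l + q)) by rewrite exprMn mulrCA.
  apply: ler_pM.
  - by rewrite !mulr_ge0 ?ler0n ?nm_ge0 ?exprn_ge0 // ltW.
  - by rewrite mulr_ge0 ?exprn_ge0 // invr_ge0 exprn_ge0 // ltW.
  - by rewrite ler_wpM2r // mulr_ge0 ?nm_ge0 ?exprn_ge0 // ltW.
  - have yq : (nm h / x) ^+ q <= (nm h / x) ^+ P.
      by rewrite -(subnKC Pq) exprD ler_piMr ?exprn_ge0 // exprn_ile1.
    by apply: ler_wpM2l yq; rewrite invr_ge0 exprn_ge0 // ltW.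
rewrite -mulr_suml -mulrA ler_wpM2r ?mulr_ge0 ?invr_ge0 ?exprn_ge0 ?(ltW x0) //.
apply: le_trans (HM (l + N)%N); rewrite /gen.
rewrite -(big_mkord xpredT (fun q => nm (g q) * (2 * x) ^+ q)).
rewrite [X in _ <= X](@big_cat_nat _ _ _ (l + P)%N) ?leq_add2l //=.
apply: ler_wpDl.
  by rewrite sumr_ge0 // => q _; rewrite mulr_ge0 ?nm_ge0 ?exprn_ge0 // mulr_ge0 ?ltW.
rewrite [(l + P)%N]addnC big_addn [(l + N)%N]addnC addnK le_eqVlt; apply/orP; left.
by apply/eqP; apply: eq_bigr => q _; rewrite addnC.
Qed.

End Jets.

(** * Typical words *)

Section Prelim.
Variable R : realType.

Lemma bin_le_exp n l : ('C(n, l) <= n.+1 ^ l)%N.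
Proof.
elim: l n => [|l IH] n; first by rewrite bin0.
elim: n => [//|n IHn]; rewrite binS.
apply: leq_trans (leq_add IHn (IH n)) _.
have h : (n.+1 ^ l <= n.+2 ^ l)%N by case: (l) => // l'; rewrite leq_exp2r.
rewrite !expnS; move: h; move: (n.+1 ^ l)%N (n.+2 ^ l)%N => a b h; nia.
Qed.

Lemma poly_le_expR (e : R) s : 0 < e ->
  exists2 C : R, 1 <= C & forall n : nat, (n.+1%:R : R) ^+ s <= C * expR (e * n%:R).
Proof.
elim: s e => [|s IH] e e0.
  exists 1 => // n; rewrite expr0 mul1r; apply: le_trans (expR_ge1Dx _).
  by rewrite lerDl mulr_ge0 // ltW.
have e2 : 0 < e / 2 by rewrite divr_gt0.
have [C C1 HC] := IH _ e2.
have D1 : 1 <= 1 + 2 / e by rewrite lerDl divr_ge0 // ltW.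
exists (C * (1 + 2 / e)) => [|n]; first by rewrite (le_trans C1) // ler_peMr // (le_trans _ C1).
have -> : expR (e * n%:R) = expR (e / 2 * n%:R) * expR (e / 2 * n%:R).
  by rewrite -expRD; congr expR; field.
rewrite exprSr mulrACA; apply: ler_pM => //; rewrite ?exprn_ge0 //.
apply: le_trans (_ : (1 + 2 / e) * (1 + e / 2 * n%:R) <= _); last first.
  by rewrite ler_wpM2l ?expR_ge1Dx // (le_trans _ D1).
have -> : (1 + 2 / e) * (1 + e / 2 * n%:R) = 1 + n%:R + (2 / e + e / 2 * n%:R).
  by field; rewrite gt_eqF.
rewrite -nat1r lerDl; apply: addr_ge0; first by rewrite divr_ge0 // ltW.
by rewrite mulr_ge0 // divr_ge0 // ltW.
Qed.

End Prelim.

Section Unipotent.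
Variable R : realType.

(** The binomial matrix is lower triangular with diagonal 1 and is inverted by forward substitution.
    Its entries are polynomial in n, hence so is the loss. *)
Lemma unip (x : nat -> R[i]) n s (r : R) : 0 <= r ->
  (forall l, (l < s)%N -> nm (\sum_(i < l.+1) 'C(n, l - i)%:R * x i) <= r) ->
  forall l, (l < s)%N -> nm (x l) <= 2 ^+ l * n.+1%:R ^+ l * r.
Proof.
move=> r0 H l; elim/ltn_ind: l => l IH ls.
have := H l ls; rewrite big_ord_recr /= subnn bin0 mul1r => Hl.
set S := \sum_(i < l) _ in Hl.
have -> : x l = (S + x l) - S by rewrite addrC addKr.
apply: le_trans (nmB _ _) _.
have HS : nm S <= \sum_(i < l) (n.+1%:R ^+ l * r) * 2 ^+ i.
  apply: le_trans (nm_sum _ _ _) _; apply: ler_sum => i _; rewrite nmM nm_nat.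
  have hi := IH i (ltn_ord i) (ltn_trans (ltn_ord i) ls).
  apply: le_trans (_ : n.+1%:R ^+ (l - i) * (2 ^+ i * n.+1%:R ^+ i * r) <= _).
    apply: ler_pM => //; first exact: nm_ge0.
    by rewrite -natrX ler_nat bin_le_exp.
  have -> : (n.+1%:R : R) ^+ l = n.+1%:R ^+ (l - i) * n.+1%:R ^+ i.
    by rewrite -exprD subnK // ltnW.
  by rewrite le_eqVlt; apply/orP; left; apply/eqP; ring.
rewrite -mulr_sumr in HS.
have G : \sum_(i < l) (2 : R) ^+ i = 2 ^+ l - 1.
  elim: (l) => [|j IHj]; first by rewrite big_ord0 expr0 subrr.
  by rewrite big_ord_recr /= IHj exprS; ring.
rewrite G in HS.
have n1 : 1 <= (n.+1%:R : R) ^+ l by rewrite exprn_ege1 // ler1n.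
move: HS Hl n1; set a := n.+1%:R ^+ l; set b := 2 ^+ l.
move: (nm S) (nm (S + x l)) => u v HS Hl n1.
apply: le_trans (lerD Hl HS) _.
have -> : b * a * r = r + a * r * (b - 1) + r * (a - 1) by ring.
by rewrite lerDl mulr_ge0 // subr_ge0.
Qed.

End Unipotent.

Section Typical.
Variables (R : realType) (k : nat).
Implicit Types (u v : seq 'I_k) (x : 'I_k -> R).

Definition wsum x u : R := \sum_(i <- u) x i.

(** Deviations are controlled along all prefixes, not only at full length, so that the property
    passes to prefixes and, with a larger constant, to tails. The additive K makes the exceptional
    probability small uniformly in the length. *)
Definition dev x (m eps K : R) u : bool :=
  all (fun j => `|wsum x (take j u) - j%:R * m| <= eps * j%:R + K) (iota 0 (size u).+1).

Lemma wsum_cat x u v : wsum x (u ++ v) = wsum x u + wsum x v.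
Proof. exact: big_cat. Qed.

Lemma devP x m eps K u :
  reflect (forall j, (j <= size u)%N -> `|wsum x (take j u) - j%:R * m| <= eps * j%:R + K)
          (dev x m eps K u).
Proof.
apply: (iffP allP) => H j; first by move=> jn; apply: H; rewrite mem_iota /= ltnS.
by rewrite mem_iota /= add0n ltnS => /H.
Qed.

Lemma dev_full x m eps K u : dev x m eps K u ->
  `|wsum x u - (size u)%:R * m| <= eps * (size u)%:R + K.
Proof. by move/devP => /(_ _ (leqnn _)); rewrite take_size. Qed.

Lemma dev_prefix x m eps K u v : dev x m eps K (u ++ v) -> dev x m eps K u.
Proof.
move/devP => H; apply/devP => j ju.
have := H j; rewrite size_cat => /(_ (leq_trans ju (leq_addr _ _))).
by rewrite takel_cat.
Qed.

Lemma dev_mono x m eps K K' u : K <= K' -> dev x m eps K u -> dev x m eps K' u.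
Proof.
by move=> KK /devP H; apply/devP => j /H h; apply: (le_trans h); rewrite lerD2l.
Qed.

(** A partial sum of the tail is the difference of two prefix sums, and their errors add up. *)
Lemma dev_tail x m eps K u v : dev x m eps K (u ++ v) ->
  dev x m eps (2 * K + 2 * eps * (size u)%:R) v.
Proof.
move=> H; have H1 := dev_full (dev_prefix H); move/devP: H => H.
apply/devP => j jv.
have := H (size u + j)%N; rewrite size_cat leq_add2l => /(_ jv).
rewrite take_cat ltnNge leq_addr /= addKn wsum_cat natrD => H2.
move: H1 H2; move: (wsum x u) (wsum x (take j v)) ((size u)%:R) (j%:R : R) => a b n y.
by rewrite !ler_norml => /andP[? ?] /andP[? ?]; apply/andP; split; lra.
Qed.

End Typical.

(** * Correlation energies *)

Section Energies.
Variables (R : realType) (k : nat) (p : 'I_k -> R) (t : 'I_k -> R[i]) (chi : 'I_k -> R).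
Variables (Chi H eps : R).
Implicit Types (u v w : seq 'I_k) (lam : 'I_k -> R[i]) (K r : R) (s n L : nat).

Definition typ K u : bool :=
  dev chi Chi eps K u && dev (fun i => - ln (p i)) H eps K u.

Definition small lam r s u v : bool :=
  all (fun l => nm (jet t lam u l - jet t lam v l) <= r) (iota 0 s).

(* PhiF is the correlation energy: the probability that two independent typical words of length L
   have their first s jets within r. PsiF is its part on pairs with distinct first letters. *)
Definition PhiF lam s L K r : R :=
  Ew p L (fun u => Ew p L (fun v => [&& typ K u, typ K v & small lam r s u v]%:R)).

Definition PsiF lam s L K r : R :=
  Ew p L (fun u => Ew p L (fun v => [&& dif u v, typ K u, typ K v & small lam r s u v]%:R)).

(* chi i is minus the logarithm of the contraction ratio at a base point; lam ranges over parameters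
   near that point. *)
Definition inB (rho : R) lam : Prop :=
  forall i, expR (- chi i - eps) <= nm (lam i) <= expR (- chi i + eps) /\ nm (lam i) <= rho.

Lemma smallP lam r s u v :
  reflect (forall l, (l < s)%N -> nm (jet t lam u l - jet t lam v l) <= r) (small lam r s u v).
Proof.
apply: (iffP allP) => h l; first by move=> ls; apply: h; rewrite mem_iota.
by rewrite mem_iota /= add0n => /h.
Qed.

Lemma small_mono lam r r' s s' u v : r <= r' -> (s' <= s)%N ->
  small lam r s u v -> small lam r' s' u v.
Proof.
by move=> rr ss /smallP h; apply/smallP => l ls; apply: le_trans rr; apply/h/(leq_trans ls).
Qed.

Lemma typ_mono K K' u : K <= K' -> typ K u -> typ K' u.
Proof. by move=> KK /andP[h1 h2]; rewrite /typ (dev_mono KK h1) (dev_mono KK h2). Qed.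

Lemma typ_prefix K u v : typ K (u ++ v) -> typ K u.
Proof. by move=> /andP[h1 h2]; rewrite /typ (dev_prefix h1) (dev_prefix h2). Qed.

Lemma typ_tail K u v : typ K (u ++ v) -> typ (2 * K + 2 * eps * (size u)%:R) v.
Proof. by move=> /andP[h1 h2]; rewrite /typ (dev_tail h1) (dev_tail h2). Qed.

Hypothesis p_gt0 : forall i, 0 < p i.
Hypothesis p_sum : \sum_(i < k) p i = 1.

Local Notation E := (Ew p).

Lemma bool_le (a b : bool) : (a -> b) -> (a%:R : R) <= b%:R.
Proof. by case: a; case: b => // h; have := h isT. Qed.

Lemma PhiF_mono lam s s' L K K' r r' : K <= K' -> r <= r' -> (s' <= s)%N ->
  PhiF lam s L K r <= PhiF lam s' L K' r'.
Proof.
move=> KK rr ss; apply: Ew_le => // u _; apply: Ew_le => // v _; apply: bool_le.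
by move=> /and3P[h1 h2 h3]; rewrite (typ_mono KK h1) (typ_mono KK h2) (small_mono rr ss h3).
Qed.

Lemma PsiF_mono lam s s' L K K' r r' : K <= K' -> r <= r' -> (s' <= s)%N ->
  PsiF lam s L K r <= PsiF lam s' L K' r'.
Proof.
move=> KK rr ss; apply: Ew_le => // u _; apply: Ew_le => // v _; apply: bool_le.
move=> /and4P[h0 h1 h2 h3].
by rewrite h0 (typ_mono KK h1) (typ_mono KK h2) (small_mono rr ss h3).
Qed.

Lemma PhiF_ge0 lam s L K r : 0 <= PhiF lam s L K r.
Proof. by apply: Ew_ge0 => // u _; apply: Ew_ge0. Qed.

Lemma PsiF_ge0 lam s L K r : 0 <= PsiF lam s L K r.
Proof. by apply: Ew_ge0 => // u _; apply: Ew_ge0. Qed.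

Lemma PsiF_le1 lam s L K r : PsiF lam s L K r <= 1.
Proof.
by do 2! apply: Ew_le_cst => // ? _; case: [&& _, _, _ & _].
Qed.

Lemma wsum_lnp u : pw p u = expR (- wsum (fun i => - ln (p i)) u).
Proof.
rewrite /pw /wsum; elim: u => [|i u IH]; first by rewrite !big_nil oppr0 expR0.
by rewrite !big_cons opprD expRD opprK lnK ?posrE // IH.
Qed.

Lemma pw_le K u : typ K u -> pw p u <= expR (- H * (size u)%:R + eps * (size u)%:R + K).
Proof.
move=> /andP[_ /dev_full]; rewrite wsum_lnp ler_expR ler_norml => /andP[h _]; lra.
Qed.

Lemma lamw_bounds rho lam u : inB rho lam ->
  expR (- wsum chi u - eps * (size u)%:R) <= nm (lamw lam u)
    <= expR (- wsum chi u + eps * (size u)%:R).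
Proof.
move=> B; rewrite /lamw nm_prod /wsum; elim: u => [|i u /andP[h1 h2]].
  by rewrite !big_nil mulr0 oppr0 addr0 expR0 lexx.
rewrite !big_cons /= -nat1r; have [/andP[b1 b2] _] := B i.
have -> : - (chi i + \sum_(j <- u) chi j) - eps * (1 + (size u)%:R) =
  (- chi i - eps) + (- \sum_(j <- u) chi j - eps * (size u)%:R) by ring.
have -> : - (chi i + \sum_(j <- u) chi j) + eps * (1 + (size u)%:R) =
  (- chi i + eps) + (- \sum_(j <- u) chi j + eps * (size u)%:R) by ring.
rewrite (expRD (- chi i - eps)) (expRD (- chi i + eps)).
have P0 : 0 <= \prod_(j <- u) nm (lam j) by apply: prodr_ge0 => j _; exact: nm_ge0.
by apply/andP; split; apply: ler_pM => //; rewrite ?expR_ge0 ?nm_ge0.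
Qed.

(** One eps comes from the deviation of the word, the other from the distance of lam to the base
    point. *)
Lemma lamw_typ rho lam K u : inB rho lam -> typ K u ->
  expR (- Chi * (size u)%:R - 2 * eps * (size u)%:R - K) <= nm (lamw lam u)
    <= expR (- Chi * (size u)%:R + 2 * eps * (size u)%:R + K).
Proof.
move=> B /andP[/dev_full + _]; have /andP[h1 h2] := lamw_bounds u B.
rewrite ler_norml => /andP[g1 g2]; apply/andP; split.
  by apply: le_trans h1; rewrite ler_expR; lra.
by apply: (le_trans h2); rewrite ler_expR; lra.
Qed.

(** * Splitting words into prefixes and tails *)

Section Split.
Variables (rho : R) (S : nat) (jetC Cp : R).
Hypothesis Cj0 : 0 <= jetC.
Hypothesis HCj : forall lam u l, inB rho lam -> (l <= S)%N -> nm (jet t lam u l) <= jetC.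
Hypothesis Cp1 : 1 <= Cp.
Hypothesis HCp : forall n : nat, (n.+1%:R : R) ^+ S <= Cp * expR (eps * n%:R).

Lemma HCp_le n l : (l <= S)%N -> (n.+1%:R : R) ^+ l <= Cp * expR (eps * n%:R).
Proof.
move=> lS; apply: le_trans (HCp n); rewrite -(subnK lS) exprD.
by rewrite ler_peMl ?exprn_ge0 // exprn_ege1 // ler1n.
Qed.

Definition C1 : R := 2 * (S.+1%:R * Cp * jetC).
Definition C2 : R := 2 ^+ S.+1 * Cp.

Lemma C1_ge0 : 0 <= C1.
Proof. by rewrite !mulr_ge0 // (le_trans _ Cp1). Qed.

Lemma C2_ge0 : 0 <= C2.
Proof. by rewrite !mulr_ge0 // ?exprn_ge0 // (le_trans _ Cp1). Qed.

Lemma C2_ge1 : 1 <= C2.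
Proof. by rewrite /C2 (le_trans Cp1) // ler_peMl ?exprn_ege1 ?ler1n // (le_trans _ Cp1). Qed.

Lemma jet_cat_bound lam u v l : inB rho lam -> (l <= S)%N ->
  nm (\sum_(i < l.+1) 'C(size u, l - i)%:R * jet t lam v i) <=
  S.+1%:R * Cp * jetC * expR (eps * (size u)%:R).
Proof.
move=> B lS; apply: le_trans (nm_sum _ _ _) _.
apply: le_trans (_ : \sum_(i < l.+1) Cp * expR (eps * (size u)%:R) * jetC <= _).
  apply: ler_sum => i _; rewrite nmM nm_nat; apply: ler_pM => //; first exact: nm_ge0.
    have h : (l - i <= S)%N by apply: leq_trans lS; exact: leq_subr.
    by apply: le_trans (HCp_le _ h); rewrite -natrX ler_nat bin_le_exp.
  by apply: HCj => //; apply: leq_trans lS; rewrite -ltnS.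
rewrite sumr_const card_ord -[_ *+ _]mulr_natr.
have -> : S.+1%:R * Cp * jetC * expR (eps * (size u)%:R) =
  Cp * expR (eps * (size u)%:R) * jetC * S.+1%:R by ring.
rewrite ler_wpM2l ?ler_nat // !mulr_ge0 ?expR_ge0 //; exact: le_trans Cp1.
Qed.

(** The tails enter multiplied by [lamw], which costs 2 eps n, and by the binomials of [jet_cat],
    whose polynomial size costs the third eps n. *)
Lemma trunc_bound lam K n u1 u2 v1 v2 l : inB rho lam -> size u1 = n -> size v1 = n ->
  typ K u1 -> typ K v1 -> (l <= S)%N ->
  nm ((jet t lam (u1 ++ u2) l - jet t lam (v1 ++ v2) l) - (jet t lam u1 l - jet t lam v1 l)) <=
  C1 * expR (- Chi * n%:R + 3 * eps * n%:R + K).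
Proof.
move=> B su sv Tu Tv lS; rewrite !jet_cat.
set X := \sum_(i < _) _; set Y := \sum_(i < _) _.
have -> : jet t lam u1 l + lamw lam u1 * X - (jet t lam v1 l + lamw lam v1 * Y) -
  (jet t lam u1 l - jet t lam v1 l) = lamw lam u1 * X - lamw lam v1 * Y by ring.
have /andP[_ hu] := lamw_typ B Tu; have /andP[_ hv] := lamw_typ B Tv.
have hX := jet_cat_bound u1 u2 B lS; have hY := jet_cat_bound v1 v2 B lS.
rewrite -/X -/Y su sv in hu hv hX hY.
apply: le_trans (nmB _ _) _; rewrite !nmM.
apply: le_trans (lerD (ler_pM (nm_ge0 _) (nm_ge0 _) hu hX) (ler_pM (nm_ge0 _) (nm_ge0 _) hv hY)) _.
rewrite (_ : - Chi * n%:R + 3 * eps * n%:R + K =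
  (- Chi * n%:R + 2 * eps * n%:R + K) + eps * n%:R); last by ring.
by rewrite (expRD (- Chi * n%:R + 2 * eps * n%:R + K)) /C1 le_eqVlt; apply/orP; left; apply/eqP; ring.
Qed.

Lemma PhiF_trunc lam s n L K r r' : inB rho lam -> (s <= S.+1)%N -> (n <= L)%N ->
  r + C1 * expR (- Chi * n%:R + 3 * eps * n%:R + K) <= r' ->
  PhiF lam s L K r <= PhiF lam s n K r'.
Proof.
move=> B sS nL rr; rewrite /PhiF -(subnKC nL) Ew_cat.
apply: Ew_le => // u1 su1; apply: Ew_le_cst => // u2 su2.
rewrite Ew_cat; apply: Ew_le => // v1 sv1; apply: Ew_le_cst => // v2 sv2.
apply: bool_le => /and3P[h1 h2 /smallP h3].
rewrite (typ_prefix h1) (typ_prefix h2); apply/smallP => l ls.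
apply: le_trans (nm_tri _ (jet t lam (u1 ++ u2) l - jet t lam (v1 ++ v2) l)) _.
rewrite [X in _ + X <= _]nmBC; apply: le_trans rr; apply: lerD; first exact: h3.
apply: trunc_bound => //; [exact: typ_prefix h1 | exact: typ_prefix h2 |].
exact: leq_trans ls sS.
Qed.

(** A common prefix cancels up to the factor [lamw lam u1] and the binomial matrix, which [unip]
    inverts. Closeness at r becomes closeness at r exp (Chi n), up to losses. *)
Lemma tail_rel lam K n (u1 : seq 'I_k) u2 u2' s (r : R) : inB rho lam -> typ K u1 -> size u1 = n ->
  (s <= S.+1)%N -> 0 <= r ->
  (forall l, (l < s)%N -> nm (jet t lam (u1 ++ u2) l - jet t lam (u1 ++ u2') l) <= r) ->
  small lam (2 ^+ S * Cp * r * expR (Chi * n%:R + 3 * eps * n%:R + K)) s u2 u2'.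
Proof.
move=> B Tu su sS r0 Hr; apply/smallP => l ls.
pose x i := lamw lam u1 * (jet t lam u2 i - jet t lam u2' i).
have Hx j : (j < s)%N -> nm (\sum_(i < j.+1) 'C(n, j - i)%:R * x i) <= r.
  move=> js; apply: le_trans (Hr j js); rewrite !jet_cat su le_eqVlt; apply/orP; left.
  apply/eqP; congr nm.
  set X := \sum_(i < _) _ * jet _ _ _ _; set Y := \sum_(i < _) _ * jet _ _ _ _.
  have -> : jet t lam u1 j + lamw lam u1 * X - (jet t lam u1 j + lamw lam u1 * Y) =
    lamw lam u1 * (X - Y) by ring.
  rewrite /X /Y -sumrB mulr_sumr; apply: eq_bigr => i _; rewrite /x; ring.
have := unip r0 Hx ls; rewrite /x nmM => h.
have /andP[lo _] := lamw_typ B Tu; rewrite su in lo.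
have lS : (l <= S)%N by rewrite -ltnS; apply: leq_trans ls sS.
have hp := HCp_le n lS.
have b2 : (2 : R) ^+ l <= 2 ^+ S by rewrite ler_eXn2l // ltr1n.
set N := nm (jet t lam u2 l - _) in h *.
have N0 : 0 <= N by exact: nm_ge0.
have h1 : expR (- Chi * n%:R - 2 * eps * n%:R - K) * N <=
    2 ^+ S * (Cp * expR (eps * n%:R)) * r.
  apply: le_trans (ler_wpM2r N0 lo) _; apply: (le_trans h).
  by apply: ler_wpM2r => //; apply: ler_pM; rewrite ?exprn_ge0.
have -> : N = expR (Chi * n%:R + 2 * eps * n%:R + K) *
    (expR (- Chi * n%:R - 2 * eps * n%:R - K) * N).
  rewrite mulrA -expRD (_ : _ + _ = 0) ?expR0 ?mul1r //; ring.
apply: le_trans (ler_wpM2l (expR_ge0 _) h1) _.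
rewrite (_ : Chi * n%:R + 3 * eps * n%:R + K =
  (Chi * n%:R + 2 * eps * n%:R + K) + eps * n%:R); last by ring.
by rewrite (expRD (_ + _ + _)) le_eqVlt; apply/orP; left; apply/eqP; ring.
Qed.

Lemma dif_cat u1 u2 v1 v2 : size u1 = size v1 -> dif (u1 ++ u2) (v1 ++ v2) -> dif u1 v1.
Proof. by case: u1; case: v1. Qed.

(** For fixed prefixes u1 and v1 the tails are compared through two different affine maps, so their
    closeness is not an event counted by [PhiF]. [Ew_rel_le] reduces it to two tails behind the same
    prefix: both are within r1 of a third point, hence within 2 r1 of each other, and [tail_rel]
    removes the prefix. The 2 explains the power S + 1 in [C2]. *)
Lemma split_le lam s1 s2 n1 L2 K r1 r2 : inB rho lam -> (s1 <= S.+1)%N -> (s2 <= S.+1)%N ->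
  0 <= r1 ->
  E (n1 + L2) (fun u => E (n1 + L2) (fun v =>
    [&& dif u v, typ K u, typ K v, small lam r1 s1 u v & small lam r2 s2 u v]%:R)) <=
  PsiF lam s2 n1 K (r2 + C1 * expR (- Chi * n1%:R + 3 * eps * n1%:R + K)) *
  PhiF lam s1 L2 (2 * K + 2 * eps * n1%:R) (C2 * r1 * expR (Chi * n1%:R + 3 * eps * n1%:R + K)).
Proof.
move=> B s1S s2S r10.
set r3 := r2 + _; set R2 := C2 * _ * _; set K' := 2 * K + _.
rewrite Ew_cat.
have -> : E n1 (fun u => E L2 (fun v => E (n1 + L2) (fun v0 =>
   [&& dif (u ++ v) v0, typ K (u ++ v), typ K v0, small lam r1 s1 (u ++ v) v0
     & small lam r2 s2 (u ++ v) v0]%:R))) =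
   E n1 (fun u1 => E n1 (fun v1 => E L2 (fun u2 => E L2 (fun v2 =>
   [&& dif (u1 ++ u2) (v1 ++ v2), typ K (u1 ++ u2), typ K (v1 ++ v2),
     small lam r1 s1 (u1 ++ u2) (v1 ++ v2) & small lam r2 s2 (u1 ++ u2) (v1 ++ v2)]%:R)))).
  apply: Ew_ext => u1 _; rewrite -[RHS]Ew_exch; apply: Ew_ext => u2 _.
  by rewrite Ew_cat.
rewrite [X in _ <= X]mulrC -EwZ.
apply: Ew_le => // u1 su1; rewrite -EwZ; apply: Ew_le => // v1 sv1.
pose rel u2 v2 := [&& typ K (u1 ++ u2), typ K (v1 ++ v2) & small lam r1 s1 (u1 ++ u2) (v1 ++ v2)].
(* If some pair of tails contributes, truncation shows that the prefixes are close at the enlarged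
   radius [r3]; otherwise both sides vanish. *)
case pre : [&& dif u1 v1, typ K u1, typ K v1 & small lam r3 s2 u1 v1]; last first.
  rewrite mulr0 -[X in _ <= X](Ew_cst p_sum L2 0); apply: Ew_le => // u2 _.
  rewrite -[X in _ <= X](Ew_cst p_sum L2 0); apply: Ew_le => // v2 _.
  have -> // : [&& dif (u1 ++ u2) (v1 ++ v2), typ K (u1 ++ u2), typ K (v1 ++ v2),
     small lam r1 s1 (u1 ++ u2) (v1 ++ v2) & small lam r2 s2 (u1 ++ u2) (v1 ++ v2)] = false.
  apply/negP => /and5P[d T1 T2 _ /smallP sm]; move/negP: pre; apply.
  rewrite (dif_cat _ d) ?su1 ?sv1 // (typ_prefix T1) (typ_prefix T2).
  apply/smallP => l ls.
  apply: le_trans (nm_tri _ (jet t lam (u1 ++ u2) l - jet t lam (v1 ++ v2) l)) _.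
  rewrite [X in _ + X <= _]nmBC; apply: lerD; first exact: sm.
  apply: trunc_bound => //; [exact: typ_prefix T1 | exact: typ_prefix T2 |].
  exact: leq_trans ls s2S.
move: pre => /and4P[_ Tu1 Tv1 _]; rewrite mulr1.
apply: le_trans (_ : E L2 (fun u2 => E L2 (fun v2 => (rel u2 v2)%:R)) <= _).
  apply: Ew_le => // u2 _; apply: Ew_le => // v2 _; apply: bool_le.
  by rewrite /rel => /and5P[_ -> -> -> _].
pose relX u2 u2' := [&& typ K' u2, typ K' u2' & small lam R2 s1 u2 u2'].
have HR2 : R2 = 2 ^+ S * Cp * (2 * r1) * expR (Chi * n1%:R + 3 * eps * n1%:R + K).
  by rewrite /R2 /C2 exprS; ring.
have := @Ew_rel_le _ _ p p_gt0 p_sum L2 rel relX relX.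
rewrite -[X in _ <= X]mulr2n -[X in _ <= X]mulr_natl ler_pM2l //; apply.
  move=> u2 u2' v2 /and3P[a1 a2 /smallP a3] /and3P[b1 b2 /smallP b3].
  have := typ_tail a1; have := typ_tail b1; rewrite su1 -/K' /relX => -> -> /=.
  rewrite HR2; apply: (tail_rel B Tu1) => //; first by rewrite mulr_ge0.
  move=> l ls; have -> : jet t lam (u1 ++ u2) l - jet t lam (u1 ++ u2') l =
    (jet t lam (u1 ++ u2) l - jet t lam (v1 ++ v2) l) - (jet t lam (u1 ++ u2') l - jet t lam (v1 ++ v2) l).
    by ring.
  apply: le_trans (nmB _ _) _; rewrite mulr_natl mulr2n; apply: lerD; [exact: a3 | exact: b3].
move=> u2 v2 v2' /and3P[a1 a2 /smallP a3] /and3P[b1 b2 /smallP b3].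
have := typ_tail a2; have := typ_tail b2; rewrite sv1 -/K' /relX => -> -> /=.
rewrite HR2; apply: (tail_rel B Tv1) => //; first by rewrite mulr_ge0.
move=> l ls; have -> : jet t lam (v1 ++ v2) l - jet t lam (v1 ++ v2') l =
  (jet t lam (u1 ++ u2) l - jet t lam (v1 ++ v2') l) - (jet t lam (u1 ++ u2) l - jet t lam (v1 ++ v2) l).
  by ring.
apply: le_trans (nmB _ _) _; rewrite mulr_natl mulr2n; apply: lerD; [exact: b3 | exact: a3].
Qed.

(** A typical common prefix of length j has weight at most about exp (- H j), and removing it
    magnifies the radius by about exp (Chi j). *)
Lemma pair_decomp lam s n L K r : inB rho lam -> (s <= S.+1)%N -> (n <= L)%N -> 0 <= r ->
  PhiF lam s L K r <=
  \sum_(j < n) expR (- H * j%:R + eps * j%:R + K) *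
     PsiF lam s (L - j) (2 * K + 2 * eps * j%:R)
       (C2 * r * expR (Chi * j%:R + 3 * eps * j%:R + K)) +
  expR (- H * n%:R + eps * n%:R + K).
Proof.
move=> B sS nL r0; rewrite /PhiF.
apply: le_trans (@Ew_pair_decomp _ _ p p_gt0 n L
  (fun u v => [&& typ K u, typ K v & small lam r s u v]%:R) nL _) _ => //.
apply: lerD.
  apply: ler_sum => j _; apply: Ew_le_cst => // w sw.
  case Tw : (typ K w); last first.
    apply: le_trans (_ : 0 <= _); last by rewrite mulr_ge0 ?expR_ge0 ?PsiF_ge0.
    rewrite -[X in _ <= X](mulr0 (pw p w)) ler_wpM2l ?(ltW (pw_gt0 p_gt0 w)) //.
    apply: Ew_le_cst => // u _; apply: Ew_le_cst => // v _.
    case Tc : (typ K (w ++ u)); last by rewrite mulr0.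
    by rewrite (typ_prefix Tc) in Tw.
  apply: ler_pM; first exact/ltW/pw_gt0.
  - by do 2! (apply: Ew_ge0 => // ? _); rewrite mulr_ge0.
  - by rewrite -sw; exact: pw_le.
  apply: Ew_le => // u _; apply: Ew_le => // v _; rewrite -natrM mulnb.
  apply: bool_le => /and4P[d T1 T2 /smallP sm].
  have := typ_tail T1; have := typ_tail T2; rewrite sw d => -> -> /=.
  have := @tail_rel lam K j w u v s r B Tw sw sS r0 sm.
  apply: small_mono => //; rewrite ler_wpM2r ?expR_ge0 // ler_wpM2r // /C2 exprS.
  by rewrite ler_wpM2r ?ler_peMl ?ler1n ?exprn_ge0 // (le_trans _ Cp1).
apply: Ew_le_cst => // w sw.
case Tw : (typ K w); last first.
  apply: le_trans (_ : 0 <= _); last by rewrite expR_ge0.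
  rewrite -[X in _ <= X](mulr0 (pw p w)) ler_wpM2l ?(ltW (pw_gt0 p_gt0 w)) //.
  apply: Ew_le_cst => // u _; apply: Ew_le_cst => // v _.
  case Tc : (typ K (w ++ u)); last by [].
  by rewrite (typ_prefix Tc) in Tw.
rewrite -[X in _ <= X]mulr1; apply: ler_pM; first exact/ltW/pw_gt0.
- by do 2! apply: Ew_ge0 => // ? _.
- by rewrite -sw; exact: pw_le.
by do 2! apply: Ew_le_cst => // ? _; case: [&& _, _ & _].
Qed.

End Split.
End Energies.

(** * Calculus of decay exponents *)

Section Claims.
Variables (R : realType) (k : nat) (p : 'I_k -> R) (t : 'I_k -> R[i]) (chi : 'I_k -> R).
Variables (Chi H eps : R).
Implicit Types (lam : 'I_k -> R[i]) (K r d A C : R) (s n L : nat).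
Local Notation PhiF := (PhiF p t chi Chi H eps).
Local Notation PsiF := (PsiF p t chi Chi H eps).
Local Notation typ := (typ p chi Chi H eps).
Local Notation small := (small t).
Local Notation E := (Ew p).

(* At the scale E_n = exp (- Chi n) the energy decays like E_n ^ d, up to errors exponential in
   eps n; any radius expR K * E_n is allowed, at a cost polynomial in expR K. *)
Definition claim lam s d A C : Prop := forall n K, 0 <= K ->
  PsiF lam s n K (expR (K - Chi * n%:R)) <= C * expR (A * (K + eps * n%:R) - d * Chi * n%:R).

Definition claimPhi lam s d A C : Prop := forall n K, 0 <= K ->
  PhiF lam s n K (expR (K - Chi * n%:R)) <= C * expR (A * (K + eps * n%:R) - d * Chi * n%:R).

Hypothesis p_gt0 : forall i, 0 < p i.
Hypothesis p_sum : \sum_(i < k) p i = 1.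
Hypothesis eps0 : 0 <= eps.
Variables (rho : R) (S : nat) (jetC Cp : R).
Hypothesis S1 : (1 <= S)%N.
Hypothesis Cj0 : 0 <= jetC.
Hypothesis HCj : forall lam u l, inB chi eps rho lam -> (l <= S)%N -> nm (jet t lam u l) <= jetC.
Hypothesis Cp1 : 1 <= Cp.
Hypothesis HCp : forall n : nat, (n.+1%:R : R) ^+ S <= Cp * expR (eps * n%:R).

Local Notation C1 := (C1 S jetC Cp).
Local Notation C2 := (C2 S Cp).
Let C1_0 : 0 <= C1 := C1_ge0 S Cj0 Cp1.
Let C2_0 : 0 <= C2 := C2_ge0 S Cp1.
Lemma expR_ln_ge0 (x : R) : 1 <= x -> expR (ln x) = x /\ 0 <= ln x.
Proof. by move=> x1; rewrite ln_ge0 // lnK // posrE (lt_le_trans _ x1). Qed.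

(** Passing from distinct first letters to all pairs keeps the exponent as long as d Chi <= H: for a
    common prefix of length j, the weight exp (- H j) pays for the magnification exp (d Chi j). The
    number of terms is absorbed in exp (eps n). *)
Lemma claim_phi lam s d A C : inB chi eps rho lam -> (s <= S.+1)%N ->
  0 <= d -> d * Chi <= H -> 0 <= A -> 0 <= C ->
  claim lam s d A C ->
  claimPhi lam s d (3 * A + 2) (Cp * (C * expR (A * ln C2) + 1)).
Proof.
move=> B sS d0 dH A0 C0 cl n K K0.
apply: le_trans (@pair_decomp _ _ p t chi Chi H eps p_gt0 p_sum rho S Cp Cp1 HCp lam s n n K _ B sS (leqnn n) (expR_ge0 _)) _.
have [E2 c20] := expR_ln_ge0 (C2_ge1 S Cp1); set c2 := ln C2 in E2 c20 *.
set M := C * expR (A * c2).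
have M0 : 0 <= M by rewrite mulr_ge0 ?expR_ge0.
set X := expR ((3 * A + 1) * (K + eps * n%:R) - d * Chi * n%:R).
have term j : (j < n)%N ->
   expR (- H * j%:R + eps * j%:R + K) *
     PsiF lam s (n - j) (2 * K + 2 * eps * j%:R)
       (C2 * expR (K - Chi * n%:R) * expR (Chi * j%:R + 3 * eps * j%:R + K)) <= M * X.
  move=> jn.
  have ej : 0 <= eps * j%:R by rewrite mulr_ge0.
  have nj : (n - j)%:R = n%:R - j%:R :> R by rewrite natrB // ltnW.
  (* One constant dominates the typicality constant of the tails, the magnified radius and the
     factor [C2]. *)
  set K2 := 2 * K + 3 * eps * j%:R + c2.
  have K20 : 0 <= K2 by rewrite /K2; lra.
  have h : PsiF lam s (n - j) (2 * K + 2 * eps * j%:R)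
       (C2 * expR (K - Chi * n%:R) * expR (Chi * j%:R + 3 * eps * j%:R + K)) <=
     PsiF lam s (n - j) K2 (expR (K2 - Chi * (n - j)%:R)).
    apply: PsiF_mono => //; first by rewrite /K2; lra.
    rewrite -{1}E2 -mulrA -!expRD ler_expR nj /K2; lra.
  apply: le_trans (ler_wpM2l (expR_ge0 _) (le_trans h (cl _ _ K20))) _.
  rewrite /M -mulrA mulrCA -mulrA; apply: ler_wpM2l => //.
  rewrite -!expRD ler_expR /X nj /K2.
  have e1 : 0 <= eps * n%:R - eps * j%:R by rewrite -mulrBr mulr_ge0 // subr_ge0 ler_nat ltnW.
  have e2 : 0 <= A * (K + 2 * (eps * n%:R - eps * j%:R)).
    by rewrite mulr_ge0 // addr_ge0 // mulr_ge0.
  have e3 : 0 <= (H - d * Chi) * j%:R by rewrite mulr_ge0 // subr_ge0.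
  nra.
apply: le_trans (_ : n%:R * (M * X) + X <= _).
  apply: lerD.
    apply: le_trans (_ : \sum_(j < n) M * X <= _); first by apply: ler_sum => j _; exact: term.
    by rewrite sumr_const card_ord -[_ *+ _]mulr_natl.
  rewrite /X ler_expR.
  have e0 : 0 <= eps * n%:R by rewrite mulr_ge0.
  have e2 : 0 <= A * (K + eps * n%:R) by rewrite mulr_ge0 // addr_ge0.
  have e3 : 0 <= (H - d * Chi) * n%:R by rewrite mulr_ge0 // subr_ge0.
  nra.
have X0 : 0 <= X by rewrite expR_ge0.
apply: le_trans (_ : n.+1%:R * (M + 1) * X <= _).
  rewrite -nat1r; have n0 : 0 <= (n%:R : R) by []; nra.
have hp := HCp_le HCp n S1; rewrite expr1 in hp.
have -> : (3 * A + 2) * (K + eps * n%:R) - d * Chi * n%:R =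
  K + (eps * n%:R + ((3 * A + 1) * (K + eps * n%:R) - d * Chi * n%:R)) by ring.
rewrite (expRD K) (expRD (eps * _)) -/X.
have K1 : 1 <= expR K by rewrite -expR0 ler_expR.
have -> : Cp * (M + 1) * (expR K * (expR (eps * n%:R) * X)) =
  (Cp * expR (eps * n%:R)) * (M + 1) * X * expR K by ring.
apply: le_trans (_ : (Cp * expR (eps * n%:R)) * (M + 1) * X <= _).
  by rewrite !ler_wpM2r // addr_ge0.
by rewrite ler_peMr // !mulr_ge0 ?expR_ge0 ?addr_ge0 // (le_trans _ Cp1).
Qed.

(** Prefixes are charged with d2 over n1 letters and tails with d1 over n3 letters. The 7 is the
    largest multiple of eps that occurs: 4 eps n1 from the prefix claim and 3 eps n1 from the tail
    claim. *)
Lemma split_claim lam s1 s2 d1 d2 A C a n1 n3 L2 K r1 r2 : inB chi eps rho lam ->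
  (s1 <= S.+1)%N -> (s2 <= S.+1)%N -> 0 <= A -> 0 <= C -> 1 <= a -> 0 <= K ->
  (n3 <= L2)%N -> 0 <= r1 ->
  claim lam s2 d2 A C -> claimPhi lam s1 d1 A C ->
  r1 <= a * expR (K - Chi * (n1 + n3)%:R) -> r2 <= a * expR (K - Chi * n1%:R) ->
  E (n1 + L2) (fun u => E (n1 + L2) (fun v =>
    [&& dif u v, typ K u, typ K v, small lam r1 s1 u v & small lam r2 s2 u v]%:R)) <=
  C ^+ 2 * expR (A * (ln (a + C1) + ln (C2 * a + C1))) *
   expR (7 * A * (K + eps * (n1 + n3)%:R) - d2 * Chi * n1%:R - d1 * Chi * n3%:R).
Proof.
move=> B s1S s2S A0 C0 a1 K0 n3L r10 cl clP hr1 hr2.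
apply: le_trans (@split_le _ _ p t chi Chi H eps p_gt0 p_sum rho S jetC Cp Cj0 HCj Cp1 HCp
  lam s1 s2 n1 L2 K r1 r2 B s1S s2S r10) _.
have e1 : 0 <= eps * n1%:R by rewrite mulr_ge0.
have e3 : 0 <= eps * n3%:R by rewrite mulr_ge0.
have [E1 c10] := @expR_ln_ge0 (a + C1) (ler_wpDr C1_0 a1).
have a21 : 1 <= C2 * a by rewrite (le_trans a1) // ler_peMl ?(C2_ge1 S Cp1) // (le_trans _ a1).
have [E3 c30] := @expR_ln_ge0 (C2 * a + C1) (ler_wpDr C1_0 a21).
set c1 := ln _ in E1 c10 *; set c3 := ln _ in E3 c30 *.
set K1 := K + 3 * eps * n1%:R + c1.
have K10 : 0 <= K1 by rewrite /K1; lra.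
have h1 : PsiF lam s2 n1 K (r2 + C1 * expR (- Chi * n1%:R + 3 * eps * n1%:R + K)) <=
    PsiF lam s2 n1 K1 (expR (K1 - Chi * n1%:R)).
  apply: PsiF_mono => //; first by rewrite /K1; lra.
  have -> : K1 - Chi * n1%:R = c1 + (- Chi * n1%:R + 3 * eps * n1%:R + K) by rewrite /K1; ring.
  rewrite [X in _ <= X]expRD E1 [X in _ <= X]mulrDl lerD2r (le_trans hr2) // ler_wpM2l ?(le_trans _ a1) // ler_expR; lra.
set K3 := 2 * K + 3 * eps * n1%:R + 3 * eps * n3%:R + c3.
have K30 : 0 <= K3 by rewrite /K3; lra.
have h3 : PhiF lam s1 L2 (2 * K + 2 * eps * n1%:R) (C2 * r1 * expR (Chi * n1%:R + 3 * eps * n1%:R + K)) <=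
    PhiF lam s1 n3 K3 (expR (K3 - Chi * n3%:R)).
  apply: le_trans (PhiF_trunc H p_gt0 p_sum Cj0 HCj Cp1 HCp (r' := expR (K3 - Chi * n3%:R)) B s1S n3L _) _; last first.
    by apply: PhiF_mono => //; rewrite /K3; lra.
  have -> : K3 - Chi * n3%:R = c3 + (- Chi * n3%:R + 3 * eps * n3%:R + (2 * K + 3 * eps * n1%:R)) by rewrite /K3; ring.
  rewrite [X in _ <= X]expRD E3 [X in _ <= X]mulrDl; apply: lerD; last first.
    by rewrite ler_wpM2l // ler_expR; lra.
  rewrite -(mulrA C2 r1) -(mulrA C2 a) ler_wpM2l //.
  apply: le_trans (ler_wpM2r (expR_ge0 _) hr1) _.
  rewrite -(mulrA a) ler_wpM2l ?(le_trans _ a1) // -expRD ler_expR natrD; lra.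
have g1 := le_trans h1 (cl _ _ K10); have g3 := le_trans h3 (clP _ _ K30).
apply: le_trans (ler_pM _ _ g1 g3) _; rewrite ?PsiF_ge0 ?PhiF_ge0 //.
rewrite mulrACA -expr2 -(mulrA (C ^+ 2)); apply: ler_wpM2l; first exact: exprn_ge0.
rewrite -!expRD ler_expR /K1 /K3 natrD.
have f1 : 0 <= A * (4 * K + 3 * (eps * n3%:R)) by rewrite mulr_ge0 //; lra.
nra.
Qed.

End Claims.

(** * Separation by jets *)

Lemma nm_real (R : realType) (r : R) : nm (r%:C%C) = `|r|.
Proof. by rewrite /nm /= expr0n addr0 sqrtr_sqr. Qed.

Section Shift.
Variables (R : realType) (k : nat) (t : 'I_k -> R[i]).
Implicit Types (u v : seq 'I_k) (lam : 'I_k -> R[i]) (l P N : nat).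

Definition jetdif lam u v l : R[i] := jet t lam u l - jet t lam v l.

Lemma jetdifE lam u v l : jetdif lam u v l = jet t lam u l - jet t lam v l.
Proof. by []. Qed.

Variables (rho tau x : R).
Hypotheses (rho0 : 0 <= rho) (tau0 : 0 <= tau) (x0 : 0 < x) (x1 : x <= 1).
Hypothesis rhox : rho * (1 + 2 * x) < 1.
Hypothesis t_le : forall i, nm (t i) <= tau.

Definition Md : R := 2 * (tau / (1 - rho * (1 + 2 * x))).

Lemma Md_ge0 : 0 <= Md.
Proof. by rewrite mulr_ge0 // divr_ge0 // subr_ge0 ltW. Qed.

Lemma gen_fj lam u v N : (forall i, nm (lam i) <= rho) ->
  gen (fun l => nm (jetdif lam u v l)) (2 * x) N <= Md.
Proof.
move=> B; have x20 : 0 <= 2 * x by rewrite mulr_ge0 // ltW.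
apply: le_trans (_ : gen (fun l => nm (jet t lam u l) + nm (jet t lam v l)) (2 * x) N <= _).
  by apply: gen_le => // l; exact: nmB.
rewrite genD /Md [2 * (tau / _)]mulr_natl mulr2n.
by apply: lerD; apply: gen_jet.
Qed.

Lemma jetdif_shift lam u v l h P : (forall i, nm (lam i) <= rho) -> nm h <= x ->
  nm (jetdif (fun i => (1 + h) * lam i) u v l -
     (1 + h) ^+ l * \sum_(q < P) 'C(l + q, l)%:R * jetdif lam u v (l + q) * h ^+ q) <=
  nm (1 + h) ^+ l * (Md * x ^- l * (nm h / x) ^+ P).
Proof.
move=> B hx.
pose N := (size u + size v + P)%N.
have uN : (size u <= N)%N by rewrite /N; lia.
have vN : (size v <= N)%N by rewrite /N; lia.
have PN : (P <= N)%N by rewrite /N; lia.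
rewrite {1}/jetdif (jet_shift t lam l h uN) (jet_shift t lam l h vN) -mulrBr -mulrBr nmM nmX.
apply: ler_wpM2l; first by rewrite exprn_ge0 // nm_ge0.
have -> : \sum_(q < N) 'C(l + q, l)%:R * jet t lam u (l + q) * h ^+ q -
   \sum_(q < N) 'C(l + q, l)%:R * jet t lam v (l + q) * h ^+ q =
   \sum_(q < N) 'C(l + q, l)%:R * jetdif lam u v (l + q) * h ^+ q.
  by rewrite -sumrB; apply: eq_bigr => q _; rewrite /jetdif; ring.
exact: (taylor_tail (g := jetdif lam u v) l x0 hx (fun N => gen_fj u v N B) PN).
Qed.

End Shift.

Section Base.
Variables (R : realType) (k : nat) (t : 'I_k -> R[i]).
Variables (rho tau c : R).
Hypotheses (rho0 : 0 <= rho) (rho1 : rho < 1) (tau0 : 0 <= tau) (c0 : 0 < c).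
Hypothesis t_le : forall i, nm (t i) <= tau.
Hypothesis t_sep : forall i j, i != j -> c <= nm (t i - t j).

(* Proved by scaling: repeated multiplication by 1 - x / 2 brings lam close to 0, where already the
   values separate, and the jets at lam are controlled by those at (1 - x / 2) lam. *)
Definition separated (r : R) := exists S : nat, exists2 d : R, 0 < d &
  forall lam : 'I_k -> R[i], (forall i, nm (lam i) <= r) ->
  forall u v, dif u v -> u != [::] -> v != [::] ->
  exists2 l, (l < S)%N & d <= nm (jetdif t lam u v l).

Let x := (1 - rho) / 4.

Lemma geometric_small (y e : R) : 0 <= y -> y < 1 -> 0 < e -> exists n : nat, y ^+ n <= e.
Proof.
move=> y0 y1 e0.
have [->|ynz] := eqVneq y 0; first by exists 1%N; rewrite expr1 ltW.
have yp : 0 < y by rewrite lt_neqAle eq_sym ynz.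
have hy : 0 < y^-1 - 1 by rewrite subr_gt0 invf_gt1.
have [n hn] : exists n : nat, e^-1 <= n%:R * (y^-1 - 1).
  exists (Num.bound (e^-1 / (y^-1 - 1))); rewrite -ler_pdivrMr //.
  by apply/ltW/archi_boundP/divr_ge0; rewrite ?invr_ge0; exact: ltW.
exists n; rewrite -[y ^+ n]invrK -[e]invrK lef_pV2 ?posrE ?invr_gt0 ?exprn_gt0 //.
rewrite -exprVn; apply: (le_trans hn).
have -> : y^-1 = 1 + (y^-1 - 1) by rewrite addrC subrK.
move: (y^-1 - 1) hy => z z0; rewrite [1 + z]addrC addrK.
suff : n%:R * z + 1 <= (z + 1) ^+ n by lra.
elim: n {hn} => [|n IH]; first by rewrite mul0r add0r expr0.
rewrite exprS; apply: le_trans (_ : (z + 1) * (n%:R * z + 1) <= _).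
  have : 0 <= n%:R * z * z by rewrite !mulr_ge0 // ltW.
  by rewrite -nat1r; lra.
by apply: ler_wpM2l => //; lra.
Qed.

(** Everything after the first letter contributes at most r tau / (1 - rho) to each value, so the
    jet of order zero is dominated by t i - t j. *)
Lemma base_small r : 0 <= r -> r <= rho -> 2 * r * (tau / (1 - rho)) <= c / 2 -> separated r.
Proof.
move=> r0 rr Hr; exists 1%N; exists (c / 2); first by rewrite divr_gt0.
move=> lam B [|i u] [|j v] //= ij _ _; exists 0%N => //.
have B' w i' : nm (lam i' * (jet t lam w 0 + 0)) <= r * (tau / (1 - rho)).
  rewrite nmM addr0; apply: ler_pM; rewrite ?nm_ge0 //.
  have rho10 : rho * (1 + 0) < 1 by rewrite addr0 mulr1.
  have Bl j' : nm (lam j') <= rho by apply: le_trans rr.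
  have := @gen_jet _ _ t rho tau 0 rho0 (lexx 0) rho10 t_le lam w 1 tau0 Bl.
  by rewrite /gen big_ord1 expr0 mulr1 addr0 mulr1.
rewrite /jetdif /= !mul1r.
have -> : t i + lam i * (jet t lam u 0 + 0) - (t j + lam j * (jet t lam v 0 + 0)) =
  (t i - t j) - (lam j * (jet t lam v 0 + 0) - lam i * (jet t lam u 0 + 0)) by ring.
set Y := _ - lam i * _.
have hY : nm Y <= 2 * r * (tau / (1 - rho)).
  apply: le_trans (nmB _ _) _.
  by rewrite -mulrA mulr_natl mulr2n; apply: lerD; exact: B'.
have h1 := nm_tri (t i - t j) Y; have h2 := t_sep ij.
have := le_trans h2 h1; lra.
Qed.

(** If all jets at lam up to order S' + P were tiny, re-expansion at h = - x / 2 would make all jets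
    at (1 + h) lam below order S' smaller than d: the explicit part is at most d / 4 and the Taylor
    tail at most d / 2. *)
Lemma base_step r : 0 <= r -> r <= rho -> separated ((1 - x / 2) * r) -> separated r.
Proof.
move=> r0 rr [S' [d d0 Hd]].
have x0 : 0 < x by rewrite /x divr_gt0 // subr_gt0.
have x1 : x <= 1 by rewrite /x; lra.
have rx : r * (1 + 2 * x) < 1.
  apply: le_lt_trans (_ : rho * (1 + 2 * x) < 1); first by rewrite ler_wpM2r //; lra.
  have r1 := rho1; rewrite /x; have : 0 < (1 - rho) * (1 - rho / 2) by apply: mulr_gt0; lra.
  lra.
set M := Md r tau x; have M0 : 0 <= M := Md_ge0 tau0 rx.
have MX : 0 < M * x ^- S' + 1 by rewrite ltr_wpDl // mulr_ge0 // invr_ge0 exprn_ge0 // ltW.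
have e0 : 0 < d / 2 / (M * x ^- S' + 1) by rewrite !divr_gt0.
(* |h| is half of the admissible radius x, so the Taylor tail decays like (1 / 2)^P. [B] below
   dominates the sum of the P binomials. *)
have [P HP] := @geometric_small (1 / 2) _ ltac:(lra) ltac:(lra) e0.
pose B := (P.+1%:R * 2 ^+ (S' + P) : R).
have B0 : 0 < B by rewrite mulr_gt0 // exprn_gt0.
exists (S' + P)%N; exists (d / 4 / B); first by rewrite !divr_gt0.
move=> lam Bl u v duv u0 v0.
pose h : R[i] := (- (x / 2))%:C%C.
have nh : nm h = x / 2 by rewrite nm_real normrN ger0_norm // divr_ge0 // ltW.
have n1h : nm (1 + h) = 1 - x / 2.
  have -> : 1 + h = (1 - x / 2)%:C%C by rewrite /h -(rmorph1 (real_complex R)) -rmorphD.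
  by rewrite nm_real ger0_norm //; lra.
have Bl' i : nm ((1 + h) * lam i) <= (1 - x / 2) * r.
  by rewrite nmM n1h ler_wpM2l //; lra.
have [l lS hl] := Hd _ Bl' u v duv u0 v0.
case al : (all (fun l' => nm (jetdif t lam u v l') < d / 4 / B) (iota 0 (S' + P))); last first.
  move/negbT: al; rewrite -has_predC => /hasP[l' + hl'].
  by rewrite mem_iota /= add0n => l'S; exists l' => //; rewrite leNgt.
exfalso; move/allP: al => al.
have hx : nm h <= x by rewrite nh; lra.
have sh := @jetdif_shift _ _ t r tau x r0 tau0 x0 x1 rx t_le lam u v l h P Bl hx.
set T := \sum_(q < P) _ in sh.
have q1 : nm (1 + h) ^+ l <= 1 by rewrite exprn_ile1 // ?nm_ge0 // n1h; lra.
have q0 : 0 <= nm (1 + h) ^+ l by rewrite exprn_ge0 // nm_ge0.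
have rem : nm (1 + h) ^+ l * (M * x ^- l * (nm h / x) ^+ P) <= d / 2.
  have -> : nm h / x = 1 / 2 by rewrite nh; field; rewrite gt_eqF.
  have xl : x ^- l <= x ^- S'.
    rewrite lef_pV2 ?posrE ?exprn_gt0 //.
    by rewrite -(subnKC (ltnW lS)) exprD ler_piMr ?exprn_ge0 ?exprn_ile1 // ltW.
  have P0 : 0 <= (1 / 2 : R) ^+ P by apply: exprn_ge0; lra.
  have m1 : M * x ^- l * (1 / 2) ^+ P <= (M * x ^- S' + 1) * (d / 2 / (M * x ^- S' + 1)).
    apply: ler_pM => //; first by rewrite mulr_ge0 // invr_ge0 exprn_ge0 // ltW.
    by apply: le_trans (_ : M * x ^- S' <= _); rewrite ?ler_wpM2l // lerDl.
  rewrite mulrCA divff ?mulr1 ?gt_eqF // in m1.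
  apply: le_trans m1; apply: ler_piMl => //; apply: mulr_ge0 => //.
  by apply: mulr_ge0 => //; rewrite invr_ge0 exprn_ge0 // ltW.
have hT : nm T <= d / 4.
  apply: le_trans (nm_sum _ _ _) _.
  apply: le_trans (_ : \sum_(q < P) 2 ^+ (S' + P) * (d / 4 / B) <= _).
    apply: ler_sum => q _; rewrite !nmM nm_nat nmX nh.
    have lq : (l + q < S' + P)%N by rewrite -addSn leq_add // ltnW.
    have fq : nm (jetdif t lam u v (l + q)) <= d / 4 / B.
      by apply/ltW/al; rewrite mem_iota add0n.
    have bq : ('C(l + q, l)%:R : R) <= 2 ^+ (S' + P).
      rewrite -natrX ler_nat; apply: leq_trans (_ : 2 ^ (l + q) <= _)%N; last by rewrite leq_exp2l // ltnW.
      rewrite -[2%N]/(1 + 1)%N expnDn.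
      have lq' : (l < (l + q).+1)%N by rewrite ltnS leq_addr.
      by rewrite (bigD1 (Ordinal lq')) //= !exp1n !muln1 leq_addr.
    have hq : (x / 2) ^+ q <= 1 by apply: exprn_ile1; lra.
    have hq0 : 0 <= (x / 2) ^+ q by apply: exprn_ge0; lra.
    have m : 'C(l + q, l)%:R * nm (jetdif t lam u v (l + q)) <= 2 ^+ (S' + P) * (d / 4 / B).
      by apply: ler_pM => //; exact: nm_ge0.
    apply: le_trans m; rewrite ler_piMr // mulr_ge0 //; exact: nm_ge0.
  rewrite sumr_const card_ord -[_ *+ _]mulr_natl.
  have z2 : (2 ^+ (S' + P) : R) != 0 by rewrite expf_neq0 ?pnatr_eq0.
  have zP : (P.+1%:R : R) != 0 by rewrite pnatr_eq0.
  have -> : P%:R * (2 ^+ (S' + P) * (d / 4 / B)) = (d / 4) * (P%:R / P.+1%:R).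
    by rewrite /B; move: z2 zP; move: (2 ^+ _) (P.+1%:R) (P%:R) => z y w z2 zP; field; rewrite z2 zP.
  rewrite ler_piMr //; first by rewrite ltW // divr_gt0.
  by rewrite ler_pdivrMr ?ltr0n // mul1r ler_nat.
have := nm_tri (jetdif t (fun i => (1 + h) * lam i) u v l) ((1 + h) ^+ l * T).
have : nm ((1 + h) ^+ l * T) <= d / 4.
  by rewrite nmM nmX; apply: le_trans hT; rewrite ler_piMl // nm_ge0.
have := le_trans sh rem.
by move: hl d0; lra.
Qed.

(** x depends on rho only, so every step shrinks the radius by the same factor and finitely many
    steps reach [base_small]; the order S grows by a finite amount on each step back. *)
Lemma base_separated : separated rho.
Proof.
have r0 := rho0; have r1 := rho1.
have x0 : 0 < x by rewrite /x divr_gt0 // subr_gt0.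
have x1 : x <= 1 by rewrite /x; lra.
have y0 : 0 <= 1 - x / 2 by lra.
have y1 : 1 - x / 2 < 1 by lra.
have T0 : 0 <= tau / (1 - rho) by rewrite divr_ge0 // subr_ge0 ltW.
have e0 : 0 < c / 2 / (2 * rho * (tau / (1 - rho)) + 1).
  by rewrite !divr_gt0 // ltr_wpDl // mulr_ge0 // mulr_ge0.
have [n Hn] := geometric_small y0 y1 e0.
have ylt i : 0 <= (1 - x / 2) ^+ i * rho <= rho.
  by rewrite mulr_ge0 ?exprn_ge0 //= ler_piMl // exprn_ile1 // ltW.
(* Induction from the smallest radius upwards; n - i is truncated at 0, so nothing changes for i
   beyond n. *)
suff H i : separated ((1 - x / 2) ^+ (n - i) * rho) by have := H n; rewrite subnn expr0 mul1r.
elim: i => [|i IH].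
  rewrite subn0; have /andP[h1 h2] := ylt n; apply: base_small => //.
  set A := 2 * rho * (tau / (1 - rho)) in Hn e0.
  have -> : 2 * ((1 - x / 2) ^+ n * rho) * (tau / (1 - rho)) = (1 - x / 2) ^+ n * A by rewrite /A; ring.
  have A0 : 0 <= A by rewrite /A mulr_ge0 // mulr_ge0.
  apply: le_trans (ler_wpM2r A0 Hn) _.
  have A1 : 0 < A + 1 by rewrite ltr_wpDl.
  have cc := c0; rewrite mulrAC ler_pdivrMr // mulrDr mulr1 lerDl; lra.
case: (leqP n i) => ni.
  have -> : (n - i.+1 = n - i)%N by lia.
  exact: IH.
have /andP[h1 h2] := ylt (n - i.+1)%N.
by apply: base_step => //; rewrite mulrA -exprS -subSn // subSS.
Qed.

End Base.

(** * Transversality *)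

Section Move.
Variables (R : realType) (k : nat) (t : 'I_k -> R[i]).
Variables (rho tau : R) (S : nat).
Hypotheses (rho0 : 0 <= rho) (rho1 : rho < 1) (tau0 : 0 <= tau).
Hypothesis t_le : forall i, nm (t i) <= tau.
Implicit Types (u v : seq 'I_k) (lam : 'I_k -> R[i]) (l P s : nat) (h : R[i]) (r e : R).
Local Notation jetdif := (jetdif t).

(** Admissible size of h: it leaves rho (1 + 2 xr) < 1 for the Taylor tails and keeps (1 + h) lam
    below [rho2] < 1. *)
Definition xr : R := (1 - rho) / 8.
Definition rho2 : R := (1 + rho) / 2.
Definition jetC : R := tau / (1 - rho * (1 + xr)) * xr ^- S.
Definition lipC : R :=
  2 * ((1 + xr) * (tau / (1 - rho2 * (1 + xr))) / (1 - rho2 * (1 + xr)) * xr ^- S).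
Definition tailC : R := Md rho tau xr * xr ^- (S + 3).

Lemma xr_gt0 : 0 < xr. Proof. by rewrite /xr divr_gt0 // subr_gt0. Qed.
Lemma xr_le : xr <= 1 / 8. Proof. have := rho0; rewrite /xr; lra. Qed.
Lemma xr_le1 : xr <= 1. Proof. have := xr_le; lra. Qed.
Lemma rhox : rho * (1 + 2 * xr) < 1.
Proof.
have := rho0; have := rho1; move=> r1 r0.
have : 0 < (1 - rho) * (1 - rho / 4) by apply: mulr_gt0; lra.
rewrite /xr; lra.
Qed.
Lemma rhox1 : rho * (1 + xr) < 1.
Proof.
apply: le_lt_trans rhox; apply: ler_wpM2l => //; have := xr_gt0; lra.
Qed.
Lemma rho2x : rho2 * (1 + xr) < 1.
Proof.
have := rho0; have := rho1; move=> r1 r0.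
have : 0 < (1 - rho) * (7 - rho) by apply: mulr_gt0; lra.
rewrite /xr /rho2; lra.
Qed.
Lemma rho2_ge0 : 0 <= rho2. Proof. have := rho0; rewrite /rho2; lra. Qed.
Lemma rho_rho2 : rho <= rho2. Proof. have := rho1; rewrite /rho2; lra. Qed.

Lemma xr_inv l : (l <= S)%N -> xr ^- l <= xr ^- S.
Proof.
move=> lS; have x0 := xr_gt0; rewrite lef_pV2 ?posrE ?exprn_gt0 //.
by rewrite -(subnKC lS) exprD ler_piMr ?exprn_ge0 ?exprn_ile1 ?xr_le1 // ltW.
Qed.

Lemma jetC_ge0 : 0 <= jetC.
Proof.
rewrite /jetC mulr_ge0 ?invr_ge0 ?exprn_ge0 ?(ltW xr_gt0) // divr_ge0 // subr_ge0 ltW //.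
exact: rhox1.
Qed.

Lemma lipC_ge0 : 0 <= lipC.
Proof.
have x0 := xr_gt0; have r2 := rho2x.
rewrite /lipC mulr_ge0 // mulr_ge0 ?invr_ge0 ?exprn_ge0 ?(ltW xr_gt0) //.
rewrite divr_ge0 ?subr_ge0 ?(ltW r2) // mulr_ge0 ?addr_ge0 ?(ltW x0) //.
by rewrite divr_ge0 // subr_ge0 ltW.
Qed.

Lemma tailC_ge0 : 0 <= tailC.
Proof.
by rewrite mulr_ge0 ?invr_ge0 ?exprn_ge0 ?(ltW xr_gt0) // Md_ge0 // rhox.
Qed.

Lemma jet_le lam u l : (forall i, nm (lam i) <= rho) -> (l <= S)%N -> nm (jet t lam u l) <= jetC.
Proof.
move=> B lS; have x0 := xr_gt0.
have h := @gen_jet _ _ t rho tau xr rho0 (ltW x0) rhox1 t_le lam u l.+1 tau0 B.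
have := @gen_coef _ (fun l => nm (jet t lam u l)) xr l.+1 l (ltW x0) (fun=> nm_ge0 _) (ltnSn l).
move=> /le_trans /(_ h) {}h.
have -> : nm (jet t lam u l) = nm (jet t lam u l) * xr ^+ l * xr ^- l.
  by rewrite mulfK // expf_neq0 // gt_eqF.
rewrite /jetC; apply: ler_pM => //; last exact: xr_inv.
  by rewrite mulr_ge0 ?nm_ge0 ?exprn_ge0 // ltW.
by rewrite invr_ge0 exprn_ge0 // ltW.
Qed.

Lemma jetdif_le lam u v l : (forall i, nm (lam i) <= rho) -> (l <= S)%N -> nm (jetdif lam u v l) <= 2 * jetC.
Proof.
move=> B lS; apply: le_trans (nmB _ _) _; rewrite mulr_natl mulr2n.
by apply: lerD; apply: jet_le.
Qed.

Lemma jetdif_lip lam lam' u v l e : (forall i, nm (lam i) <= rho2) -> (forall i, nm (lam' i) <= rho2) ->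
  0 <= e -> (forall i, nm (lam i - lam' i) <= e) -> (l <= S)%N ->
  nm (jetdif lam u v l - jetdif lam' u v l) <= lipC * e.
Proof.
move=> B B' e0 He lS; have x0 := xr_gt0.
set D := ((1 + xr) * (tau / (1 - rho2 * (1 + xr))) / (1 - rho2 * (1 + xr))).
have one w : nm (jet t lam w l - jet t lam' w l) <= D * xr ^- S * e.
  have h := @gen_jet_lip _ _ t rho2 tau xr rho2_ge0 (ltW x0) rho2x t_le lam lam' e w l.+1 tau0 e0 B B' He.
  have := @gen_coef _ (fun l => nm (jet t lam w l - jet t lam' w l)) xr l.+1 l (ltW x0) (fun=> nm_ge0 _) (ltnSn l).
  move=> /le_trans /(_ h) {}h.
  have -> : nm (jet t lam w l - jet t lam' w l) = nm (jet t lam w l - jet t lam' w l) * xr ^+ l * xr ^- l.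
    by rewrite mulfK // expf_neq0 // gt_eqF.
  rewrite [D * _ * e]mulrAC [D * e]mulrC; apply: ler_pM => //; last exact: xr_inv.
    by rewrite mulr_ge0 ?nm_ge0 ?exprn_ge0 // ltW.
  by rewrite invr_ge0 exprn_ge0 // ltW.
have -> : jetdif lam u v l - jetdif lam' u v l =
  (jet t lam u l - jet t lam' u l) - (jet t lam v l - jet t lam' v l) by rewrite !jetdifE; ring.
apply: le_trans (nmB _ _) _; rewrite /lipC -/D -mulrA mulr_natl mulr2n.
by apply: lerD; exact: one.
Qed.

Lemma mulh_rho2 lam h : (forall i, nm (lam i) <= rho) -> nm h <= xr ->
  forall i, nm ((1 + h) * lam i) <= rho2.
Proof.
move=> B hx i; rewrite nmM; have h1 : nm (1 + h) <= 1 + xr.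
  by apply: le_trans (nmD _ _) _; rewrite nm1 lerD2l.
apply: le_trans (ler_pM (nm_ge0 _) (nm_ge0 _) h1 (B i)) _.
have := rho0; have := rho1; move=> r1 r0.
have : 0 <= (1 - rho) * (1 - rho / 4) by apply: mulr_ge0; lra.
rewrite /xr /rho2; lra.
Qed.

Lemma Taylor_rem lam u v l h P : (forall i, nm (lam i) <= rho) -> nm h <= xr -> (l <= S)%N ->
  (P <= 3)%N ->
  nm (jetdif (fun i => (1 + h) * lam i) u v l -
     (1 + h) ^+ l * \sum_(q < P) 'C(l + q, l)%:R * jetdif lam u v (l + q) * h ^+ q) <=
  nm (1 + h) ^+ l * (tailC * nm h ^+ P).
Proof.
move=> B hx lS P3; have x0 := xr_gt0.
apply: le_trans (jetdif_shift rho0 tau0 x0 xr_le1 rhox t_le u v l P B hx) _.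
apply: ler_wpM2l; first by rewrite exprn_ge0 // nm_ge0.
rewrite (expr_div_n (nm h)) mulrA mulrAC; apply: ler_wpM2r; first by rewrite exprn_ge0 // nm_ge0.
rewrite /tailC -mulrA; apply: ler_wpM2l; first exact: Md_ge0 rhox.
rewrite -invfM -exprD lef_pV2 ?posrE ?exprn_gt0 //.
have lP : (l + P <= S + 3)%N by exact: leq_add.
by rewrite -(subnKC lP) exprD ler_piMr ?exprn_ge0 ?exprn_ile1 ?xr_le1 // ltW.
Qed.

Lemma nm1h h : nm h <= xr -> 1 / 2 <= nm (1 + h) <= 2.
Proof.
move=> hx; have x8 := xr_le; apply/andP; split.
  have := nm_tri 1 (- h); rewrite nm1 opprK nmN; lra.
by apply: le_trans (nmD _ _) _; rewrite nm1; lra.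
Qed.

Section TwoPoints.
Variables (lam lam' : 'I_k -> R[i]) (h : R[i]) (e : R).
Hypotheses (B : forall i, nm (lam i) <= rho) (B' : forall i, nm (lam' i) <= rho).
Hypotheses (hx : nm h <= xr) (e0 : 0 <= e).
Hypothesis He : forall i, nm (lam' i - (1 + h) * lam i) <= e.

Lemma lam'_lip u v l : (l <= S)%N ->
  nm (jetdif lam' u v l - jetdif (fun i => (1 + h) * lam i) u v l) <= lipC * e.
Proof.
move=> lS; apply: jetdif_lip => //; last exact: mulh_rho2.
by move=> i; apply: le_trans (B' i) rho_rho2.
Qed.

(** The sum is the Taylor polynomial in the scaling direction, and lipC e accounts for the part of
    the move outside that direction. The powers of 1 + h are at most 2^S. *)
Lemma fj_move u v l P : (l <= S)%N -> (P <= 3)%N ->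
  nm (jetdif lam' u v l) <= lipC * e + 2 ^+ S *
   (\sum_(q < P) 'C(l + q, l)%:R * nm (jetdif lam u v (l + q)) * nm h ^+ q + tailC * nm h ^+ P).
Proof.
move=> lS P3; apply: le_trans (nm_tri _ (jetdif (fun i => (1 + h) * lam i) u v l)) _.
rewrite addrC; apply: lerD; first exact: lam'_lip.
have T := Taylor_rem u v B hx lS P3.
set X := \sum_(q < P) _ in T.
apply: le_trans (nm_tri _ ((1 + h) ^+ l * X)) _.
have nX : nm X <= \sum_(q < P) 'C(l + q, l)%:R * nm (jetdif lam u v (l + q)) * nm h ^+ q.
  apply: le_trans (nm_sum _ _ _) _; apply: ler_sum => q _.
  by rewrite !nmM nm_nat nmX.
have /andP[_ h2] := nm1h hx.
have n2 : nm (1 + h) ^+ l <= 2 ^+ S.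
  apply: le_trans (_ : 2 ^+ l <= _); first by apply: lerXn2r; rewrite ?nnegrE ?nm_ge0.
  by rewrite ler_eXn2l // ltr1n.
rewrite mulrDr; apply: lerD.
  by rewrite nmM nmX; apply: ler_pM => //; rewrite ?exprn_ge0 ?nm_ge0.
apply: le_trans T _; apply: ler_wpM2r => //.
by rewrite mulr_ge0 ?tailC_ge0 ?exprn_ge0 ?nm_ge0.
Qed.

(* Where f_(s-1) is small and f_s is not, f_(s-1) is nearly affine in h. *)
Lemma transversal u v s r sigma : (s < S)%N -> 0 < sigma -> lipC * e <= r ->
  nm (jetdif lam u v s) <= r -> nm (jetdif lam' u v s) <= r -> sigma < nm (jetdif lam u v s.+1) ->
  2 * tailC * nm h <= sigma -> nm h <= 2 * (1 + 2 ^+ S.+1) * r / sigma.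
Proof.
move=> sS sg0 er f1 f2 f3 hM.
have sS' := ltnW sS.
have T := Taylor_rem u v B hx sS' (isT : (2 <= 3)%N).
set X := \sum_(q < 2) _ in T.
have XE : X = jetdif lam u v s + s.+1%:R * jetdif lam u v s.+1 * h.
  by rewrite /X !big_ord_recl big_ord0 /= addr0 !addn0 addn1 binn binSn expr0 expr1 mulr1 mul1r.
have /andP[h1 _] := nm1h hx.
set D := jetdif (fun i => (1 + h) * lam i) u v s in T.
have hD : nm D <= 2 * r.
  have := nm_tri D (jetdif lam' u v s); rewrite [nm (D - _)]nmBC.
  have := lam'_lip u v sS'; rewrite -/D; lra.
have q0 : 0 < nm (1 + h) ^+ s by rewrite exprn_gt0 //; lra.
have qS : 1 <= 2 ^+ S * nm (1 + h) ^+ s.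
  apply: le_trans (_ : 2 ^+ s * nm (1 + h) ^+ s <= _); last first.
    by rewrite ler_wpM2r ?(ltW q0) // ler_eXn2l ?ltr1n.
  by rewrite -exprMn exprn_ege1 //; lra.
have hX : nm X <= 2 ^+ S * (2 * r) + tailC * nm h ^+ 2.
  have a1 : nm (1 + h) ^+ s * nm X <= nm D + nm (1 + h) ^+ s * (tailC * nm h ^+ 2).
    rewrite -nmX -nmM; apply: le_trans (nm_tri _ D) _; rewrite lerD2l nmBC.
    by rewrite nmX.
  have a2 : nm D <= nm (1 + h) ^+ s * (2 ^+ S * (2 * r)).
    apply: (le_trans hD); rewrite mulrA [_ * 2 ^+ S]mulrC.
    by rewrite ler_peMl // (le_trans _ hD) // nm_ge0.
  rewrite -(ler_pM2l q0) mulrDr; apply: le_trans a1 _; by rewrite lerD2r.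
have Y : s.+1%:R * nm (jetdif lam u v s.+1) * nm h <= nm X + r.
  rewrite -(nm_nat R) -!nmM.
  have -> : s.+1%:R * jetdif lam u v s.+1 * h = X - jetdif lam u v s by rewrite XE; ring.
  by apply: le_trans (nmB _ _) _; rewrite lerD2l.
have Z : sigma * nm h <= s.+1%:R * nm (jetdif lam u v s.+1) * nm h.
  rewrite ler_wpM2r ?nm_ge0 //; apply: (le_trans (ltW f3)).
  by rewrite ler_peMl ?nm_ge0 // ler1n.
have W : tailC * nm h ^+ 2 <= sigma / 2 * nm h.
  by rewrite expr2 mulrA ler_wpM2r ?nm_ge0 //; lra.
rewrite ler_pdivlMr // exprS.
by move: Y Z W hX; rewrite [nm h * sigma]mulrC; lra.
Qed.

Definition moveC : R := 2 ^+ S * (1 + S.+3%:R ^+ 2 * (2 + 2 * jetC) + tailC) + 1.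

Lemma moveC_ge1 : 1 <= moveC.
Proof.
rewrite /moveC lerDr mulr_ge0 ?exprn_ge0 // !addr_ge0 ?tailC_ge0 // mulr_ge0 ?exprn_ge0 //.
by rewrite addr_ge0 // mulr_ge0 // jetC_ge0.
Qed.

Variables (Ei Eq r : R) (s : nat) (u v : seq 'I_k).
Hypotheses (Eq0 : 0 <= Eq) (EqEi : Eq <= Ei) (Ei1 : Ei <= 1) (hEq : nm h <= Eq).
Hypotheses (r0 : 0 <= r) (er : lipC * e <= r) (eE : lipC * e <= Ei) (sS : (s <= S)%N).
Hypothesis f_low : forall j, (j < s)%N -> nm (jetdif lam u v j) <= r.
Hypothesis f_top : nm (jetdif lam u v s) <= 2 * jetC * Ei.

(** This and the next two lemmas expand in h to first, second and third order. Jets below s are at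
    most r and the jet s is of order Ei, so after a move of size Eq the jet s stays of order Ei, the
    jet s - 1 becomes r + Eq Ei, and the lower ones become r + Eq^2 Ei. *)
Lemma moved_top : nm (jetdif lam' u v s) <= moveC * Ei.
Proof.
have := fj_move u v sS (isT : (1 <= 3)%N).
rewrite big_ord1 addn0 binn mul1r expr0 mulr1 expr1 => h1.
have C0 := jetC_ge0; have M0 := tailC_ge0.
have n2 : 1 <= (S.+3%:R : R) ^+ 2 by rewrite exprn_ege1 // ler1n.
have a1 : tailC * nm h <= tailC * Ei by rewrite ler_wpM2l // (le_trans hEq).
have T0 : 0 <= (2 : R) ^+ S by rewrite exprn_ge0.
have E0 : 0 <= Ei := le_trans Eq0 EqEi.
apply: (le_trans h1); rewrite /moveC mulrDl mul1r addrC; apply: lerD => //.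
rewrite -mulrA; apply: ler_wpM2l => //.
rewrite mulrDl; apply: lerD => //; apply: (le_trans f_top).
apply: ler_wpM2r => //.
have : (2 + 2 * jetC) <= S.+3%:R ^+ 2 * (2 + 2 * jetC) by rewrite ler_peMl //; lra.
lra.
Qed.

Lemma moved_mid l : s = l.+1 -> nm (jetdif lam' u v l) <= moveC * (r + Eq * Ei).
Proof.
move=> sl; have lS : (l <= S)%N by rewrite ltnW // -sl.
have := fj_move u v lS (isT : (2 <= 3)%N).
rewrite !big_ord_recl big_ord0 /= addn0 binn mul1r expr0 mulr1 addr0 addn1 binSn expr1 => h1.
have C0 := jetC_ge0; have M0 := tailC_ge0.
have T0 : 0 <= (2 : R) ^+ S by rewrite exprn_ge0.
have E0 : 0 <= Ei := le_trans Eq0 EqEi.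
have P0 : 0 <= Eq * Ei by rewrite mulr_ge0.
have fl : nm (jetdif lam u v l) <= r by apply: f_low; rewrite sl.
have n1 : (l.+1%:R : R) <= S.+3%:R ^+ 2.
  apply: le_trans (_ : S.+3%:R <= _); first by rewrite ler_nat; move: lS; clear; lia.
  by rewrite -{1}[S.+3%:R]expr1 ler_eXn2l // ltr1n.
have n2 : 1 <= (S.+3%:R : R) ^+ 2 by rewrite exprn_ege1 // ler1n.
have a2 : l.+1%:R * nm (jetdif lam u v l.+1) * nm h <= S.+3%:R ^+ 2 * (2 * jetC) * (Eq * Ei).
  rewrite -sl [Eq * Ei]mulrC -[X in _ <= X]mulrA (mulrA (2 * jetC)) -[X in X <= _]mulrA.
  rewrite {1}sl; apply: ler_pM => //; first by rewrite mulr_ge0 ?nm_ge0.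
  by apply: ler_pM; rewrite ?nm_ge0.
have a3 : tailC * nm h ^+ 2 <= tailC * (Eq * Ei).
  rewrite ler_wpM2l // expr2; apply: ler_pM; rewrite ?nm_ge0 //.
  exact: le_trans hEq EqEi.
apply: (le_trans h1); rewrite /moveC mulrDl mul1r addrC; apply: lerD.
  rewrite -[X in _ <= X]mulrA ler_wpM2l //.
  move: a2 a3 fl n2 P0 C0 M0 r0.
  move: (S.+3%:R ^+ 2) (Eq * Ei) (tailC * nm h ^+ 2) => N P Y.
  move: (l.+1%:R * _ * nm h) (nm (jetdif lam u v l)) => W Z a2 a3 fl n2 P0 C0 M0 r0'.
  have b1 : 0 <= N * jetC * r by apply: mulr_ge0 => //; apply: mulr_ge0 => //; lra.
  have b2 : 0 <= (N - 1) * r by rewrite mulr_ge0 // subr_ge0.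
  have b3 : 0 <= N * P by rewrite mulr_ge0 //; lra.
  have b4 : 0 <= tailC * r by rewrite mulr_ge0.
  lra.
by apply: (le_trans er); rewrite lerDl.
Qed.

Lemma moved_low l : (l.+2 <= s)%N -> nm (jetdif lam' u v l) <= moveC * (r + Eq ^+ 2 * Ei).
Proof.
move=> ls; have lS : (l <= S)%N by move: ls sS; clear; lia.
have := fj_move u v lS (isT : (3 <= 3)%N).
rewrite !big_ord_recl big_ord0 /= addn0 binn mul1r expr0 mulr1 addr0 addn1 binSn expr1.
rewrite /bump /= !add1n addn2 => h1.
have C0 := jetC_ge0; have M0 := tailC_ge0.
have T0 : 0 <= (2 : R) ^+ S by rewrite exprn_ge0.
have E0 : 0 <= Ei := le_trans Eq0 EqEi.
have E2 : Eq ^+ 2 <= 1 by rewrite exprn_ile1 // (le_trans EqEi).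
have P0 : 0 <= Eq ^+ 2 * Ei by rewrite mulr_ge0 // exprn_ge0.
have fl : nm (jetdif lam u v l) <= r by apply: f_low; move: ls; clear; lia.
have fl1 : nm (jetdif lam u v l.+1) <= r by apply: f_low; move: ls; clear; lia.
(* f_(l+2) is either one of the small jets or f_s itself. *)
have fl2 : nm (jetdif lam u v l.+2) <= r + 2 * jetC * Ei.
  have [l2|l2] := ltnP l.+2 s; first by apply: le_trans (f_low l2) _; rewrite lerDl mulr_ge0 // mulr_ge0.
  have -> : l.+2 = s by move: ls l2; clear; lia.
  by apply: (le_trans f_top); rewrite lerDr.
set N := (S.+3%:R : R).
have N1 : 1 <= N by rewrite ler1n.
have n1 : (l.+1%:R : R) <= N by rewrite ler_nat; move: lS; clear; lia.
have n2' : ('C(l.+2, l) <= S.+3 ^ 2)%N.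
  have ee : 'C(l.+2, l) = 'C(l.+2, 2) by rewrite -(@bin_sub l.+2 2) // subSS subSS subn0.
  have l3 : (l.+3 <= S.+3)%N by move: lS; clear; lia.
  have e1 : (l.+3 ^ 2 <= S.+3 ^ 2)%N by rewrite -!mulnn leq_mul.
  by rewrite ee; exact: leq_trans (bin_le_exp l.+2 2) e1.
have n2 : ('C(l.+2, l)%:R : R) <= N ^+ 2 by rewrite -natrX ler_nat.
have h1' : nm h <= 1 by rewrite (le_trans hEq) // (le_trans EqEi).
have h2' : nm h ^+ 2 <= Eq ^+ 2 by rewrite lerXn2r ?nnegrE ?nm_ge0.
have a2 : l.+1%:R * nm (jetdif lam u v l.+1) * nm h <= N * r.
  rewrite -[N * r]mulr1; apply: ler_pM; rewrite ?mulr_ge0 ?nm_ge0 //.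
  by apply: ler_pM; rewrite ?nm_ge0.
have a3 : 'C(l.+2, l)%:R * nm (jetdif lam u v l.+2) * nm h ^+ 2 <= N ^+ 2 * (r + 2 * jetC * Ei) * Eq ^+ 2.
  apply: ler_pM; rewrite ?mulr_ge0 ?nm_ge0 ?exprn_ge0 ?nm_ge0 //.
  by apply: ler_pM; rewrite ?nm_ge0.
have a4 : tailC * nm h ^+ 3 <= tailC * (Eq ^+ 2 * Ei).
  rewrite ler_wpM2l // exprSr; apply: ler_pM; rewrite ?exprn_ge0 ?nm_ge0 //.
  exact: le_trans hEq EqEi.
apply: (le_trans h1); rewrite /moveC mulrDl mul1r addrC; apply: lerD; last first.
  by apply: (le_trans er); rewrite lerDl.
rewrite -[X in _ <= X]mulrA ler_wpM2l // -/N.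
have b0 : N <= N ^+ 2 by rewrite expr2 ler_peMl // (le_trans _ N1).
have b1 : N ^+ 2 * (r + 2 * jetC * Ei) * Eq ^+ 2 <= N ^+ 2 * r + N ^+ 2 * (2 * jetC) * (Eq ^+ 2 * Ei).
  rewrite mulrDr mulrDl; apply: lerD; last by rewrite le_eqVlt; apply/orP; left; apply/eqP; ring.
  by rewrite ler_piMr // mulr_ge0 // exprn_ge0 // (le_trans _ N1).
move: a2 a3 a4 b0 b1 fl P0 r0 C0 M0.
move: (l.+1%:R * _ * nm h) ('C(l.+2, l)%:R * _ * nm h ^+ 2) (tailC * nm h ^+ 3) (nm (jetdif lam u v l)).
move: (N ^+ 2 * (r + 2 * jetC * Ei) * Eq ^+ 2) (N ^+ 2) (Eq ^+ 2 * Ei) => Y N2 P.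
move=> W X V U a2 a3 a4 b0 b1 fl P0 r0' C0 M0.
have N20 : 0 <= N2 by lra.
have c1 : N * r <= N2 * r by rewrite ler_wpM2r.
have c2 : 0 <= N2 * jetC * r by apply: mulr_ge0 => //; apply: mulr_ge0.
have c3 : 0 <= N2 * P by rewrite mulr_ge0.
have c4 : 0 <= tailC * r by rewrite mulr_ge0.
lra.
Qed.

End TwoPoints.

End Move.

(** * Dyadic cells and the chart *)

Section Dyadic.
Variable R : realType.
Implicit Types (x e : R) (l m n : nat).

(** Reduction modulo 2^l only makes the index total; on [0, 1) it changes nothing. *)
Definition idx1 l x : 'I_(2 ^ l) :=
  Ordinal (ltn_pmod (Num.truncn (x * 2 ^+ l)) (expn_gt0 2 l)).

Lemma idx1_itv l x : 0 <= x < 1 -> (idx1 l x)%:R <= x * 2 ^+ l < (idx1 l x)%:R + 1.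
Proof.
move=> /andP[x0 x1]; have y0 : 0 <= x * 2 ^+ l by rewrite mulr_ge0 // exprn_ge0.
have E : nat_of_ord (idx1 l x) = Num.truncn (x * 2 ^+ l).
  rewrite [LHS]/= modn_small // truncn_lt_nat // natrX.
  by rewrite -[X in _ < X]mul1r ltr_pM2r ?exprn_gt0.
by rewrite E natr1; exact: truncn_itv.
Qed.

Lemma idx1_close l x x' : 0 <= x < 1 -> 0 <= x' < 1 -> idx1 l x = idx1 l x' ->
  `|x - x'| <= 2 ^- l.
Proof.
move=> X X' E; have /andP[h1 h2] := idx1_itv l X; have /andP[h3 h4] := idx1_itv l X'.
rewrite -E in h3 h4; have p0 : 0 < (2 : R) ^+ l by rewrite exprn_gt0.
rewrite -(ler_pM2r p0) mulVf ?gt_eqF // -{1}(ger0_norm (ltW p0)) -normrM mulrBl.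
by rewrite ler_norml; apply/andP; split; lra.
Qed.

Lemma idx1_dist l x x' : 0 <= x < 1 -> 0 <= x' < 1 ->
  `|(idx1 l x)%:R - (idx1 l x')%:R| <= `|x - x'| * 2 ^+ l + 1.
Proof.
move=> X X'; have /andP[h1 h2] := idx1_itv l X; have /andP[h3 h4] := idx1_itv l X'.
have p0 : 0 < (2 : R) ^+ l by rewrite exprn_gt0.
rewrite -{1}(ger0_norm (ltW p0)) -normrM mulrBl.
move: h1 h2 h3 h4; move: (x * _) (x' * _) ((idx1 l x)%:R : R) ((idx1 l x')%:R : R) => a a' n n' h1 h2 h3 h4.
have := ler_norm (a - a'); have := ler_norm (- (a - a')); rewrite normrN => q1 q2.
by rewrite ler_norml; apply/andP; split; lra.
Qed.

Lemma dyadic_scale x : 0 < x -> x <= 1 -> exists m : nat, 2 ^- m <= x < 2 * 2 ^- m.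
Proof.
move=> x0 x1.
have [n hn] : exists n : nat, 2 ^- n <= x.
  have [n hn] := @geometric_small R (1 / 2) x ltac:(lra) ltac:(lra) x0.
  by exists n; rewrite -exprVn; have -> : (2 : R)^-1 = 1 / 2 by lra.
have ex : exists n, 2 ^- n <= x by exists n.
case: (ex_minnP ex) => -[|m] hm mmin.
  by exists 0%N; rewrite hm /= expr0 invr1; lra.
exists m.+1; rewrite hm /=.
case: (ltP x (2 * 2 ^- m.+1)) => // h.
have E : 2 * 2 ^- m.+1 = 2 ^- m :> R by rewrite exprS invfM mulrA divff ?mul1r ?pnatr_eq0.
rewrite E in h; have := mmin _ h.
by rewrite ltnn.
Qed.

Lemma dyadic_small x : 0 < x -> exists l0 : nat, forall l, (l0 <= l)%N -> 2 ^- l <= x.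
Proof.
move=> x0; have [n hn] := @geometric_small R (1 / 2) x ltac:(lra) ltac:(lra) x0.
exists n => l nl; apply: le_trans hn.
have -> : (1 / 2 : R) ^+ n = 2 ^- n by rewrite -exprVn; congr (_ ^+ _); lra.
by rewrite lef_pV2 ?posrE ?exprn_gt0 // ler_eXn2l // ltr1n.
Qed.

Lemma window_card N (n0 D : nat) :
  (#|[pred n : 'I_N | (n <= n0 + D) && (n0 <= n + D)]| <= (2 * D).+1)%N.
Proof.
rewrite cardE -(size_map val) -(size_iota (n0 - D) (2 * D).+1).
apply: uniq_leq_size; first by rewrite map_inj_uniq ?enum_uniq //; exact: val_inj.
move=> x /mapP[n]; rewrite mem_enum inE => /andP[h1 h2] ->; rewrite mem_iota /=.
move: h1 h2; move: (nat_of_ord n) => m; clear; lia.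
Qed.

End Dyadic.

Section Cells.
Variables (R : realType) (kk : nat).

Definition pt : Type := ((R * R) * ('I_kk -> R * R))%type.

Definition inU (y : pt) : Prop :=
  (0 <= y.1.1 < 1 /\ 0 <= y.1.2 < 1) /\
  forall j, 0 <= (y.2 j).1 < 1 /\ 0 <= (y.2 j).2 < 1.

Definition cell l : Type :=
  (('I_(2 ^ l) * 'I_(2 ^ l)) * {ffun 'I_kk -> 'I_(2 ^ l) * 'I_(2 ^ l)})%type.
HB.instance Definition _ l := Finite.copy (cell l)
  (('I_(2 ^ l) * 'I_(2 ^ l)) * {ffun 'I_kk -> 'I_(2 ^ l) * 'I_(2 ^ l)})%type.

Definition idx l (y : pt) : cell l :=
  ((idx1 l y.1.1, idx1 l y.1.2), [ffun j => (idx1 l (y.2 j).1, idx1 l (y.2 j).2)]).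

Definition ncell l : R := (4 ^+ l) ^+ kk.+1.

Lemma card_cell l : #|{: cell l}|%:R = ncell l.
Proof.
rewrite card_prod card_ffun !card_prod !card_ord /ncell exprS.
have -> : (4 : R) ^+ l = (2 ^ l * 2 ^ l)%N%:R by rewrite natrM natrX -exprMn -natrM.
by rewrite natrM; congr (_ * _); rewrite natrX.
Qed.

Lemma ncell_gt0 l : 0 < ncell l.
Proof. by rewrite !exprn_gt0. Qed.

(* A discrete substitute for an upper integral over X: one sample point per dyadic cell, so that no
   measurability is needed. *)
Definition AvgLe (X : pt -> Prop) (Theta : pt -> R) (beta : R) : Prop :=
  exists l0 : nat, forall l, (l0 <= l)%N ->
  forall (A : {set cell l}) (y : cell l -> pt),
    (forall c, c \in A -> X (y c) /\ idx l (y c) = c) ->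
    \sum_(c in A) Theta (y c) <= beta * ncell l.

Lemma AvgLe_cst X Theta beta : 0 <= beta -> (forall y, X y -> Theta y <= beta) -> AvgLe X Theta beta.
Proof.
move=> b0 H; exists 0%N => l _ A y hA.
apply: le_trans (_ : \sum_(c in A) beta <= _).
  by apply: ler_sum => c /hA[Xc _]; exact: H.
rewrite sumr_const -[_ *+ _]mulr_natr -card_cell ler_wpM2l // ler_nat max_card //.
Qed.

Lemma AvgLe_le X Theta Theta' beta beta' : (forall y, X y -> Theta y <= Theta' y) ->
  beta <= beta' -> AvgLe X Theta' beta -> AvgLe X Theta beta'.
Proof.
move=> H bb [l0 h]; exists l0 => l ll A y hA.
apply: le_trans (_ : beta * ncell l <= _); last by rewrite ler_wpM2r // ltW // ncell_gt0.
apply: le_trans (h l ll A y hA); apply: ler_sum => c /hA[Xc _]; exact: H.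
Qed.

Lemma AvgLe_add X Theta Theta' beta beta' : AvgLe X Theta beta -> AvgLe X Theta' beta' ->
  AvgLe X (fun y => Theta y + Theta' y) (beta + beta').
Proof.
move=> [l0 h] [l0' h']; exists (maxn l0 l0') => l; rewrite geq_max => /andP[ll ll'] A y hA.
by rewrite big_split mulrDl; apply: lerD; [exact: h | exact: h'].
Qed.

Lemma AvgLe_scale X Theta beta c : 0 <= c -> AvgLe X Theta beta ->
  AvgLe X (fun y => c * Theta y) (c * beta).
Proof.
move=> c0 [l0 h]; exists l0 => l ll A y hA; rewrite -mulr_sumr -mulrA ler_wpM2l //; exact: h.
Qed.

Lemma AvgLe_sum X n (Theta : nat -> pt -> R) beta :
  (forall i, (i < n)%N -> AvgLe X (Theta i) (beta i)) ->
  AvgLe X (fun y => \sum_(i < n) Theta i y) (\sum_(i < n) beta i).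
Proof.
elim: n => [|n IH] H.
  rewrite big_ord0; apply: AvgLe_cst => // y _; by rewrite big_ord0.
rewrite big_ord_recr /=.
apply: (AvgLe_le (Theta' := fun y => \sum_(i < n) Theta i y + Theta n y) _ (lexx _)).
  by move=> y _; rewrite big_ord_recr.
by apply: AvgLe_add; [apply: IH => i ii; apply: H; exact: ltnW | exact: H].
Qed.

End Cells.

Section Chart.
Variables (R : realType) (kk : nat).
Variables (b : R) (a0 : R[i]) (ac : 'I_kk -> R[i]).
Hypotheses (b0 : 0 < b) (b4 : b <= 1 / 4).

Definition cpx (x y : R) : R[i] := (x +i* y)%C.

Lemma nm_cpx x y : nm (cpx x y) <= `|x| + `|y|.
Proof.
rewrite /nm /= -(@ler_pXn2r _ 2) ?nnegrE ?sqrtr_ge0 ?addr_ge0 //.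
rewrite sqr_sqrtr ?addr_ge0 ?sqr_ge0 // sqrrD !real_normK ?num_real //.
by rewrite addrAC lerDl mulrn_wge0 // mulr_ge0.
Qed.

Lemma nm_Re (z : R[i]) : `|complex.Re z| <= nm z.
Proof.
case: z => x y; rewrite /nm /= -sqrtr_sqr ler_wsqrtr // lerDl sqr_ge0 //.
Qed.

Lemma nm_Im (z : R[i]) : `|complex.Im z| <= nm z.
Proof.
case: z => x y; rewrite /nm /= -sqrtr_sqr ler_wsqrtr // lerDr sqr_ge0 //.
Qed.

(* The chart lam = z * a of a neighbourhood of (a0, ac): z moves along the scaling direction, in which
   jets are taken, and a_0 = a0 is kept fixed. *)
Definition zY (y : pt R kk) : R[i] := cpx (1 + b * (2 * y.1.1 - 1)) (b * (2 * y.1.2 - 1)).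
Definition aY (y : pt R kk) j : R[i] :=
  ac j + cpx (b * (2 * (y.2 j).1 - 1)) (b * (2 * (y.2 j).2 - 1)).
Definition lamY (y : pt R kk) (i : 'I_kk.+1) : R[i] :=
  zY y * (if unlift ord0 i is Some j then aY y j else a0).

Lemma zY_sub y y' : zY y' - zY y = cpx (2 * b * (y'.1.1 - y.1.1)) (2 * b * (y'.1.2 - y.1.2)).
Proof. by apply/eqP; rewrite eq_complex /=; apply/andP; split; apply/eqP; ring. Qed.

Lemma aY_sub y y' j : aY y' j - aY y j =
  cpx (2 * b * ((y'.2 j).1 - (y.2 j).1)) (2 * b * ((y'.2 j).2 - (y.2 j).2)).
Proof. by rewrite /aY; case: (ac j) => u v; apply/eqP; rewrite eq_complex /=; apply/andP; split; apply/eqP; ring. Qed.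

Lemma zY_bound y : inU y -> 1 / 2 <= nm (zY y) <= 2.
Proof.
move=> [[/andP[h1 h2] /andP[h3 h4]] _].
have hb0 := b0; have hb4 := b4.
have E : zY y = 1 + cpx (b * (2 * y.1.1 - 1)) (b * (2 * y.1.2 - 1)).
  by apply/eqP; rewrite eq_complex /=; apply/andP; split; apply/eqP; ring.
have small : nm (cpx (b * (2 * y.1.1 - 1)) (b * (2 * y.1.2 - 1))) <= 1 / 2.
  apply: le_trans (nm_cpx _ _) _; rewrite !normrM (ger0_norm (ltW b0)).
  have k1 : `|2 * y.1.1 - 1| <= 1 by rewrite ler_norml; apply/andP; split; lra.
  have k2 : `|2 * y.1.2 - 1| <= 1 by rewrite ler_norml; apply/andP; split; lra.
  have := ler_wpM2l (ltW b0) k1; have := ler_wpM2l (ltW b0) k2; rewrite mulr1; lra.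
rewrite E; apply/andP; split; last by apply: le_trans (nmD _ _) _; rewrite nm1; lra.
set w := cpx _ _ in small *.
by have := nm_tri 1 (- w); rewrite nm1 opprK nmN; lra.
Qed.

Lemma chart_h y y' d : inU y -> inU y' ->
  `|y'.1.1 - y.1.1| <= d -> `|y'.1.2 - y.1.2| <= d -> nm (zY y' / zY y - 1) <= 2 * d.
Proof.
move=> U U' d1 d2; have /andP[z1 z2] := zY_bound U.
have hb0 := b0; have hb4 := b4.
have z0 : 0 < nm (zY y) by lra.
have znz : zY y != 0 by apply: contraTneq z0 => ->; rewrite nm0 ltxx.
have -> : zY y' / zY y - 1 = (zY y' - zY y) / zY y by field.
rewrite nmM nmV ler_pdivrMr // zY_sub; apply: le_trans (nm_cpx _ _) _.
rewrite !normrM !(ger0_norm (ltW b0)) normr_nat.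
have d0 : 0 <= d := le_trans (normr_ge0 _) d1.
have b20 : 0 <= 2 * b by lra.
have := ler_wpM2l b20 d1; have := ler_wpM2l b20 d2.
have : 2 * b * d <= d / 2.
  have : 0 <= (1 / 4 - b) * d by rewrite mulr_ge0 // subr_ge0.
  by lra.
have : d <= 2 * d * nm (zY y).
  have : 0 <= d * (nm (zY y) - 1 / 2) by rewrite mulr_ge0 // subr_ge0.
  by lra.
by lra.
Qed.

Lemma chart_h_inv y y' : inU y -> inU y' ->
  `|y'.1.1 - y.1.1| <= nm (zY y' / zY y - 1) / b /\
  `|y'.1.2 - y.1.2| <= nm (zY y' / zY y - 1) / b.
Proof.
move=> U U'; have /andP[z1 z2] := zY_bound U.
have hb0 := b0.
have z0 : 0 < nm (zY y) by lra.
have znz : zY y != 0 by apply: contraTneq z0 => ->; rewrite nm0 ltxx.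
have E : nm (zY y' - zY y) <= 2 * nm (zY y' / zY y - 1).
  have -> : zY y' - zY y = zY y * (zY y' / zY y - 1) by field.
  by rewrite nmM ler_wpM2r ?nm_ge0.
rewrite zY_sub in E.
have b2 : 0 < 2 * b by lra.
split; rewrite ler_pdivlMr // -(ler_pM2l (_ : 0 < 2)) //.
  have := le_trans (nm_Re _) E; rewrite /= normrM (ger0_norm (ltW b2)); lra.
have := le_trans (nm_Im _) E; rewrite /= normrM (ger0_norm (ltW b2)); lra.
Qed.

(** Moving z is exactly a scaling by 1 + h, so only the coordinates [aY] contribute to the error. *)
Lemma chart_err y y' d i : inU y -> inU y' -> 0 <= d ->
  (forall j, `|(y'.2 j).1 - (y.2 j).1| <= d /\ `|(y'.2 j).2 - (y.2 j).2| <= d) ->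
  nm (lamY y' i - (1 + (zY y' / zY y - 1)) * lamY y i) <= 2 * d.
Proof.
move=> U U' d0 Hd; have /andP[z1 z2] := zY_bound U; have /andP[z1' z2'] := zY_bound U'.
have hb0 := b0; have hb4 := b4.
have z0 : 0 < nm (zY y) by lra.
have znz : zY y != 0 by apply: contraTneq z0 => ->; rewrite nm0 ltxx.
rewrite /lamY; case: (unlift ord0 i) => [j|]; last first.
  have -> : zY y' * a0 - (1 + (zY y' / zY y - 1)) * (zY y * a0) = 0 by field.
  by rewrite nm0 mulr_ge0.
have -> : zY y' * aY y' j - (1 + (zY y' / zY y - 1)) * (zY y * aY y j) = zY y' * (aY y' j - aY y j).
  by field.
rewrite nmM; have [d1 d2] := Hd j.
have b20 : 0 <= 2 * b by lra.
have : nm (aY y' j - aY y j) <= d.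
  rewrite aY_sub; apply: le_trans (nm_cpx _ _) _; rewrite !normrM !(ger0_norm (ltW b0)) normr_nat.
  have := ler_wpM2l b20 d1; have := ler_wpM2l b20 d2.
  have : 0 <= (1 / 4 - b) * d by rewrite mulr_ge0 // subr_ge0.
  by lra.
move=> h; apply: ler_pM; rewrite ?nm_ge0 //.
Qed.

End Chart.

(** * Averaging over the scaling direction *)

Section AvgTransversal.
Variables (R : realType) (kk : nat).
Variables (p : 'I_kk.+1 -> R) (t : 'I_kk.+1 -> R[i]).
Hypothesis p_gt0 : forall i, 0 < p i.
Hypothesis p_sum : \sum_(i < kk.+1) p i = 1.
Variables (rho tau : R) (S : nat).
Hypotheses (rho0 : 0 <= rho) (rho1 : rho < 1) (tau0 : 0 <= tau).
Hypothesis t_le : forall i, nm (t i) <= tau.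
Variables (b : R) (a0 : R[i]) (ac : 'I_kk -> R[i]).
Hypotheses (b0 : 0 < b) (b4 : b <= 1 / 4).
Variable kap : R.
Hypothesis kap1 : 1 <= kap.
Variable X : pt R kk -> Prop.
Hypothesis XU : forall y, X y -> inU y.
Hypothesis Xrho : forall y, X y -> forall i, nm (lamY b a0 ac y i) <= rho.
Local Notation lam := (lamY b a0 ac).
Local Notation jetC := (jetC rho tau S).
Local Notation lipC := (lipC rho tau S).
Local Notation moveC := (moveC rho tau S).
Local Notation tailC := (tailC rho tau S).
Local Notation jetdif := (jetdif t).
Local Notation E := (Ew p).
Variables (T : seq 'I_kk.+1 -> seq 'I_kk.+1 -> bool) (L : nat).

(* Moving z by Eq turns top_event into moved_event, while top_event confines z to a disc of radius comparable to r / sg: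
   averaging over z gains the factor (r / (Ei Eq))^2. *)
Definition top_event s r sg Ei y u v : bool :=
  [&& T u v, small t (lam y) r s.+1 u v, sg < nm (jetdif (lam y) u v s.+1)
    & nm (jetdif (lam y) u v s.+1) <= 2 * jetC * Ei].

Definition moved_event s r Ei Eq y u v : bool :=
  [&& T u v, small t (lam y) (moveC * (r + Eq ^+ 2 * Ei)) s u v,
     nm (jetdif (lam y) u v s) <= moveC * (r + Eq * Ei) & nm (jetdif (lam y) u v s.+1) <= moveC * Ei].

Definition top_energy s r sg Ei y : R := E L (fun u => E L (fun v => (top_event s r sg Ei y u v)%:R)).
Definition moved_energy s r Ei Eq y : R := E L (fun u => E L (fun v => (moved_event s r Ei Eq y u v)%:R)).

Lemma top_event_move s r sg Ei Eq y y' u v d e : X y -> X y' -> (s.+1 <= S)%N ->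
  0 <= r -> 0 <= Eq -> Eq <= Ei -> Ei <= 1 -> 0 <= e -> 2 * d <= Eq -> 2 * d <= xr rho ->
  lipC * (2 * e) <= r -> lipC * (2 * e) <= Ei ->
  `|y'.1.1 - y.1.1| <= d -> `|y'.1.2 - y.1.2| <= d ->
  (forall j, `|(y'.2 j).1 - (y.2 j).1| <= e /\ `|(y'.2 j).2 - (y.2 j).2| <= e) ->
  top_event s r sg Ei y u v -> moved_event s r Ei Eq y' u v.
Proof.
move=> Xy Xy' sS r0 Eq0 EqEi Ei1 e0 dE dx er eE d1 d2 da /and4P[typ_dif /smallP low _ top].
have hd := chart_h b0 b4 (XU Xy) (XU Xy') d1 d2.
have herr i := chart_err a0 ac b0 b4 i (XU Xy) (XU Xy') e0 da.
have B := Xrho Xy; have B' := Xrho Xy'.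
have hx := le_trans hd dx; have hE := le_trans hd dE.
have e20 : 0 <= 2 * e by rewrite mulr_ge0.
apply/and4P; split => //.
- apply/smallP => l ls.
  exact: (@moved_low _ _ t rho tau S rho0 rho1 tau0 t_le (lam y) (lam y') _ _ B B' hx e20 herr
      Ei Eq r s.+1 u v Eq0 EqEi Ei1 hE r0 er sS low top l).
- exact: (@moved_mid _ _ t rho tau S rho0 rho1 tau0 t_le (lam y) (lam y') _ _ B B' hx e20 herr
      Ei Eq r s.+1 u v Eq0 EqEi hE r0 er sS low top s erefl).
- exact: (@moved_top _ _ t rho tau S rho0 rho1 tau0 t_le (lam y) (lam y') _ _ B B' hx e20 herr
      Ei Eq s.+1 u v Eq0 EqEi hE eE sS top).
Qed.

Definition C3 : R := 2 * (1 + 2 ^+ S.+1) * kap.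

Lemma C3_ge0 : 0 <= C3.
Proof. by rewrite !mulr_ge0 ?addr_ge0 ?exprn_ge0 // (le_trans _ kap1). Qed.

Lemma top_event_close s r sg Ei y y' u v d e : X y -> X y' -> (s.+1 <= S)%N ->
  0 <= r -> 0 < Ei -> Ei <= kap * sg -> 0 <= e -> 2 * d <= xr rho -> 4 * tailC * d <= sg ->
  lipC * (2 * e) <= r ->
  `|y'.1.1 - y.1.1| <= d -> `|y'.1.2 - y.1.2| <= d ->
  (forall j, `|(y'.2 j).1 - (y.2 j).1| <= e /\ `|(y'.2 j).2 - (y.2 j).2| <= e) ->
  top_event s r sg Ei y u v -> top_event s r sg Ei y' u v ->
  `|y'.1.1 - y.1.1| <= C3 * r / (b * Ei) /\ `|y'.1.2 - y.1.2| <= C3 * r / (b * Ei).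
Proof.
move=> Xy Xy' sS r0 Ei0 Esg e0 dx dM er d1 d2 da /and4P[_ /smallP low sgt _] /and4P[_ /smallP low' _ _].
have hd := chart_h b0 b4 (XU Xy) (XU Xy') d1 d2.
have herr i := chart_err a0 ac b0 b4 i (XU Xy) (XU Xy') e0 da.
have B := Xrho Xy; have B' := Xrho Xy'.
have hx := le_trans hd dx.
have e20 : 0 <= 2 * e by rewrite mulr_ge0.
have k0 : 0 < kap by rewrite (lt_le_trans _ kap1).
have sg0 : 0 < sg by rewrite -(pmulr_rgt0 _ k0) (lt_le_trans Ei0).
have M0 : 0 <= tailC := tailC_ge0 S rho0 rho1 tau0.
have hM : 2 * tailC * nm (zY b y' / zY b y - 1) <= sg.
  apply: le_trans dM; have := ler_wpM2l M0 hd; lra.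
have f1 : nm (jetdif (lam y) u v s) <= r by apply: low.
have f2 : nm (jetdif (lam y') u v s) <= r by apply: low'.
have h1 := transversal rho0 rho1 tau0 t_le B B' hx e20 herr sS sg0 er f1 f2 sgt hM.
have h2 : nm (zY b y' / zY b y - 1) <= C3 * r / Ei.
  apply: (le_trans h1); rewrite ler_pdivrMr // [X in _ <= X]mulrAC ler_pdivlMr //.
  have -> : C3 * r * sg = (2 * (1 + 2 ^+ S.+1) * r) * (kap * sg) by rewrite /C3; ring.
  by apply: ler_wpM2l => //; rewrite mulr_ge0 // mulr_ge0 // addr_ge0 // exprn_ge0.
have [g1 g2] := chart_h_inv b0 b4 (XU Xy) (XU Xy').
have h3 : nm (zY b y' / zY b y - 1) / b <= C3 * r / (b * Ei).
  have -> : C3 * r / (b * Ei) = C3 * r / Ei / b by field; rewrite (gt_eqF b0) (gt_eqF Ei0).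
  by rewrite ler_wpM2r // invr_ge0 ltW.
by split; [exact: le_trans g1 h3 | exact: le_trans g2 h3].
Qed.

(** The fraction of Eq by which z is moved: it keeps |h| below [xr], and the quadratic Taylor term
    in [transversal] below half of the linear one. *)
Definition c1 : R := xr rho / (2 * (1 + 4 * tailC * kap)).
Definition CT : R := 4 / c1 ^+ 2 * (2 * C3 / b + 5) ^+ 2.

Lemma W4_ge0 : 0 <= 4 * tailC * kap.
Proof.
apply: mulr_ge0; last exact: le_trans ler01 kap1.
by apply: mulr_ge0 => //; exact: tailC_ge0.
Qed.

Lemma c1_gt0 : 0 < c1.
Proof.
rewrite /c1; apply: divr_gt0; first exact: xr_gt0.
by rewrite mulr_gt0 // ltr_pwDl // W4_ge0.
Qed.

Lemma c1_le : 2 * c1 <= xr rho /\ 4 * tailC * kap * c1 <= 1.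
Proof.
have M0 : 0 <= tailC := tailC_ge0 S rho0 rho1 tau0.
have x0 := xr_gt0 rho1; have x1 := xr_le rho0.
have W0 := W4_ge0.
have c0 := c1_gt0.
have E1 : 2 * c1 * (1 + 4 * tailC * kap) = xr rho.
  by rewrite /c1; field; rewrite gt_eqF // ltr_pwDl.
have : 0 <= c1 * (4 * tailC * kap) by rewrite mulr_ge0 // ltW.
move: (4 * tailC * kap) W0 E1 => W W0 E1; rewrite [W * c1]mulrC; split; lra.
Qed.

Lemma CT_ge0 : 0 <= CT.
Proof. by rewrite mulr_ge0 ?sqr_ge0 // divr_ge0 // sqr_ge0. Qed.

(** The sampled cells are grouped by the square of side about c1 Eq that contains z and by the fine
    cell of the other coordinates. In one group a pair (u, v) has its [top_event] in at most D
    cells, with D about (r / Ei)^2 4^l, and it then has its [moved_event] at a fixed representative.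
    A group thus contributes at most D beta, and there are about Eq^-2 groups for each fine cell of
    the other coordinates. *)
Lemma avg_transversal s r sg Ei Eq beta : (s.+1 <= S)%N ->
  0 < r -> 0 < Eq -> Eq <= Ei -> Ei <= 1 -> Ei <= kap * sg -> 0 <= beta ->
  (forall y, X y -> moved_energy s r Ei Eq y <= beta) ->
  AvgLe X (top_energy s r sg Ei) (CT * (r / (Ei * Eq)) ^+ 2 * beta).
Proof.
move=> sS r0 Eq0 EqEi Ei1 Esg beta0 HT.
have Ei0 := lt_le_trans Eq0 EqEi.
have Eq1 := le_trans EqEi Ei1.
have c0 := c1_gt0; have [c1x c1M] := c1_le; have x8 := xr_le rho0.
have k0 : 0 < kap by rewrite (lt_le_trans _ kap1).
have M0 : 0 <= tailC := tailC_ge0 S rho0 rho1 tau0.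
have L0 : 0 <= lipC := lipC_ge0 S rho0 rho1 tau0.
have xi0 : 0 < c1 * Eq by rewrite mulr_gt0.
have xi1 : c1 * Eq <= 1 by apply: le_trans (ler_wpM2l (ltW c0) Eq1) _; lra.
have [lq /andP[lq1 lq2]] := dyadic_scale xi0 xi1.
set d := 2 ^- lq in lq1 lq2.
have dEq : 2 * d <= Eq.
  have : 2 * c1 * Eq <= 1 * Eq by rewrite ler_wpM2r ?ltW //; lra.
  by lra.
have dx : 2 * d <= xr rho.
  have : 2 * c1 * Eq <= 2 * c1 by rewrite ler_piMr // mulr_ge0 // ltW.
  by lra.
have dM : 4 * tailC * d <= sg.
  have h1 : 4 * tailC * d <= 4 * tailC * (c1 * Eq) by rewrite ler_wpM2l // mulr_ge0.
  rewrite -(ler_pM2l k0); apply: le_trans Esg; apply: le_trans EqEi.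
  apply: le_trans (ler_wpM2l (ltW k0) h1) _.
  have -> : kap * (4 * tailC * (c1 * Eq)) = (4 * tailC * kap * c1) * Eq by ring.
  by rewrite ler_piMl // ltW.
have m0 : 0 < Num.min r Ei / (2 * lipC + 1).
  by rewrite divr_gt0 ?lt_min ?r0 ?Ei0 // ltr_wpDl // mulr_ge0.
have [l1 Hl1] := dyadic_small m0.
exists (maxn lq l1) => l; rewrite geq_max => /andP[lql ll1] A y HA.
set e := 2 ^- l : R.
have e0 : 0 < e by rewrite invr_gt0 exprn_gt0.
have eM : (2 * lipC + 1) * e <= Num.min r Ei.
  by rewrite mulrC -ler_pdivlMr ?Hl1 // ltr_wpDl // mulr_ge0.
have [erE eEE] : (2 * lipC + 1) * e <= r /\ (2 * lipC + 1) * e <= Ei.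
  by move: eM; rewrite le_min => /andP[].
have CLe : lipC * (2 * e) <= (2 * lipC + 1) * e by have := ltW e0; lra.
have er := le_trans CLe erE; have eE := le_trans CLe eEE.
have e_le_r : e <= r.
  apply: le_trans erE; have eL : 0 <= lipC * e := mulr_ge0 L0 (ltW e0).
  rewrite mulrDl mul1r lerDr -mulrA; apply: mulr_ge0 => //.
pose key (c : cell kk l) := ((idx1 lq (y c).1.1, idx1 lq (y c).1.2), (idx l (y c)).2).
have P0 : 0 <= C3 * r / (b * Ei) * 2 ^+ l.
  apply: mulr_ge0; last exact: exprn_ge0.
  by apply: divr_ge0; apply: mulr_ge0; rewrite ?C3_ge0 //; exact: ltW.
(* Two more than the truncation: one for rounding down, one for the index error in [idx1_dist]. *)
pose N0 := (Num.truncn (C3 * r / (b * Ei) * 2 ^+ l)).+2.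
pose D := ((2 * N0).+1 * (2 * N0).+1)%N.
have close c c' : c \in A -> c' \in A -> key c = key c' ->
    [/\ `|(y c').1.1 - (y c).1.1| <= d, `|(y c').1.2 - (y c).1.2| <= d &
     forall j, `|((y c').2 j).1 - ((y c).2 j).1| <= e /\ `|((y c').2 j).2 - ((y c).2 j).2| <= e].
  move=> cA cA' [k1 k2 k3].
  have [Xc _] := HA c cA; have [Xc' _] := HA c' cA'.
  have [[U1 U2] U3] := XU Xc; have [[U1' U2'] U3'] := XU Xc'.
  split; first by apply: idx1_close => //; apply: val_inj.
    by apply: idx1_close => //; apply: val_inj.
  move=> j; have := congr1 (fun f : {ffun 'I_kk -> _} => f j) k3; rewrite !ffunE => -[q1 q2].
  have [U4 U5] := U3 j; have [U4' U5'] := U3' j.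
  by split; apply: idx1_close => //; apply: val_inj.
have inner k' : \sum_(c in A | key c == k') top_energy s r sg Ei (y c) <= D%:R * beta.
  case: (pickP [pred c in A | key c == k']) => [c0' /andP[c0A /eqP kc0]|none]; last first.
    rewrite big_pred0 ?mulr_ge0 // => c; exact: none.
  have [Xc0 _] := HA _ c0A.
  apply: le_trans (_ : D%:R * moved_energy s r Ei Eq (y c0') <= _); last by rewrite ler_wpM2l // HT.
  rewrite /top_energy /moved_energy -Ew_sum -EwZ; apply: Ew_le => // u _.
  rewrite -Ew_sum -EwZ; apply: Ew_le => // v _.
  (* [c0'] represents the group and does not depend on u and v, so that the expectation can be taken
     at [c0']. [c2] is a cell where the event of (u, v) holds and centres the counting window. *)
  case: (pickP [pred c in A | (key c == k') && top_event s r sg Ei (y c) u v]) => [c2|none]; last first.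
    rewrite big1 ?mulr_ge0 // => c /andP[cA kc]; case ev : top_event => //.
    by have := none c; rewrite /= cA kc ev.
  move=> /and3P[c2A /eqP kc2 ev2].
  have [Xc2 _] := HA _ c2A.
  have [q1 q2 q3] := close _ _ c2A c0A (etrans kc2 (esym kc0)).
  rewrite (top_event_move Xc2 Xc0 sS (ltW r0) (ltW Eq0) EqEi Ei1 (ltW e0) dEq dx er eE q1 q2 q3 ev2) mulr1.
  rewrite (bigID (fun c => top_event s r sg Ei (y c) u v)) /= [X in _ + X]big1 ?addr0; last first.
    by move=> c /andP[_ /negbTE ->].
  rewrite (eq_bigr (fun=> 1)); last by move=> c /andP[_ ->].
  rewrite sumr_const ler_nat.
  pose W (n0 : 'I_(2 ^ l)) := [pred n : 'I_(2 ^ l) | (n <= n0 + N0)%N && (n0 <= n + N0)%N].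
  have sub c : (c \in A) && (key c == k') && top_event s r sg Ei (y c) u v ->
      [/\ c.1.1 \in W c2.1.1, c.1.2 \in W c2.1.2 & c.2 = c2.2].
    move=> /andP[/andP[cA /eqP kc] ev].
    have [Xc cE] := HA _ cA; have [_ c2E] := HA _ c2A.
    have [w1 w2 w3] := close _ _ c2A cA (etrans kc2 (esym kc)).
    have [z1 z2] := top_event_close Xc2 Xc sS (ltW r0) Ei0 Esg (ltW e0) dx dM er w1 w2 w3 ev2 ev.
    have [[U1 U2] _] := XU Xc; have [[U1' U2'] _] := XU Xc2.
    have kk2 : c.2 = c2.2.
      rewrite -cE -c2E; have := kc; rewrite -kc2 /key => -[_ _]; by [].
    have win (n n2 : nat) (x x' : R) : `|(n%:R : R) - n2%:R| <= `|x' - x| * 2 ^+ l + 1 ->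
        `|x' - x| <= C3 * r / (b * Ei) -> (n <= n2 + N0)%N && (n2 <= n + N0)%N.
      move=> g1 g2; have /andP[_ tr] := truncn_itv P0.
      have g3 : `|(n%:R : R) - n2%:R| <= N0%:R.
        apply: (le_trans g1); rewrite -[N0%:R]natr1 lerD2r; apply: le_trans (ltW tr).
        by rewrite ler_wpM2r // exprn_ge0.
      move: g3; rewrite ler_norml => /andP[g3 g4].
      by rewrite -!(ler_nat R) !natrD; apply/andP; split; lra.
    have q11 : idx1 l (y c).1.1 = c.1.1 := congr1 (fun x : cell kk l => x.1.1) cE.
    have q12 : idx1 l (y c).1.2 = c.1.2 := congr1 (fun x : cell kk l => x.1.2) cE.
    have q21 : idx1 l (y c2).1.1 = c2.1.1 := congr1 (fun x : cell kk l => x.1.1) c2E.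
    have q22 : idx1 l (y c2).1.2 = c2.1.2 := congr1 (fun x : cell kk l => x.1.2) c2E.
    split; last exact: kk2.
      by rewrite inE -q11 -q21; exact: win (idx1_dist l U1 U1') z1.
    by rewrite inE -q12 -q22; exact: win (idx1_dist l U2 U2') z2.
  rewrite /D.
  apply: leq_trans (_ : #|[predX W c2.1.1 & W c2.1.2]| <= _)%N; last first.
    by rewrite cardX leq_mul // window_card.
  (* The other coordinates agree within a group, so cells are counted by their z-index alone. *)
  rewrite -(@card_in_imset _ _ (fun c : cell kk l => c.1)); last first.
    move=> c c' /sub[_ _ h] /sub[_ _ h'] h1; move: h h' h1.
    by case: c => [? ?]; case: c' => [? ?] /= -> -> ->.
  apply/subset_leq_card/fintype.subsetP => x /imsetP[c /sub[s1 s2 _] ->].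
  by rewrite inE; apply/andP.
pose KT := (('I_(2 ^ lq) * 'I_(2 ^ lq)) * {ffun 'I_kk -> 'I_(2 ^ l) * 'I_(2 ^ l)})%type.
rewrite (partition_big (key : cell kk l -> KT) xpredT) //=.
apply: le_trans (_ : \sum_(k' : KT) D%:R * beta <= _); first by apply: ler_sum => k' _; exact: inner.
rewrite sumr_const -[_ *+ _]mulr_natr card_prod card_ffun !card_prod !card_ord.
have four m : (4 : R) ^+ m = (2 ^ m * 2 ^ m)%N%:R by rewrite natrM natrX -exprMn -natrM.
have -> : ((2 ^ lq * 2 ^ lq * (2 ^ l * 2 ^ l) ^ kk)%N%:R : R) = 4 ^+ lq * (4 ^+ l) ^+ kk.
  by rewrite !four -natrX -natrM.
have lqE : (4 : R) ^+ lq <= 4 / (c1 * Eq) ^+ 2.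
  rewrite ler_pdivlMr ?exprn_gt0 //.
  have -> : (4 : R) ^+ lq = (2 ^+ lq) ^+ 2 by rewrite -exprM mulnC exprM; congr (_ ^+ _); ring.
  rewrite -exprMn.
  have h1 : 2 ^+ lq * (c1 * Eq) <= 2.
    by rewrite mulrC -ler_pdivlMr ?exprn_gt0 // ltW.
  have h2 : 0 <= 2 ^+ lq * (c1 * Eq) by rewrite mulr_ge0 ?exprn_ge0 // ltW.
  have : (2 ^+ lq * (c1 * Eq)) ^+ 2 <= 2 ^+ 2 by rewrite lerXn2r ?nnegrE.
  by move/le_trans; apply; lra.
have DE : D%:R <= ((2 * C3 / b + 5) * (r / Ei)) ^+ 2 * 4 ^+ l.
  have -> : (4 : R) ^+ l = (2 ^+ l) ^+ 2 by rewrite -exprM mulnC exprM; congr (_ ^+ _); ring.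
  rewrite -exprMn /D natrM -expr2.
  have tr : (Num.truncn (C3 * r / (b * Ei) * 2 ^+ l))%:R <= C3 * r / (b * Ei) * 2 ^+ l.
    by have /andP[] := truncn_itv P0.
  set Q := C3 * r / (b * Ei) * 2 ^+ l in P0 tr.
  have QE : (2 * C3 / b + 5) * (r / Ei) * 2 ^+ l = 2 * Q + 5 * (r / Ei * 2 ^+ l).
    by rewrite /Q; field; rewrite (gt_eqF b0) (gt_eqF Ei0).
  (* A fine cell is not larger than r, so the additive 5 is absorbed in the main term. *)
  have big : 1 <= r / Ei * 2 ^+ l.
    rewrite mulrAC ler_pdivlMr // mul1r (le_trans Ei1) //.
    by rewrite mulrC -ler_pdivrMl ?exprn_gt0 // mulr1.
  have N0E : ((2 * N0).+1%:R : R) = 2 * (Num.truncn Q)%:R + 5.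
    by rewrite -natr1 natrM /N0 -/Q -[(Num.truncn Q).+2%:R]natr1 -[(Num.truncn Q).+1%:R]natr1; ring.
  have up : ((2 * N0).+1%:R : R) <= (2 * C3 / b + 5) * (r / Ei) * 2 ^+ l by rewrite QE N0E; lra.
  by rewrite lerXn2r ?nnegrE // (le_trans _ up).
have D0 : 0 <= (D%:R : R) by [].
have q0 : 0 <= (4 : R) ^+ lq by rewrite exprn_ge0.
have n0 : 0 <= ((4 : R) ^+ l) ^+ kk by rewrite !exprn_ge0.
have := ler_pM D0 q0 DE lqE => /(ler_wpM2r n0) /(ler_wpM2l beta0) fin.
have -> : D%:R * beta * (4 ^+ lq * (4 ^+ l) ^+ kk) = beta * (D%:R * 4 ^+ lq * (4 ^+ l) ^+ kk) by ring.
apply: (le_trans fin); rewrite le_eqVlt; apply/orP; left; apply/eqP.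
rewrite /CT /ncell [_ ^+ kk.+1]exprS.
have c0' := c0; move: (((4 : R) ^+ l) ^+ kk) ((4 : R) ^+ l) C3 c1 c0' => n4 m4 y3 y1 y10. field.
by rewrite (gt_eqF Ei0) (gt_eqF Eq0) (gt_eqF y10) (gt_eqF b0).
Qed.

End AvgTransversal.

(** * Case analysis on the size of the next jet *)

Section Cases.
Variables (R : realType) (kk : nat).
Variables (p : 'I_kk.+1 -> R) (t : 'I_kk.+1 -> R[i]) (chi : 'I_kk.+1 -> R).
Variables (Chi H eps : R).
Hypothesis p_gt0 : forall i, 0 < p i.
Hypothesis p_sum : \sum_(i < kk.+1) p i = 1.
Hypothesis Chi0 : 0 <= Chi.
Hypothesis eps0 : 0 <= eps.
Variables (rho tau : R) (S : nat) (Cp : R).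
Hypotheses (rho0 : 0 <= rho) (rho1 : rho < 1) (tau1 : 1 <= tau).
Hypothesis t_le : forall i, nm (t i) <= tau.
Hypothesis S1 : (1 <= S)%N.
Hypothesis Cp1 : 1 <= Cp.
Hypothesis HCp : forall n : nat, (n.+1%:R : R) ^+ S <= Cp * expR (eps * n%:R).
Variables (b : R) (a0 : R[i]) (ac : 'I_kk -> R[i]).
Hypotheses (b0 : 0 < b) (b4 : b <= 1 / 4).
Variable X : pt R kk -> Prop.
Hypothesis XU : forall y, X y -> inU y.
Hypothesis XB : forall y, X y -> inB chi eps rho (lamY b a0 ac y).
Local Notation lam := (lamY b a0 ac).
Local Notation jetC := (jetC rho tau S).
Local Notation moveC := (moveC rho tau S).
Local Notation C1 := (C1 S jetC Cp).
Local Notation C2 := (C2 S Cp).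
Local Notation kap := (expR Chi).
Local Notation jetdif := (jetdif t).
Local Notation EE := (Ew p).
Local Notation typ := (typ p chi Chi H eps).
Local Notation PsiF := (PsiF p t chi Chi H eps).
Local Notation PhiF := (PhiF p t chi Chi H eps).
Local Notation claim := (claim p t chi Chi H eps).
Local Notation claimPhi := (claimPhi p t chi Chi H eps).
Local Notation sc n := (expR (- Chi * n%:R)).

Let tau0 : 0 <= tau := le_trans ler01 tau1.
Let Cj0 : 0 <= jetC := jetC_ge0 S rho0 rho1 tau0.
Let HCj (lam : 'I_kk.+1 -> R[i]) u l : inB chi eps rho lam -> (l <= S)%N -> nm (jet t lam u l) <= jetC :=
  fun B lS => jet_le rho0 rho1 tau0 t_le u (fun i => (B i).2) lS.

Lemma jetC_ge1 : 1 <= jetC.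
Proof.
have x0 := xr_gt0 rho1; have x1 := xr_le1 rho0; have r1 := rhox1 rho0 rho1.
have h : tau <= tau / (1 - rho * (1 + xr rho)).
  have d0 : 0 < 1 - rho * (1 + xr rho) by rewrite subr_gt0.
  rewrite ler_pdivlMr // ler_piMr // lerBlDr lerDl mulr_ge0 // addr_ge0 //; exact: ltW.
apply: (le_trans tau1); apply: (le_trans h); rewrite ler_peMr //.
  exact: le_trans tau0 h.
by rewrite invf_ge1 ?exprn_gt0 // exprn_ile1 // ltW.
Qed.

Definition typ_dif K (u v : seq 'I_kk.+1) : bool := [&& dif u v, typ K u & typ K v].

(* Either the next jet has size about exp (- Chi i) for some i < n / 2 (case B i, estimated by
   transversality) or it is below exp (- Chi n / 2) (case A, estimated by splitting words at n / 2). *)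
Definition caseB s L K n i y : R :=
  top_energy p t rho tau S b a0 ac (typ_dif K) L s (expR (K - Chi * n%:R)) (sc i.+1) (sc i) y.

Definition caseA s L K n y : R := EE L (fun u => EE L (fun v =>
  [&& typ_dif K u v, small t (lam y) (expR (K - Chi * n%:R)) s.+1 u v
    & nm (jetdif (lam y) u v s.+1) <= 2 * jetC * sc n./2]%:R)).

Lemma sc_le m n : (m <= n)%N -> sc n <= sc m.
Proof. by move=> mn; rewrite ler_expR !mulNr lerN2 ler_wpM2l // ler_nat. Qed.

Lemma sc_le1 n : sc n <= 1.
Proof. by have := sc_le (leq0n n); rewrite mulr0 expR0. Qed.

Lemma scD m n : sc (m + n) = sc m * sc n.
Proof. by rewrite -expRD natrD mulrDr. Qed.

Lemma rad_sc K n : expR (K - Chi * n%:R) = expR K * sc n.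
Proof. by rewrite -expRD mulNr. Qed.

Lemma scale_cases (x : R) N : x <= 2 * jetC ->
  (x <= 2 * jetC * sc N) || [exists i : 'I_N, (sc i.+1 < x) && (x <= 2 * jetC * sc i)].
Proof.
move=> hx; elim: N => [|N /orP[h|/existsP[i hi]]]; first by rewrite mulr0 expR0 mulr1 hx.
  case: (leP x (2 * jetC * sc N.+1)) => //= h2; apply/existsP; exists ord_max; rewrite /= h andbT.
  apply: le_lt_trans h2; rewrite ler_peMl ?expR_ge0 //.
  have := jetC_ge1; lra.
by apply/orP; right; apply/existsP; exists (widen_ord (leqnSn N) i).
Qed.

Lemma Psi_cases s L K n y : X y -> (s.+1 <= S)%N ->
  PsiF (lam y) s.+1 L K (expR (K - Chi * n%:R)) <=
  caseA s L K n y + \sum_(i < n./2) caseB s L K n i y.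
Proof.
move=> Xy sS; rewrite /caseA /caseB /top_energy -Ew_sum -EwD; apply: Ew_le => // u _.
rewrite -Ew_sum -EwD; apply: Ew_le => // v _.
case PT : [&& dif u v, typ K u, typ K v & small t (lam y) (expR (K - Chi * n%:R)) s.+1 u v]; last first.
  by rewrite addr_ge0 // sumr_ge0.
move: PT => /and4P[d t1 t2 sm].
have T1 : typ_dif K u v by rewrite /typ_dif d t1 t2.
have hx : nm (jetdif (lam y) u v s.+1) <= 2 * jetC.
  exact: (jetdif_le rho0 rho1 tau0 t_le u v (fun i => (XB Xy i).2) sS).
case/orP: (scale_cases n./2 hx) => [h|/existsP[i /andP[h1 h2]]].
  by rewrite T1 sm h lerDl sumr_ge0.
rewrite (bigD1 i) //= /top_event T1 sm h1 h2 addrCA lerDl addr_ge0 // sumr_ge0 //.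
Qed.

Section Bounds.
Variables (A C : R).
Hypotheses (A0 : 0 <= A) (C0 : 0 <= C).

(** The next jet is below exp (- Chi n / 2), so prefixes of length n / 2 have s + 2 jets small at
    their own scale; the tails are charged with s + 1 jets. *)
Lemma caseA_le s d0 d1 : (s.+1 <= S)%N ->
  (forall y, X y -> claim (lam y) s.+2 d1 A C) ->
  (forall y, X y -> claimPhi (lam y) s.+1 d0 A C) ->
  exists2 CA, 0 <= CA & forall L n K, (n <= L)%N -> 0 <= K -> forall y, X y ->
   caseA s L K n y <= CA * expR (7 * A * (K + eps * n%:R)
      - d1 * Chi * (n./2)%:R - d0 * Chi * (n - n./2)%N%:R).
Proof.
move=> sS H1 H0; set a := 2 * jetC.
have a1 : 1 <= a by have := jetC_ge1; rewrite /a; lra.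
exists (C ^+ 2 * expR (A * (ln (a + C1) + ln (C2 * a + C1)))).
  by rewrite mulr_ge0 ?exprn_ge0 ?expR_ge0.
move=> L n K nL K0 y Xy.
have n2n : (n./2 <= n)%N by rewrite -[X in (_ <= X)%N]odd_double_half -addnn addnA leq_addl.
have E1 : (n./2 + (n - n./2) = n)%N by rewrite subnKC.
have eK : 1 <= expR K by rewrite -expR0 ler_expR.
have L1 : (n - n./2 <= L - n./2)%N by exact: leq_sub2r.
have := @split_claim _ _ p t chi Chi H eps p_gt0 p_sum eps0 rho S jetC Cp Cj0 HCj Cp1 HCp
  (lam y) s.+1 s.+2 d0 d1 A C a n./2 (n - n./2) (L - n./2) K
  (expR (K - Chi * n%:R)) (a * expR (K - Chi * (n./2)%:R)) (XB Xy) (leqW sS) _ A0 C0 a1 K0 L1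
  (expR_ge0 _) (H1 y Xy) (H0 y Xy).
rewrite E1 subnKC ?(leq_trans n2n) // => /(_ sS _ (lexx _)) => h.
apply: le_trans (h _); last by rewrite ler_peMl ?expR_ge0.
apply: Ew_le => // u _; apply: Ew_le => // v _; apply: bool_le.
move=> /and3P[/and3P[-> -> ->] sm top] /=; rewrite sm /=.
have ha : expR (K - Chi * n%:R) <= a * expR (K - Chi * (n./2)%:R).
  rewrite !rad_sc; apply: le_trans (_ : expR K * sc n./2 <= _).
    by rewrite ler_wpM2l ?expR_ge0 // sc_le.
  by rewrite ler_peMl // mulr_ge0 ?expR_ge0.
apply/smallP => l; rewrite ltnS leq_eqVlt => /orP[/eqP ->|ls].
  apply: (le_trans top); rewrite rad_sc ler_wpM2l ?(le_trans _ a1) //.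
  by rewrite ler_peMl ?expR_ge0.
by apply: le_trans ha; move/smallP: sm; apply.
Qed.

Lemma ratioB K n i q : (expR (K - Chi * n%:R) / (sc i * sc q)) ^+ 2 =
  expR (2 * K - 2 * Chi * n%:R + 2 * Chi * i%:R + 2 * Chi * q%:R).
Proof. by rewrite -expRD -expRN -expRD -expRM_natl; congr expR; ring. Qed.

(** Transversality with Eq = Ei = exp (- Chi i) gains 2 n - 4 i in the exponent. The moved pairs
    have s + 1 jets small at scale 2 i and s + 2 jets at scale i, so splitting at i adds (d1 + d0)
    i. *)
Lemma caseB_le s d0 d1 : (s.+1 <= S)%N ->
  (forall y, X y -> claim (lam y) s.+2 d1 A C) ->
  (forall y, X y -> claimPhi (lam y) s.+1 d0 A C) ->
  exists2 CB, 0 <= CB & forall L n K i, (n <= L)%N -> 0 <= K -> (i.*2 <= n)%N ->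
   AvgLe X (caseB s L K n i) (CB * expR (7 * A * (K + 2 * eps * i%:R) + 2 * K
      - 2 * Chi * n%:R + (4 - d1 - d0) * Chi * i%:R)).
Proof.
move=> sS H1 H0; set a := 2 * moveC.
have G1 := moveC_ge1 S rho0 rho1 tau0.
have a1 : 1 <= a by rewrite /a; lra.
set Cs := C ^+ 2 * expR (A * (ln (a + C1) + ln (C2 * a + C1))).
have Cs0 : 0 <= Cs by rewrite mulr_ge0 ?exprn_ge0 ?expR_ge0.
have k1 : 1 <= kap by rewrite -expR0 ler_expR.
have CT0 := CT_ge0 rho tau S b kap.
exists (CT rho tau S b kap * Cs); first by rewrite mulr_ge0.
move=> L n K i nL K0 i2n.
have eK : 1 <= expR K by rewrite -expR0 ler_expR.
have iL : (i <= L)%N by apply: leq_trans nL; apply: leq_trans i2n; rewrite -addnn leq_addl.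
have L1 : (i <= L - i)%N by rewrite leq_subRL // addnn (leq_trans i2n).
set beta := Cs * expR (7 * A * (K + eps * (i + i)%N%:R) - d1 * Chi * i%:R - d0 * Chi * i%:R).
have beta0 : 0 <= beta by rewrite mulr_ge0 ?expR_ge0.
have HT y : X y -> moved_energy p t rho tau S b a0 ac (typ_dif K) L s (expR (K - Chi * n%:R)) (sc i) (sc i) y <= beta.
  move=> Xy.
  have := @split_claim _ _ p t chi Chi H eps p_gt0 p_sum eps0 rho S jetC Cp Cj0 HCj Cp1 HCp
    (lam y) s.+1 s.+2 d0 d1 A C a i i (L - i) K
    (a * expR (K - Chi * (i + i)%N%:R)) (a * expR (K - Chi * i%:R)) (XB Xy) (leqW sS) _ A0 C0 a1 K0 L1
    _ (H1 y Xy) (H0 y Xy) (lexx _) (lexx _).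
  rewrite subnKC // => /(_ sS) h; apply: le_trans (h _); last first.
    by rewrite mulr_ge0 ?expR_ge0 // (le_trans _ a1).
  apply: Ew_le => // u _; apply: Ew_le => // v _; apply: bool_le.
  move=> /and4P[/and3P[-> -> ->] /smallP low mid top] /=.
  have e2 : sc n <= sc i * sc i by rewrite -scD sc_le // addnn.
  have i0 : 0 <= sc i by rewrite expR_ge0.
  have i1 := sc_le1 i.
  have g1 : expR (K - Chi * n%:R) + sc i * sc i <= 2 * expR (K - Chi * (i + i)%N%:R).
    rewrite !rad_sc scD; have := ler_wpM2l (expR_ge0 K) e2.
    have : sc i * sc i <= expR K * (sc i * sc i) by rewrite ler_peMl // mulr_ge0.
    lra.
  have g2 : sc i ^+ 2 * sc i <= sc i * sc i.
    by rewrite expr2 ler_piMr // mulr_ge0.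
  have small1 l : (l < s.+1)%N -> nm (jetdif (lam y) u v l) <= a * expR (K - Chi * (i + i)%N%:R).
    rewrite ltnS leq_eqVlt => /orP[/eqP ->|ls].
      apply: (le_trans mid); rewrite /a [2 * moveC]mulrC -[moveC * 2 * _]mulrA ler_wpM2l // (le_trans _ G1) //.
    apply: (le_trans (low l ls)); rewrite /a [2 * moveC]mulrC -[moveC * 2 * _]mulrA ler_wpM2l ?(le_trans _ G1) //.
    by apply: le_trans g1; rewrite lerD2l.
  apply/andP; split; first by apply/smallP.
  apply/smallP => l; rewrite ltnS leq_eqVlt => /orP[/eqP ->|ls].
    apply: (le_trans top); apply: ler_pM => //; rewrite ?(le_trans _ G1) //; first by rewrite /a; lra.
    by rewrite rad_sc ler_peMl.
  apply: le_trans (small1 l ls) _; rewrite ler_wpM2l ?(le_trans _ a1) // !rad_sc.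
  by rewrite ler_wpM2l ?expR_ge0 // sc_le // leq_addl.
have Esg : sc i <= kap * sc i.+1.
  by rewrite -expRD ler_expR -natr1; lra.
have := avg_transversal p_gt0 rho0 rho1 tau0 t_le b0 b4 k1 XU (fun y Xy i => (XB Xy i).2) sS
  (expR_gt0 _) (expR_gt0 _) (lexx (sc i)) (sc_le1 i) Esg beta0 HT.
apply: AvgLe_le => //.
rewrite ratioB /beta mulrACA; apply: ler_wpM2l; first by rewrite mulr_ge0.
rewrite -expRD ler_expR natrD; lra.
Qed.

(** Eq = exp (- Chi q) is chosen with Eq^2 Ei about exp (- Chi n), so that after the move the jets
    up to s stay of order r, while the jet s + 1 grows to Eq Ei, about exp (- Chi (n - q)).
    Splitting at n - q charges prefixes with s + 2 jets and tails with s + 1. The condition 3 i <= n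
    gives Eq <= Ei. *)
Lemma caseI_le s d0 dy : (s.+2 <= S)%N ->
  (forall y, X y -> claim (lam y) s.+2 d0 A C) ->
  (forall y, X y -> claimPhi (lam y) s.+1 dy A C) ->
  exists2 CI, 0 <= CI & forall L n K i, (n <= L)%N -> 0 <= K -> (3 * i <= n)%N ->
   AvgLe X (caseB s.+1 L K n i) (CI * expR (7 * A * (K + eps * n%:R) + 2 * K
      - 2 * Chi * n%:R + 2 * Chi * i%:R + 2 * Chi * ((n - i)./2)%:R
      - d0 * Chi * (n - (n - i)./2)%N%:R - dy * Chi * ((n - i)./2)%:R)).
Proof.
move=> sS H1 H0.
have G1 := moveC_ge1 S rho0 rho1 tau0.
have k1 : 1 <= kap by rewrite -expR0 ler_expR.
set a := moveC * (1 + kap).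
have a1 : 1 <= a.
  by rewrite /a; apply: le_trans (_ : 1 * 1 <= _); [rewrite mulr1 | apply: ler_pM => //; lra].
set Cs := C ^+ 2 * expR (A * (ln (a + C1) + ln (C2 * a + C1))).
have Cs0 : 0 <= Cs by rewrite mulr_ge0 ?exprn_ge0 ?expR_ge0.
have CT0 := CT_ge0 rho tau S b kap.
exists (CT rho tau S b kap * Cs); first by rewrite mulr_ge0.
move=> L n K i nL K0 i3n; set q := (n - i)./2.
have eK : 1 <= expR K by rewrite -expR0 ler_expR.
have qd : (n <= 2 * q + i + 1)%N /\ (2 * q + i <= n)%N.
  have := odd_double_half (n - i); rewrite -/q -addnn; have : (odd (n - i) <= 1)%N by case: odd.
  move: i3n; move: (nat_of_bool _) => o; clear; lia.
case: qd => qd1 qd2.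
have iq : (i <= q)%N by move: qd1 i3n; clear; lia.
have qn : (q <= n)%N by move: qd2; clear; lia.
set n1 := (n - q)%N.
have E1 : (n1 + q = n)%N by rewrite /n1 subnK.
have n1L : (n1 <= L)%N by apply: leq_trans nL; rewrite -E1 leq_addr.
have L1 : (q <= L - n1)%N by rewrite leq_subRL // E1.
set beta := Cs * expR (7 * A * (K + eps * n%:R) - d0 * Chi * n1%:R - dy * Chi * q%:R).
have beta0 : 0 <= beta by rewrite mulr_ge0 ?expR_ge0.
have HT y : X y -> moved_energy p t rho tau S b a0 ac (typ_dif K) L s.+1 (expR (K - Chi * n%:R)) (sc i) (sc q) y <= beta.
  move=> Xy.
  have := @split_claim _ _ p t chi Chi H eps p_gt0 p_sum eps0 rho S jetC Cp Cj0 HCj Cp1 HCp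
    (lam y) s.+1 s.+2 dy d0 A C a n1 q (L - n1) K
    (a * expR (K - Chi * n%:R)) (a * expR (K - Chi * n1%:R)) (XB Xy) (leqW (ltnW sS)) (leqW sS) A0 C0 a1 K0 L1
    _ (H1 y Xy) (H0 y Xy).
  rewrite E1 subnKC // => h.
  have ar : 0 <= a * expR (K - Chi * n%:R) by rewrite mulr_ge0 ?expR_ge0 // (le_trans _ a1).
  apply: le_trans (h ar (lexx _) (lexx _)).
  apply: Ew_le => // u _; apply: Ew_le => // v _; apply: bool_le.
  move=> /and4P[/and3P[-> -> ->] /smallP low mid top] /=.
  have scS m m' : (m <= m' + 1)%N -> sc m' <= kap * sc m.
    move=> mm; rewrite -expRD ler_expR -(ler_nat R) natrD in mm *.
    have : Chi * m%:R <= Chi * (m'%:R + 1) by rewrite ler_wpM2l.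
    lra.
  have g1 : sc q ^+ 2 * sc i <= kap * sc n.
    by rewrite expr2 -!scD; apply: scS; move: qd1; clear; lia.
  have g2 : sc q * sc i <= kap * sc n1.
    by rewrite -scD; apply: scS; rewrite /n1; move: qd1; clear; lia.
  have eKc m x : x <= kap * sc m -> x <= kap * expR (K - Chi * m%:R).
    move/le_trans; apply; rewrite ler_wpM2l ?expR_ge0 // rad_sc ler_peMl ?expR_ge0 //.
  have mono : expR (K - Chi * n%:R) <= expR (K - Chi * n1%:R).
    by rewrite !rad_sc ler_wpM2l ?expR_ge0 // sc_le // leq_subr.
  apply/andP; split.
    apply/smallP => l ls; apply: (le_trans (low l ls)); rewrite /a -mulrA ler_wpM2l ?(le_trans _ G1) //.
    by rewrite mulrDl mul1r lerD2l; exact: eKc.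
  apply/smallP => l; rewrite ltnS leq_eqVlt => /orP[/eqP ->|ls].
    apply: (le_trans mid); rewrite /a -mulrA ler_wpM2l ?(le_trans _ G1) //.
    by rewrite mulrDl mul1r; apply: lerD => //; exact: eKc.
  apply: (le_trans (low l ls)); rewrite /a -mulrA ler_wpM2l ?(le_trans _ G1) //.
  rewrite mulrDl mul1r; apply: lerD => //.
  by apply: le_trans (eKc _ _ g1) _; rewrite ler_wpM2l ?expR_ge0.
have Esg : sc i <= kap * sc i.+1.
  by rewrite -expRD ler_expR -natr1; lra.
have := avg_transversal p_gt0 rho0 rho1 tau0 t_le b0 b4 k1 XU (fun y Xy i => (XB Xy i).2) sS
  (expR_gt0 _) (expR_gt0 _) (sc_le iq) (sc_le1 i) Esg beta0 HT.
apply: AvgLe_le => //.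
rewrite ratioB /beta mulrACA; apply: ler_wpM2l; first by rewrite mulr_ge0.
rewrite -expRD ler_expR; lra.
Qed.

End Bounds.
End Cases.

(** * Null sets in the chart *)

Section Content.
Variables (R : realType) (kk : nat).
Local Notation pt := (pt R kk).
Local Notation cell := (cell kk).
Local Notation ncell := (ncell R kk).
Implicit Types (X Y W : pt -> Prop) (l m n : nat).

Lemma idx1_refine m l (x : R) : 0 <= x < 1 -> (m <= l)%N ->
  nat_of_ord (idx1 m x) = (idx1 l x %/ 2 ^ (l - m))%N.
Proof.
move=> X ml; have /andP[h1 h2] := idx1_itv l X; have /andP[g1 g2] := idx1_itv m X.
set n := nat_of_ord (idx1 l x) in h1 h2 *; set j := nat_of_ord (idx1 m x) in g1 g2 *.
have D0 : (0 < 2 ^ (l - m))%N by rewrite expn_gt0.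
have lm : x * 2 ^+ l = x * 2 ^+ m * (2 ^ (l - m))%N%:R.
  by rewrite natrX -mulrA -exprD subnKC.
have d0 : 0 < (2 ^ (l - m))%N%:R :> R by rewrite ltr0n.
have a1 : (j * 2 ^ (l - m) <= n)%N.
  rewrite -ltnS -(ltr_nat R) natrM -natr1; apply: le_lt_trans h2.
  by rewrite lm ler_pM2r.
have a2 : (n < j.+1 * 2 ^ (l - m))%N.
  rewrite -(ltr_nat R) natrM -natr1; apply: le_lt_trans h1 _.
  by rewrite lm ltr_pM2r.
by apply/eqP; rewrite eqn_leq leq_divRL // a1 andTb -ltnS ltn_divLR.
Qed.

Lemma idx_refine m l (y y' : pt) : inU y -> inU y' -> (m <= l)%N ->
  idx l y = idx l y' -> idx m y = idx m y'.
Proof.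
move=> [[U1 U2] U3] [[V1 V2] V3] ml [e1 e2 e3].
have one (x x' : R) : 0 <= x < 1 -> 0 <= x' < 1 -> idx1 l x = idx1 l x' -> idx1 m x = idx1 m x' :> 'I_(2 ^ m).
  by move=> h h' e; apply: ord_inj; rewrite (idx1_refine h ml) (idx1_refine h' ml) e.
have E1 : idx1 m y.1.1 = idx1 m y'.1.1 by apply: one => //; exact: ord_inj.
have E2 : idx1 m y.1.2 = idx1 m y'.1.2 by apply: one => //; exact: ord_inj.
rewrite /idx E1 E2; congr (_, _); apply/ffunP => j; rewrite !ffunE.
have := congr1 (fun f : {ffun _ -> _} => f j) e3; rewrite !ffunE => -[q1 q2].
have [U4 U5] := U3 j; have [V4 V5] := V3 j.
have F1 : idx1 m (y.2 j).1 = idx1 m (y'.2 j).1 by apply: one => //; exact: ord_inj.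
have F2 : idx1 m (y.2 j).2 = idx1 m (y'.2 j).2 by apply: one => //; exact: ord_inj.
by rewrite F1 F2.
Qed.

Definition meet l Y : {set cell l} := [set c | `[< exists2 y, Y y & idx l y = c >]].
Definition content l Y : R := #|meet l Y|%:R / ncell l.

Lemma meetP l Y c : reflect (exists2 y, Y y & idx l y = c) (c \in meet l Y).
Proof. by rewrite inE; exact: asboolP. Qed.

Lemma content_ge0 l Y : 0 <= content l Y.
Proof. by rewrite divr_ge0 // ltW // ncell_gt0. Qed.

Lemma content_le l Y Y' : (forall y, Y y -> Y' y) -> content l Y <= content l Y'.
Proof.
move=> YY; apply: ler_wpM2r; first by rewrite invr_ge0 ltW // ncell_gt0.
rewrite ler_nat; apply: subset_leq_card.
by apply/fintype.subsetP => c /meetP[y /YY Yy yc]; apply/meetP; exists y.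
Qed.

(** A point of Y chosen in each cell that Y meets gives an admissible sample, to which the average
    bound applies. *)
Lemma markov X Y (Theta : pt -> R) beta tau : AvgLe X Theta beta -> 0 < tau ->
  (forall y, Y y -> X y /\ tau < Theta y) ->
  exists l0, forall l, (l0 <= l)%N -> content l Y <= beta / tau.
Proof.
move=> [l0 H] tau0 HY; exists l0 => l ll.
(* If Y is empty, the claim reduces to beta >= 0, which the empty sample provides. *)
have [y0|none] := pselect (exists y, Y y); last first.
  have -> : content l Y = 0.
    rewrite /content (_ : meet l Y = finset.set0) ?cards0 ?mul0r //.
    apply/finset.setP => c; rewrite finset.in_set0; apply/negP => /meetP[y Yy _]; by apply: none; exists y.
  have := H l ll finset.set0 (fun=> ((0, 0), fun=> (0, 0))).
  rewrite big_set0 => /(_ _)/(@divr_ge0 _ (beta * ncell l) (ncell l)).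
  rewrite mulfK ?gt_eqF ?ncell_gt0 // => h.
  rewrite divr_ge0 ?(ltW tau0) // h ?(ltW (ncell_gt0 _ _ _)) //.
  by move=> c; rewrite finset.in_set0.
have ex c : exists y, c \in meet l Y -> Y y /\ idx l y = c.
  have [/meetP[y Yy yc]|] := boolP (c \in meet l Y); first by exists y.
  by case: y0 => y _ _; exists y.
have [y Hy] := choice ex.
have := H l ll (meet l Y) y _; rewrite /content => h.
have {}h : \sum_(c in meet l Y) Theta (y c) <= beta * ncell l.
  by apply: h => c /Hy[/HY[Xy _] yc].
rewrite ler_pdivrMr ?ncell_gt0 // mulrAC ler_pdivlMr //.
apply: le_trans h.
have -> : #|meet l Y|%:R * tau = \sum_(c in meet l Y) tau by rewrite sumr_const mulr_natl.
by apply: ler_sum => c /Hy[/HY[_ /ltW]].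
Qed.

Definition tcell := {l : nat & cell l}.
Definition tvol (c : tcell) : R := (ncell (tag c))^-1.
Definition intc (c : tcell) (y : pt) : Prop := idx (tag c) y = tagged c.
Definition svol (s : seq tcell) : R := \sum_(c <- s) tvol c.

(** The index i is in range, so quantifying over the default d of [nth] only avoids choosing one. *)
Definition covers (s : nat -> seq tcell) Y : Prop :=
  forall y, Y y -> exists n, exists2 i, (i < size (s n))%N &
    forall d, intc (nth d (s n) i) y.

Definition nullY Y : Prop := forall delta : R, 0 < delta ->
  exists2 s : nat -> seq tcell, covers s Y & forall N, \sum_(n < N) svol (s n) <= delta.

Definition cells l (A : {set cell l}) : seq tcell := [seq Tagged cell c | c <- enum A].

Lemma svol_cells l (A : {set cell l}) : svol (cells A) = #|A|%:R / ncell l.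
Proof.
rewrite /svol big_map (eq_bigr (fun=> (ncell l)^-1)) // big_const_seq count_predT iter_addr_0.
by rewrite -cardE mulr_natl.
Qed.

Lemma cells_in l (A : {set cell l}) y : idx l y \in A ->
  exists2 i, (i < size (cells A))%N & forall d, intc (nth d (cells A) i) y.
Proof.
rewrite -mem_enum => h; exists (index (idx l y) (enum A)).
  by rewrite size_map index_mem.
by move=> d; rewrite (nth_map (idx l y)) ?index_mem // /intc /= nth_index.
Qed.

Lemma nullY_sub Y Y' : (forall y, Y y -> Y' y) -> nullY Y' -> nullY Y.
Proof. by move=> YY H d /H[s c v]; exists s => // y /YY/c. Qed.

Lemma geo_sum N : \sum_(i < N) (2 : R) ^- i.+1 <= 1.
Proof.
suff -> : \sum_(i < N) (2 : R) ^- i.+1 = 1 - 2 ^- N by rewrite gerBl invr_ge0 exprn_ge0.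
elim: N => [|N IH]; first by rewrite big_ord0 expr0 invr1 subrr.
by rewrite big_ord_recr /= IH exprS; field; rewrite expf_neq0 // pnatr_eq0.
Qed.

Lemma diag_sum (v : nat -> nat -> R) N : (forall i n, 0 <= v i n) ->
  \sum_(m < N) \sum_(i < m.+1) v i (m - i)%N <= \sum_(i < N) \sum_(n < N) v i n.
Proof.
move=> v0.
have E m : (m < N)%N -> \sum_(i < m.+1) v i (m - i)%N = \sum_(i < N | (i <= m)%N) v i (m - i)%N.
  by move=> mN; rewrite (big_ord_widen_cond N xpredT (fun i => v i (m - i)%N)) //.
rewrite (eq_bigr (fun m : 'I_N => \sum_(i < N | (i <= m)%N) v i (m - i)%N)); last by move=> m _; exact: E.
rewrite (exchange_big_dep xpredT) //=; apply: ler_sum => i _.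
rewrite -(big_mkord (fun j => i <= j)%N (fun j => v i (j - i)%N)).
rewrite -(big_mkord xpredT (v i)).
rewrite (@big_cat_nat _ _ _ i) //=; last exact: ltnW.
rewrite big_nat_cond big_pred0 ?add0r; last first.
  by move=> j; apply/negbTE/negP => /andP[/andP[_ h1] h2]; move: h1; rewrite ltnNge h2.
rewrite -{1}[nat_of_ord i]add0n big_addn.
apply: le_trans (_ : \sum_(0 <= j < N - i) v i j <= _).
  rewrite le_eqVlt; apply/orP; left; apply/eqP.
  by apply: eq_big => j; rewrite ?leq_addl // addnK.
rewrite [X in _ <= X](@big_cat_nat _ _ _ (N - i)) ?leq_subr //= lerDl sumr_ge0 //.
Qed.

(** The covers are merged along the antidiagonals i + n = m, so that each block is again a finite
    list. *)
Lemma nullY_bigcup (Y : nat -> pt -> Prop) : (forall i, nullY (Y i)) ->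
  nullY (fun y => exists i, Y i y).
Proof.
move=> H d d0.
have ex i : exists s : nat -> seq tcell, covers s (Y i) /\
    forall N, \sum_(n < N) svol (s n) <= d * 2 ^- i.+1.
  have e0 : 0 < d * 2 ^- i.+1 by rewrite mulr_gt0 // invr_gt0 exprn_gt0.
  by have [s c v] := H i _ e0; exists s.
have [s Hs] := choice ex.
exists (fun m => flatten [seq s i (m - i)%N | i <- iota 0 m.+1]).
  move=> y [i Yi]; have [c _] := Hs i; have [n [j jn Hj]] := c y Yi.
  exists (i + n)%N.
  pose ss := [seq s i' (i + n - i')%N | i' <- iota 0 (i + n).+1].
  have szi : (i < size ss)%N by rewrite size_map size_iota ltnS leq_addr.
  have ni : nth [::] ss i = s i n.
    by rewrite (nth_map 0%N) ?size_iota ?ltnS ?leq_addr // nth_iota ?ltnS ?leq_addr // add0n addKn.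
  exists (flatten_index (shape ss) i j).
    rewrite size_flatten; apply: flatten_indexP; rewrite nth_shape ni //.
  move=> d'; have := Hj d'; rewrite -ni.
  by rewrite nth_flatten flatten_indexKl ?flatten_indexKr // nth_shape ni.
move=> N.
have -> : \sum_(m < N) svol (flatten [seq s i (m - i)%N | i <- iota 0 m.+1]) =
    \sum_(m < N) \sum_(i < m.+1) svol (s i (m - i)%N).
  apply: eq_bigr => m _; rewrite /svol big_flatten big_map.
  by rewrite -(big_mkord xpredT (fun i => \sum_(c <- s i (m - i)%N) tvol c)) /index_iota subn0.
apply: le_trans (@diag_sum (fun i n => svol (s i n)) N _) _.
  by move=> i n; rewrite /svol sumr_ge0 // => c _; rewrite invr_ge0 ltW // ncell_gt0.
apply: le_trans (_ : \sum_(i < N) d * 2 ^- i.+1 <= _).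
  by apply: ler_sum => i _; case: (Hs i).
by rewrite -mulr_sumr ler_piMr ?(ltW d0) // geo_sum.
Qed.

Lemma borel_cantelli (Y : nat -> pt -> Prop) (C x : R) : 0 <= C -> 0 <= x -> x < 1 ->
  (forall n, exists l, content l (Y n) <= C * x ^+ n) ->
  nullY (fun y => forall N, exists2 n, (N <= n)%N & Y n y).
Proof.
move=> C0 x0 x1 H d d0.
have [l Hl] := choice H.
have e0 : 0 < d * (1 - x) / (C + 1) by rewrite !divr_gt0 ?mulr_gt0 ?subr_gt0 // ltr_wpDl.
have [N0 hN0] := geometric_small x0 x1 e0.
exists (fun n => cells (meet (l (N0 + n)%N) (Y (N0 + n)%N))).
  move=> y /(_ N0)[n Nn Yn]; exists (n - N0)%N; rewrite subnKC //.
  by apply: cells_in; apply/meetP; exists y.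
move=> N.
apply: le_trans (_ : \sum_(n < N) C * x ^+ (N0 + n) <= _).
  by apply: ler_sum => n _; rewrite svol_cells; exact: Hl.
have -> : \sum_(n < N) C * x ^+ (N0 + n) = C * x ^+ N0 * \sum_(n < N) x ^+ n.
  by rewrite mulr_sumr; apply: eq_bigr => n _; rewrite exprD mulrA.
have G : \sum_(n < N) x ^+ n <= (1 - x)^-1.
  rewrite -[X in _ <= X]mul1r ler_pdivlMr ?subr_gt0 //.
  have -> : (\sum_(n < N) x ^+ n) * (1 - x) = 1 - x ^+ N.
    elim: N => [|N IH]; first by rewrite big_ord0 mul0r expr0 subrr.
    by rewrite big_ord_recr /= mulrDl IH exprS; ring.
  by rewrite gerBl exprn_ge0.
have xn0 : 0 <= x ^+ N0 by rewrite exprn_ge0.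
have C1 : 0 < C + 1 by rewrite ltr_wpDl.
apply: le_trans (_ : (C + 1) * (d * (1 - x) / (C + 1)) * (1 - x)^-1 <= _); last first.
  rewrite le_eqVlt; apply/orP; left; apply/eqP; field.
  by rewrite subr_eq0 (gt_eqF x1) (gt_eqF C1).
apply: ler_pM => //; first by rewrite mulr_ge0.
  by rewrite sumr_ge0 // => n _; rewrite exprn_ge0.
by apply: ler_pM => //; rewrite lerDl.
Qed.

(** Otherwise f would drop by d again and again and become negative. *)
Lemma nearly_min (f : nat -> R) l0 (d : R) : 0 < d -> (forall l, 0 <= f l) ->
  exists2 l1, (l0 <= l1)%N & forall l, (l1 <= l)%N -> f l1 - d <= f l.
Proof.
move=> d0 f0; apply: contrapT => H.
have step l : (l0 <= l)%N -> exists2 l', (l <= l')%N & f l' < f l - d.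
  move=> ll; apply: contrapT => H'; apply: H; exists l => // l' ll'.
  by rewrite leNgt; apply/negP => h; apply: H'; exists l'.
have it n : exists2 l, (l0 <= l)%N & f l <= f l0 - n%:R * d.
  elim: n => [|n [l ll hl]]; first by exists l0; rewrite // mul0r subr0.
  have [l' ll' h] := step l ll; exists l'; first exact: leq_trans ll'.
  by rewrite -natr1; lra.
have [l _ hl] := it (Num.bound (f l0 / d)).
have := archi_boundP (divr_ge0 (f0 l0) (ltW d0)); rewrite ltr_pdivrMr // => h.
by have := f0 l; lra.
Qed.

Section Continuity.
Variables (Y : nat -> pt -> Prop) (beta d : R).
Hypothesis YU : forall n y, Y n y -> inU y.
Hypothesis Yinc : forall n y, Y n y -> Y n.+1 y.
Hypothesis d0 : 0 < d.
Hypothesis Yc : forall n, exists l0, forall l, (l0 <= l)%N -> content l (Y n) <= beta.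

(** Continuity from below. At stage n only the part [D n] of Y n left uncovered is covered, at a
    level where its content is within [dn n] of the minimum over all finer levels. The part covered
    earlier and [D n] occupy disjoint sets of fine cells, so these contents add up to a lower bound
    for the content of Y n, which is at most beta. *)
Lemma content_cvg : exists2 s : nat -> seq tcell, covers s (fun y => exists n, Y n y) &
  forall N, \sum_(n < N) svol (s n) <= beta + d.
Proof.
pose dn n : R := d * 2 ^- n.+1.
have dn0 n : 0 < dn n by rewrite mulr_gt0 // invr_gt0 exprn_gt0.
have ex (a : nat * nat * (pt -> Prop)) : exists l1, (a.1.2 <= l1)%N /\ forall l, (l1 <= l)%N ->
    content l1 (fun y => Y a.1.1 y /\ ~ a.2 y) - dn a.1.1 <= content l (fun y => Y a.1.1 y /\ ~ a.2 y).
  have [l1 h1 h2] := nearly_min a.1.2 (dn0 a.1.1)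
    (fun l => content_ge0 l (fun y => Y a.1.1 y /\ ~ a.2 y)).
  by exists l1.
have [g Hg] := choice ex.
(* State: the last level used and the region covered so far, a union of cells of level at most that
   one. *)
pose fix st n : nat * (pt -> Prop) :=
  if n is n'.+1 then
    let l := g (n', (st n').1, (st n').2) in
    (l, fun y => (st n').2 y \/ idx l y \in meet l (fun z => Y n' z /\ ~ (st n').2 z))
  else (0%N, fun=> False).
pose D n y := Y n y /\ ~ (st n).2 y.
pose lev n := (st n.+1).1.
have levE n : lev n = g (n, (st n).1, (st n).2) by [].
have WE n : (st n.+1).2 = fun y => (st n).2 y \/ idx (lev n) y \in meet (lev n) (D n) by [].
have levmono n : ((st n).1 <= (st n.+1).1)%N by have [] := Hg (n, (st n).1, (st n).2).
have sat n l y y' : ((st n).1 <= l)%N -> inU y -> inU y' -> idx l y = idx l y' ->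
    (st n).2 y -> (st n).2 y'.
  elim: n => [//|n IH] ll U U' e; rewrite WE => -[h|h].
    by left; apply: IH h => //; exact: leq_trans ll.
  by right; rewrite -(idx_refine U U' ll e).
have inv n l : (lev n <= l)%N -> \sum_(j < n.+1) (content (lev j) (D j) - dn j) <=
    content l (fun y => Y n y /\ (st n.+1).2 y).
  elim: n l => [|n IH] l ll.
    rewrite big_ord1; have [_ h] := Hg (0%N, (st 0%N).1, (st 0%N).2).
    apply: le_trans (h l ll) _; apply: content_le => y [Yy nW]; split => //.
    by right; apply/meetP; exists y.
  rewrite big_ord_recr /=.
  have [_ h] := Hg (n.+1, (st n.+1).1, (st n.+1).2).
  have l' : (lev n <= l)%N by apply: leq_trans ll; exact: levmono.
  apply: le_trans (lerD (IH l l') (h l ll)) _ => /=.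
  rewrite -mulrDl -natrD; apply: ler_wpM2r; first by rewrite invr_ge0 ltW // ncell_gt0.
  rewrite ler_nat.
  (* By [sat], a fine cell that meets both parts would lie in the covered region. *)
  rewrite -cardsUI (_ : _ :&: _ = finset.set0) ?cards0 ?addn0; last first.
    apply/finset.setP => c; rewrite finset.in_setI finset.in_set0; apply/negP => /andP[/meetP[y [Yy Wy] e] /meetP[y' [Yy' nW] e']].
    apply: nW; apply: (@sat n.+1 l y y') => //; [exact: YU Yy | exact: YU Yy' | by rewrite e e'].
  apply/subset_leq_card/fintype.subsetP => c; rewrite inE => /orP[] /meetP[y [Yy Wy] e]; apply/meetP; exists y => //.
    by split; [exact: Yinc | left].
  by split => //; right; apply/meetP; exists y.
exists (fun n => cells (meet (lev n) (D n))).
  move=> y [n Yn].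
  have [W|nW] := pselect ((st n).2 y).
    have {W} [j _ h] : exists2 j, (j < n)%N & idx (lev j) y \in meet (lev j) (D j).
      elim: (n) W => [//|m IH]; rewrite WE => -[/IH[j jm h]|h]; first by exists j => //; exact: ltnW.
      by exists m.
    by exists j; apply: cells_in.
  by exists n; apply: cells_in; apply/meetP; exists y.
have b0 : 0 <= beta.
  by have [l0 h] := Yc 0%N; apply: le_trans (h l0 (leqnn _)); exact: content_ge0.
case=> [|N]; first by rewrite big_ord0 addr_ge0 // ltW.
have [l0 h] := Yc N.
have := inv N (maxn (lev N) l0) (leq_maxl _ _).
have c2 : content (maxn (lev N) l0) (fun y => Y N y /\ (st N.+1).2 y) <= beta.
  apply: le_trans (h _ (leq_maxr (lev N) l0)); apply: content_le => y [].  by [].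
move=> /le_trans /(_ c2); rewrite big_split /= sumrN => h2.
have h3 : \sum_(i < N.+1) dn i <= d by rewrite /dn -mulr_sumr ler_piMr ?(ltW d0) // geo_sum.
have -> : \sum_(n < N.+1) svol (cells (meet (lev n) (D n))) = \sum_(i < N.+1) content (lev i) (D i).
  by apply: eq_bigr => i _; rewrite svol_cells.
lra.
Qed.

End Continuity.
End Content.

(** * Bootstrapping the exponents *)

Section Steps.
Variables (R : realType) (kk : nat).
Variables (p : 'I_kk.+1 -> R) (t : 'I_kk.+1 -> R[i]) (chi : 'I_kk.+1 -> R).
Variables (Chi H eps : R).
Hypothesis p_gt0 : forall i, 0 < p i.
Hypothesis p_sum : \sum_(i < kk.+1) p i = 1.
Hypothesis Chi0 : 0 <= Chi.
Hypothesis eps0 : 0 < eps.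
Variables (rho tau : R) (S : nat).
Hypotheses (rho0 : 0 <= rho) (rho1 : rho < 1) (tau1 : 1 <= tau).
Hypothesis t_le : forall i, nm (t i) <= tau.
Hypothesis S1 : (1 <= S)%N.
Variables (b : R) (a0 : R[i]) (ac : 'I_kk -> R[i]).
Hypotheses (b0 : 0 < b) (b4 : b <= 1 / 4).
Hypothesis UB : forall y, inU y -> inB chi eps rho (lamY b a0 ac y).
Local Notation lam := (lamY b a0 ac).
Local Notation PsiF := (PsiF p t chi Chi H eps).
Local Notation PhiF := (PhiF p t chi Chi H eps).
Local Notation claim := (claim p t chi Chi H eps).
Local Notation claimPhi := (claimPhi p t chi Chi H eps).
Local Notation pt := (pt R kk).

Let tau0 : 0 <= tau := le_trans ler01 tau1.

(** The constant C may depend on the parameter y, while A and d may not. *)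
Definition hasclaim s d A (y : pt) : Prop := exists C, claim (lam y) s d A C.
Definition aeClaim s d A : Prop := nullY (fun y => inU y /\ ~ hasclaim s d A y).
Definition avgc (X : pt -> Prop) s d A : Prop := exists2 C, 0 <= C & forall L n K, (n <= L)%N -> 0 <= K ->
  AvgLe X (fun y => PsiF (lam y) s L K (expR (K - Chi * n%:R)))
    (C * expR (A * (K + eps * n%:R) - d * Chi * n%:R)).

Lemma claim_weaken (l : 'I_kk.+1 -> R[i]) s d A C s' d' A' C' : claim l s d A C ->
  (s <= s')%N -> d' <= d -> A <= A' -> C <= C' -> 0 <= C' -> claim l s' d' A' C'.
Proof.
move=> cl ss dd AA CC C0 n K K0.
apply: le_trans (PsiF_mono t chi Chi H eps p_gt0 l n (lexx K) (lexx _) ss) _.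
apply: (le_trans (cl n K K0)); apply: (le_trans (ler_wpM2r (expR_ge0 _) CC)).
rewrite ler_wpM2l // ler_expR lerD //.
  by rewrite ler_wpM2r // addr_ge0 // mulr_ge0 // ltW.
by rewrite lerN2 ler_wpM2r // ler_wpM2r.
Qed.

Lemma claimPhi_weaken (l : 'I_kk.+1 -> R[i]) s d A C A' C' : claimPhi l s d A C ->
  A <= A' -> C <= C' -> 0 <= C' -> claimPhi l s d A' C'.
Proof.
move=> cl AA CC C0 n K K0.
apply: (le_trans (cl n K K0)); apply: (le_trans (ler_wpM2r (expR_ge0 _) CC)).
rewrite ler_wpM2l // ler_expR lerD2r ler_wpM2r // addr_ge0 // mulr_ge0 // ltW //.
Qed.

Lemma hasclaim_weaken s d A s' d' A' y : (s <= s')%N -> d' <= d -> A <= A' ->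
  hasclaim s d A y -> hasclaim s' d' A' y.
Proof.
move=> ss dd AA [C cl]; exists (Num.max C 0).
by apply: claim_weaken cl _ _ _ _ _ => //; rewrite le_max lexx ?orbT.
Qed.

Lemma aeClaim_weaken s d A s' d' A' : (s <= s')%N -> d' <= d -> A <= A' ->
  aeClaim s d A -> aeClaim s' d' A'.
Proof.
move=> ss dd AA; apply: nullY_sub => y [U n]; split => // h; apply: n.
exact: hasclaim_weaken h.
Qed.

Lemma aeClaim_all s d A : (forall y, inU y -> hasclaim s d A y) -> aeClaim s d A.
Proof.
move=> h d' d0; exists (fun=> [::]).
  by move=> y [U n]; case: n; exact: h.
by move=> N; rewrite big1 ?ltW // => i _; rewrite /svol big_nil.
Qed.

Lemma aeClaim0 s : aeClaim s 0 0.
Proof.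
apply: aeClaim_all => y _; exists 1 => n K K0.
by rewrite !mul0r subr0 expR0 mulr1 PsiF_le1.
Qed.

Lemma sum_expN N : \sum_(i < N) expR (- (i%:R : R)) <= 2.
Proof.
have e2 : expR (-1 : R) <= 1 / 2.
  rewrite expRN div1r lef_pV2 ?posrE ?expR_gt0 //.
  by apply: le_trans (expR_ge1Dx _); lra.
have Ei (i : nat) : expR (- (i%:R : R)) <= (1 / 2) ^+ i.
  elim: i => [|i IH]; first by rewrite oppr0 expR0 expr0.
  rewrite -natr1 opprD expRD exprSr; apply: ler_pM; rewrite ?expR_ge0 //.
apply: le_trans (_ : \sum_(i < N) (1 / 2) ^+ i <= _); first by apply: ler_sum => i _; exact: Ei.
suff -> : \sum_(i < N) (1 / 2 : R) ^+ i = 2 - 2 * (1 / 2) ^+ N.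
  by rewrite gerBl mulr_ge0 // exprn_ge0 //; lra.
elim: N => [|N IH]; first by rewrite big_ord0 expr0 mulr1 subrr.
by rewrite big_ord_recr /= IH exprS; lra.
Qed.

(** Raising A by one buys a factor exp (- eps n) for Borel-Cantelli and exp (- K) for the sum over
    K. Integers K up to n times a bound for Chi suffice: beyond that, d <= A + 1 makes the claimed
    bound at least 1. *)
Lemma markov_bc (X : pt -> Prop) s d A : 0 <= A -> 0 <= d -> d <= A + 1 ->
  avgc X s d A -> nullY (fun y => X y /\ ~ hasclaim s d (A + 1) y).
Proof.
move=> A0 d0 dA [C C0 av].
pose Z := Num.bound Chi.
have ZC : Chi <= Z%:R by apply/ltW/archi_boundP.
pose w n K := expR (- ((A + 1) * (K + eps * n%:R) - d * Chi * n%:R)).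
pose Psi n (K : nat) y := PsiF (lam y) s n K%:R (expR (K%:R - Chi * n%:R)).
pose Th n y := \sum_(K < (n * Z).+1) w n K%:R * Psi n K y.
pose Bad n y := X y /\ 1 < Th n y.
have x0 : 0 <= expR (- eps) by rewrite expR_ge0.
have x1 : expR (- eps) < 1 by rewrite -expR0 ltr_expR oppr_lt0.
have C20 : 0 <= 2 * C by rewrite mulr_ge0.
have bc : nullY (fun y => forall N, exists2 n, (N <= n)%N & Bad n y).
  apply: (borel_cantelli C20 x0 x1) => n.
  have avT : AvgLe X (Th n) (2 * C * expR (- eps) ^+ n).
    have := @AvgLe_sum _ _ X (n * Z).+1 (fun K y => w n K%:R * Psi n K y)
      (fun K => w n K%:R * (C * expR (A * (K%:R + eps * n%:R) - d * Chi * n%:R))).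
    move=> /(_ (fun K _ => AvgLe_scale (expR_ge0 _) (av n n K%:R (leqnn n) (ler0n _ _)))) avS.
    apply: AvgLe_le avS; first by [].
    have -> : expR (- eps) ^+ n = expR (- (eps * n%:R)) by rewrite -expRM_natr mulNr.
    apply: le_trans (_ : \sum_(K < (n * Z).+1) C * expR (- (eps * n%:R)) * expR (- K%:R) <= _).
      apply: ler_sum => K _; rewrite /w [_ * (C * _)]mulrCA -[X in _ <= X]mulrA; apply: ler_wpM2l => //.
      rewrite -!expRD ler_expR; lra.
    rewrite -mulr_sumr mulrC -[2 * C * _]mulrA; apply: ler_wpM2r; last exact: sum_expN.
    by rewrite mulr_ge0 ?expR_ge0.
  have [l0 hl] := markov avT ltr01 (Y := Bad n) (fun y h => h).
  by exists l0; have := hl l0 (leqnn _); rewrite divr1.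
apply: nullY_sub bc => y [Xy nc] N; apply: contrapT => nB; apply: nc.
have good n : (N <= n)%N -> Th n y <= 1.
  by move=> Nn; rewrite leNgt; apply/negP => h; apply: nB; exists n.
(* The first factor pays for rounding K up to an integer, the second for the finitely many n < N. *)
exists (expR (A + 1) * expR (d * Chi * N%:R)) => n K K0.
have en : 0 <= eps * n%:R by rewrite mulr_ge0 // ltW.
have A1 : 0 <= A + 1 by lra.
have B1 : 0 <= d * Chi by rewrite mulr_ge0.
rewrite -!expRD.
have dN0 : 0 <= d * Chi * N%:R by rewrite mulr_ge0.
have pr : 0 <= (A + 1) * (K + eps * n%:R) by rewrite mulr_ge0 // addr_ge0.
case: (ltnP n N) => [nN|Nn].
  apply: le_trans (PsiF_le1 _ _ _ _ _ p_gt0 p_sum _ _ _ _ _) _.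
  rewrite -[X in X <= _]expR0 ler_expR.
  have : d * Chi * n%:R <= d * Chi * N%:R by rewrite ler_wpM2l // ler_nat ltnW.
  lra.
have /andP[t1 t2] := truncn_itv K0; set Kc := (Num.truncn K).+1 in t2.
have KK : Kc%:R <= K + 1 by rewrite /Kc -natr1 lerD2r.
apply: le_trans (_ : Psi n Kc y <= _).
  by apply: PsiF_mono => //; rewrite ?ler_expR ?lerD2r ltW.
case: (leqP Kc (n * Z)) => Kn.
  have : w n Kc%:R * Psi n Kc y <= 1.
    apply: le_trans (good n Nn); rewrite /Th (bigD1 (Ordinal (Kn : (Kc < (n * Z).+1)%N))) //= lerDl.
    by rewrite sumr_ge0 // => j _; rewrite mulr_ge0 ?expR_ge0 ?PsiF_ge0.
  rewrite /w expRN -ler_pdivlMl ?invr_gt0 ?expR_gt0 // invrK mulr1 => /le_trans; apply.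
  rewrite ler_expR.
  have : (A + 1) * Kc%:R <= (A + 1) * (K + 1) by rewrite ler_wpM2l.
  lra.
apply: le_trans (PsiF_le1 _ _ _ _ _ p_gt0 p_sum _ _ _ _ _) _.
rewrite -[X in X <= _]expR0 ler_expR.
have h1 : Chi * n%:R <= Kc%:R.
  apply: le_trans (_ : (n * Z)%N%:R <= _); last by rewrite ler_nat ltnW.
  by rewrite natrM mulrC ler_wpM2l.
have h2 : d * (Chi * n%:R) <= (A + 1) * Kc%:R by apply: ler_pM => //; rewrite mulr_ge0.
have h3 : (A + 1) * Kc%:R <= (A + 1) * (K + 1) by rewrite ler_wpM2l.
have h4 : 0 <= (A + 1) * (eps * n%:R) by rewrite mulr_ge0.
lra.
Qed.

Lemma half_bounds (n : nat) : (n%:R : R) <= 2 * (n./2)%:R + 1 /\ 2 * (n./2)%:R <= n%:R :> R.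
Proof.
have hn : (n%:R : R) = (odd n)%:R + ((n./2)%:R + (n./2)%:R) by rewrite -[in LHS](odd_double_half n) -addnn !natrD.
have [bit1 bit0] : ((odd n)%:R : R) <= 1 /\ 0 <= ((odd n)%:R : R) by case: odd.
by split; lra.
Qed.

Lemma half_le n : (n./2 <= n)%N.
Proof. by rewrite -[X in (_ <= X)%N]odd_double_half -addnn addnA leq_addl. Qed.

(** Equal to 7 (3 A + 2) + 3 + 1: the losses of [claim_phi], of the averaged case analysis and of
    [markov_bc]. *)
Definition nextA A : R := 21 * A + 18.

Section OneStep.
Variable Cp : R.
Hypothesis Cp1 : 1 <= Cp.
Hypothesis HCp : forall n : nat, (n.+1%:R : R) ^+ S <= Cp * expR (eps * n%:R).

(** The number n / 2 of cases B is absorbed in exp (eps n), at the price of one unit of A. *)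
Lemma sum_terms (X : pt -> Prop) s d A (CA CB : R) : (s.+1 <= S)%N -> 0 <= CA -> 0 <= CB ->
  (forall y, X y -> inU y) ->
  (forall L n K, (n <= L)%N -> 0 <= K -> forall y, X y ->
    caseA p t chi Chi H eps rho tau S b a0 ac s L K n y <= CA * expR (A * (K + eps * n%:R) - d * Chi * n%:R)) ->
  (forall L n K i, (n <= L)%N -> 0 <= K -> (i.*2 <= n)%N ->
    AvgLe X (caseB p t chi Chi H eps rho tau S b a0 ac s L K n i) (CB * expR (A * (K + eps * n%:R) - d * Chi * n%:R))) ->
  avgc X s.+1 d (A + 1).
Proof.
move=> sS CA0 CB0 XU HA HB; exists (CA + Cp * CB).
  by rewrite addr_ge0 // mulr_ge0 // (le_trans _ Cp1).
move=> L n K nL K0; set e := expR (A * (K + eps * n%:R) - d * Chi * n%:R) in HA HB *.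
have e0 : 0 <= e by rewrite expR_ge0.
have i2n (i : nat) : (i < n./2)%N -> (i.*2 <= n)%N.
  move=> hi; rewrite -[n in (_ <= n)%N]odd_double_half.
  by apply: leq_trans (leq_addl _ _); rewrite leq_double ltnW.
have S2 := AvgLe_sum (fun i hi => HB L n K i nL K0 (i2n i hi)).
have S1' : AvgLe X (caseA p t chi Chi H eps rho tau S b a0 ac s L K n) (CA * e).
  by apply: AvgLe_cst; [rewrite mulr_ge0 | exact: HA].
apply: AvgLe_le (AvgLe_add S1' S2).
  move=> y Xy.
  exact: (Psi_cases Chi H p_gt0 rho0 rho1 tau1 t_le (fun y Xy => UB (XU y Xy)) L K n Xy sS).
rewrite sumr_const card_ord -[_ *+ _]mulr_natl.
have hp := HCp_le HCp n S1; rewrite expr1 in hp.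
have n2 : ((n./2)%:R : R) <= Cp * expR (eps * n%:R).
  apply: le_trans hp; rewrite ler_nat; apply: leqW.
  by rewrite -[X in (_ <= X)%N]odd_double_half -addnn addnA leq_addl.
have -> : (A + 1) * (K + eps * n%:R) - d * Chi * n%:R =
  K + eps * n%:R + (A * (K + eps * n%:R) - d * Chi * n%:R) by ring.
rewrite (expRD (K + _)) -/e (expRD K).
have eK : 1 <= expR K by rewrite -expR0 ler_expR.
have en : 1 <= expR (eps * n%:R) by rewrite -[X in X <= _]expR0 ler_expR mulr_ge0 // ltW.
have eKn : 1 <= expR K * expR (eps * n%:R) by apply: mulr_ege1.
rewrite mulrDl; apply: lerD.
  by apply: ler_wpM2l => //; rewrite ler_peMl.
move: n2; move: (expR K) (expR (eps * n%:R)) ((n./2)%:R) eK en => x z w eK en n2.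
have -> : Cp * CB * (x * z * e) = (Cp * z) * (CB * e) * x by ring.
apply: le_trans (ler_wpM2r (mulr_ge0 CB0 e0) n2) _.
have h0 : 0 <= Cp * z * (CB * e) by rewrite !mulr_ge0 // ?(le_trans _ Cp1) // (le_trans _ en).
by rewrite ler_peMr.
Qed.

(** The exponent 2 n - (4 - d1 - d0) i of case B is linear in i; its values at i = 0 and i = n / 2
    are the bounds 2 and (d1 + d0) / 2, the latter being also the exponent of case A. *)
Lemma step1_avg (X : pt -> Prop) s d d0 d1 A C : (s.+1 <= S)%N -> 0 <= A -> 0 <= C ->
  0 <= d0 -> 0 <= d1 -> d <= 2 -> d <= (d1 + d0) / 2 ->
  (forall y, X y -> inU y) ->
  (forall y, X y -> claim (lam y) s.+2 d1 A C) ->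
  (forall y, X y -> claimPhi (lam y) s.+1 d0 A C) ->
  avgc X s.+1 d (7 * A + 3).
Proof.
move=> sS A0 C0 d00 d10 d2 dd XU H1 H0.
have XB y (Xy : X y) : inB chi eps rho (lam y) := UB (XU y Xy).
have eps0' := ltW eps0.
have [CA CA0 HA] := caseA_le p_gt0 p_sum Chi0 eps0' rho0 rho1 tau1 t_le Cp1 HCp XB A0 C0 sS H1 H0.
have [CB CB0 HB] := caseB_le p_gt0 p_sum Chi0 eps0' rho0 rho1 tau1 t_le Cp1 HCp b0 b4 XU XB A0 C0 sS H1 H0.
have -> : 7 * A + 3 = (7 * A + 2) + 1 by ring.
apply: (@sum_terms X s d (7 * A + 2) (CA * expR (d1 * Chi)) CB) => //.
- by rewrite mulr_ge0 ?expR_ge0.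
- move=> L n K nL K0 y Xy; apply: le_trans (HA L n K nL K0 y Xy) _.
  rewrite -[X in _ <= X]mulrA; apply: ler_wpM2l => //; rewrite -expRD ler_expR.
  have en : 0 <= eps * n%:R by rewrite mulr_ge0.
  have n2n := half_le n.
  rewrite natrB //; set x := (n./2)%:R.
  have [x1 x2] := half_bounds n; rewrite -/x in x1 x2.
  have : d * (Chi * n%:R) <= (d1 + d0) / 2 * (Chi * n%:R) by apply: ler_wpM2r => //; apply: mulr_ge0.
  have : 0 <= d1 * Chi * (2 * x + 1 - n%:R) by rewrite !mulr_ge0 // subr_ge0.
  have : 0 <= d0 * Chi * (n%:R - 2 * x) by rewrite !mulr_ge0 // subr_ge0.
  have : 0 <= d1 * Chi by rewrite mulr_ge0.
  lra.
move=> L n K i nL K0 i2n; apply: AvgLe_le (HB L n K i nL K0 i2n) => //.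
rewrite ler_wpM2l // ler_expR.
have [i1 i0] : 2 * i%:R <= n%:R :> R /\ 0 <= i%:R :> R by rewrite -natrM mul2n ler_nat.
have g1 : 0 <= A * (eps * (n%:R - 2 * i%:R)) by rewrite !mulr_ge0 // subr_ge0.
have en : 0 <= eps * n%:R by rewrite mulr_ge0.
set x := Chi * i%:R; set z := Chi * n%:R.
have x0 : 0 <= x by rewrite mulr_ge0.
have xz : 2 * x <= z by rewrite /x /z mulrCA ler_wpM2l.
have key : d * z <= 2 * z - (4 - d1 - d0) * x.
  have : 0 <= (2 - d) * (z - 2 * x) by rewrite mulr_ge0 // subr_ge0.
  have : 0 <= ((d1 + d0) / 2 - d) * (2 * x) by rewrite mulr_ge0 ?subr_ge0 // mulr_ge0.
  lra.
rewrite -!(mulrA _ Chi) -/x -/z; lra.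
Qed.

(** For i <= n / 3 the exponent of [caseI_le] interpolates between 1 + (d0 + dy) / 2 at i = 0 and (2
    + 2 d0 + dy) / 3 at n / 3. For larger i that of [caseB_le] interpolates between (2 + d1 + d0) /
    3 and (d1 + d0) / 2. The value 2 at i = 0 no longer occurs. *)
Lemma step2_avg (X : pt -> Prop) s d d0 d1 dy A C : (s.+2 <= S)%N -> 0 <= A -> 0 <= C ->
  0 <= d0 -> 0 <= d1 -> 0 <= dy ->
  d <= 1 + (d0 + dy) / 2 -> d <= (2 + 2 * d0 + dy) / 3 -> d <= (2 + d1 + d0) / 3 -> d <= (d1 + d0) / 2 ->
  (forall y, X y -> inU y) ->
  (forall y, X y -> claim (lam y) s.+3 d1 A C) ->
  (forall y, X y -> claim (lam y) s.+2 d0 A C) ->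
  (forall y, X y -> claimPhi (lam y) s.+2 d0 A C) ->
  (forall y, X y -> claimPhi (lam y) s.+1 dy A C) ->
  avgc X s.+2 d (7 * A + 3).
Proof.
move=> sS A0 C0 d00 d10 dy0 e1 e2 e3 e4 XU H1 H0 H0P HyP.
have XB y (Xy : X y) : inB chi eps rho (lam y) := UB (XU y Xy).
have eps0' := ltW eps0.
have [CA CA0 HA] := caseA_le p_gt0 p_sum Chi0 eps0' rho0 rho1 tau1 t_le Cp1 HCp XB A0 C0 sS H1 H0P.
have [CB CB0 HB] := caseB_le p_gt0 p_sum Chi0 eps0' rho0 rho1 tau1 t_le Cp1 HCp b0 b4 XU XB A0 C0 sS H1 H0P.
have [CI CI0 HI] := caseI_le p_gt0 p_sum Chi0 eps0' rho0 rho1 tau1 t_le Cp1 HCp b0 b4 XU XB A0 C0 sS H0 HyP.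
have -> : 7 * A + 3 = (7 * A + 2) + 1 by ring.
have D1 : 0 <= CI * expR ((2 + d0 + dy) * Chi) by rewrite mulr_ge0 ?expR_ge0.
apply: (@sum_terms X s.+1 d (7 * A + 2) (CA * expR (d1 * Chi)) (CB + CI * expR ((2 + d0 + dy) * Chi))) => //.
- by rewrite mulr_ge0 ?expR_ge0.
- by rewrite addr_ge0.
- move=> L n K nL K0 y Xy; apply: le_trans (HA L n K nL K0 y Xy) _.
  rewrite -[X in _ <= X]mulrA; apply: ler_wpM2l => //; rewrite -expRD ler_expR.
  have en : 0 <= eps * n%:R by rewrite mulr_ge0.
  have n2n := half_le n.
  rewrite natrB //; set x := (n./2)%:R.
  have [x1 x2] := half_bounds n; rewrite -/x in x1 x2.
  have : d * (Chi * n%:R) <= (d1 + d0) / 2 * (Chi * n%:R) by apply: ler_wpM2r => //; apply: mulr_ge0.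
  have : 0 <= d1 * Chi * (2 * x + 1 - n%:R) by rewrite !mulr_ge0 // subr_ge0.
  have : 0 <= d0 * Chi * (n%:R - 2 * x) by rewrite !mulr_ge0 // subr_ge0.
  have : 0 <= d1 * Chi by rewrite mulr_ge0.
  lra.
move=> L n K i nL K0 i2n.
have en : 0 <= eps * n%:R by rewrite mulr_ge0.
have [i1 i0] : 2 * i%:R <= n%:R :> R /\ 0 <= i%:R :> R by rewrite -natrM mul2n ler_nat.
set E := expR (_ - _); have E0 : 0 <= E by rewrite expR_ge0.
case: (leqP (3 * i) n) => i3.
  apply: AvgLe_le (HI L n K i nL K0 i3) => //.
  apply: le_trans (_ : CI * expR ((2 + d0 + dy) * Chi) * E <= _); last by apply: ler_wpM2r => //; rewrite lerDr.
  rewrite -[X in _ <= X]mulrA; apply: ler_wpM2l => //; rewrite -expRD ler_expR.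
  have ni : (i <= n)%N by rewrite (leq_trans _ i3) // leq_pmull.
  have qn : ((n - i)./2 <= n)%N := leq_trans (half_le _) (leq_subr i n).
  rewrite natrB //; set q := ((n - i)./2)%:R.
  have [q1 q2] := half_bounds (n - i); rewrite natrB // -/q in q1 q2.
  have i3' : 3 * i%:R <= n%:R :> R by rewrite -natrM ler_nat.
  have q2' : 0 <= n%:R - i%:R - 2 * q by rewrite subr_ge0.
  have q1' : 0 <= 2 * q + 1 - (n%:R - i%:R) by rewrite subr_ge0.
  have i3s : 0 <= n%:R - 3 * i%:R :> R by rewrite subr_ge0.
  have k1 : 0 <= Chi * (d0 / 2) * (n%:R - i%:R - 2 * q).
    by apply: mulr_ge0 => //; apply: mulr_ge0 => //; apply: divr_ge0.
  have k2 : 0 <= Chi * (n%:R - i%:R - 2 * q) by apply: mulr_ge0.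
  have k3 : 0 <= Chi * dy * (2 * q + 1 - (n%:R - i%:R)).
    by apply: mulr_ge0 => //; apply: mulr_ge0.
  have k4 : 0 <= (1 + (d0 + dy) / 2 - d) * (Chi * (n%:R - 3 * i%:R)).
    by apply: mulr_ge0; rewrite ?subr_ge0 //; apply: mulr_ge0.
  have k5 : 0 <= ((2 + 2 * d0 + dy) / 3 - d) * (Chi * (3 * i%:R)).
    by apply: mulr_ge0; rewrite ?subr_ge0 //; apply: mulr_ge0 => //; apply: mulr_ge0.
  have k6 : 0 <= d0 * Chi by rewrite mulr_ge0.
  have k7 : 0 <= dy * Chi by rewrite mulr_ge0.
  move: k1 k2 k3 k4 k5 k6 k7; have := Chi0; lra.
apply: AvgLe_le (HB L n K i nL K0 i2n) => //.
apply: le_trans (_ : CB * E <= _); last by apply: ler_wpM2r => //; rewrite lerDl.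
rewrite ler_wpM2l // ler_expR.
have g1 : 0 <= A * (eps * (n%:R - 2 * i%:R)) by rewrite !mulr_ge0 // subr_ge0.
have i3' : n%:R <= 3 * i%:R :> R by rewrite -natrM ler_nat ltnW.
set x := Chi * i%:R; set z := Chi * n%:R.
have xz : 2 * x <= z by rewrite /x /z mulrCA ler_wpM2l.
have zx : z <= 3 * x by rewrite /x /z [X in _ <= X]mulrCA ler_wpM2l.
have k1 : 0 <= ((2 + d1 + d0) / 3 - d) * (z - 2 * x) by rewrite mulr_ge0 // subr_ge0.
have k2 : 0 <= ((d1 + d0) / 2 - d) * (3 * x - z) by rewrite mulr_ge0 // subr_ge0.
rewrite -!(mulrA _ Chi) -/x -/z; lra.
Qed.

End OneStep.

Lemma claims_phi s d A C : (s <= S.+1)%N ->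
  0 <= d -> d * Chi <= H -> 0 <= A -> 0 <= C ->
  exists2 C', C <= C' & forall y, inU y -> claim (lam y) s d A C -> claimPhi (lam y) s d (3 * A + 2) C'.
Proof.
move=> sS d0 dH A0 C0.
have [Cp Cp1 HCp] := poly_le_expR S eps0.
have Cp0 : 0 <= Cp by rewrite (le_trans _ Cp1).
set C' := Cp * (C * expR (A * ln (C2 S Cp)) + 1).
exists (Num.max C C'); first by rewrite le_max lexx.
move=> y U cl.
have h : claimPhi (lam y) s d (3 * A + 2) C' := claim_phi p_gt0 p_sum (ltW eps0) S1 Cp1 HCp (UB U) sS d0 dH A0 C0 cl.
by apply: claimPhi_weaken h _ _ _ => //; rewrite le_max ?lexx ?orbT // C0.
Qed.

(** Integer constants turn almost-everywhere claims into a countable union of sets with uniform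
    constants, over which averages can be taken. *)
Lemma hasclaim_nat s d A y : 0 <= A -> hasclaim s d A y ->
  exists M : nat, forall M', (M <= M')%N -> claim (lam y) s d A M'%:R.
Proof.
move=> A0 [C cl]; exists (Num.bound `|C|) => M tailC.
apply: claim_weaken cl _ _ _ _ _ => //.
apply: le_trans (_ : (Num.bound `|C|)%:R <= _); last by rewrite ler_nat.
by apply/(le_trans (ler_norm _))/ltW/archi_boundP.
Qed.

Lemma nullY_U (Y Y' : pt -> Prop) : nullY Y -> nullY Y' -> nullY (fun y => Y y \/ Y' y).
Proof.
move=> n1 n2; apply: nullY_sub (@nullY_bigcup R kk (fun i => if i is 0%N then Y else Y') _).
  by move=> y [?|?]; [exists 0%N | exists 1%N].
by case.
Qed.

(* Transversality for the jet s turns exponents d1 (for s.+2 jets) and d0 (for s.+1 jets) into their mean. *)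
Lemma step1 s d d0 d1 A : (s.+1 <= S)%N -> 0 <= A -> 0 <= d -> 0 <= d0 -> 0 <= d1 ->
  d <= 2 -> d <= (d1 + d0) / 2 -> d0 * Chi <= H ->
  aeClaim s.+2 d1 A -> aeClaim s.+1 d0 A -> aeClaim s.+1 d (nextA A).
Proof.
move=> sS A0 d_0 d00 d10 d2 dd dH H1 H0.
have A3 : 0 <= 3 * A + 2 by lra.
have AA : A <= 3 * A + 2 by lra.
pose X (M : nat) y := [/\ inU y, claim (lam y) s.+2 d1 A M%:R & claim (lam y) s.+1 d0 A M%:R].
have nX M : nullY (fun y => X M y /\ ~ hasclaim s.+1 d (nextA A) y).
  have [C CM HC] := claims_phi (leqW sS) d00 dH A0 (ler0n R M).
  have C0 : 0 <= C := le_trans (ler0n R M) CM.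
  have [Cp Cp1 HCp] := poly_le_expR S eps0.
  have av : avgc (X M) s.+1 d (7 * (3 * A + 2) + 3).
    apply: (step1_avg Cp1 HCp sS A3 C0 d00 d10 d2 dd) => y [U c1 c0] //.
      exact: claim_weaken c1 _ _ _ _ _.
    exact: HC.
  have -> : nextA A = 7 * (3 * A + 2) + 3 + 1 by rewrite /nextA; ring.
  by apply: markov_bc av; lra.
apply: nullY_sub (nullY_U (nullY_U H1 H0) (nullY_bigcup nX)) => y [U nh].
apply: contrapT => n.
have h1 : hasclaim s.+2 d1 A y by apply: contrapT => nn; apply: n; left; left.
have h0 : hasclaim s.+1 d0 A y by apply: contrapT => nn; apply: n; left; right.
have [M1 c1] := hasclaim_nat A0 h1; have [M0 c0] := hasclaim_nat A0 h0.
apply: n; right; exists (maxn M1 M0); split => //; split => //.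
  by apply: c1; rewrite leq_maxl.
by apply: c0; rewrite leq_maxr.
Qed.

(* For small i, moving z at the finer scale (n - i) / 2 uses one jet fewer, with exponent dy; this is
   what lets the exponent exceed 2. *)
Lemma step2 s d d0 d1 dy A : (s.+2 <= S)%N -> 0 <= A -> 0 <= d -> 0 <= d0 -> 0 <= d1 -> 0 <= dy ->
  d <= 1 + (d0 + dy) / 2 -> d <= (2 + 2 * d0 + dy) / 3 -> d <= (2 + d1 + d0) / 3 -> d <= (d1 + d0) / 2 ->
  d <= 4 -> d0 * Chi <= H -> dy * Chi <= H ->
  aeClaim s.+3 d1 A -> aeClaim s.+2 d0 A -> aeClaim s.+1 dy A -> aeClaim s.+2 d (nextA A).
Proof.
move=> sS A0 d_0 d00 d10 dy0 e1 e2 e3 e4 d4 dH dyH H1 H0 Hy.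
have A3 : 0 <= 3 * A + 2 by lra.
have AA : A <= 3 * A + 2 by lra.
pose X (M : nat) y := [/\ inU y, claim (lam y) s.+3 d1 A M%:R, claim (lam y) s.+2 d0 A M%:R
  & claim (lam y) s.+1 dy A M%:R].
have nX M : nullY (fun y => X M y /\ ~ hasclaim s.+2 d (nextA A) y).
  have [C CM HC] := claims_phi (leqW sS) d00 dH A0 (ler0n R M).
  have C0 : 0 <= C := le_trans (ler0n R M) CM.
  have [C' CM' HC'] := claims_phi (leqW (ltnW sS)) dy0 dyH A0 C0.
  have C0' : 0 <= C' := le_trans C0 CM'.
  have MC' := le_trans CM CM'.
  have [Cp Cp1 HCp] := poly_le_expR S eps0.
  have av : avgc (X M) s.+2 d (7 * (3 * A + 2) + 3).
    apply: (step2_avg Cp1 HCp sS A3 C0' d00 d10 dy0 e1 e2 e3 e4) => y [U c1 c0 cy] //.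
    - exact: claim_weaken c1 _ _ _ _ _.
    - exact: claim_weaken c0 _ _ _ _ _.
    - by apply: claimPhi_weaken (HC y U c0) _ _ _.
    - by apply: HC' => //; apply: claim_weaken cy _ _ _ _ _.
  have -> : nextA A = 7 * (3 * A + 2) + 3 + 1 by rewrite /nextA; ring.
  by apply: markov_bc av; lra.
apply: nullY_sub (nullY_U (nullY_U H1 H0) (nullY_U Hy (nullY_bigcup nX))) => y [U nh].
apply: contrapT => n.
have h1 : hasclaim s.+3 d1 A y by apply: contrapT => nn; apply: n; left; left.
have h0 : hasclaim s.+2 d0 A y by apply: contrapT => nn; apply: n; left; right.
have hy : hasclaim s.+1 dy A y by apply: contrapT => nn; apply: n; right; left.
have [M1 c1] := hasclaim_nat A0 h1; have [M0 c0] := hasclaim_nat A0 h0.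
have [My cy] := hasclaim_nat A0 hy.
apply: n; right; right; exists (maxn M1 (maxn M0 My)); split => //; split => //.
- by apply: c1; rewrite leq_maxl.
- by apply: c0; rewrite (leq_trans _ (leq_maxr _ _)) // leq_maxl.
- by apply: cy; rewrite (leq_trans _ (leq_maxr _ _)) // leq_maxr.
Qed.

End Steps.

(** * Arithmetic of the exponents *)

Section Schedule.
Variables (R : realType) (N : nat) (Chi H : R).
Hypotheses (N3 : (3 <= N)%N) (Chi0 : 0 <= Chi) (ChiH : 2 * Chi < H).

(** The available steps in abstract form. The almost-everywhere claims depend on eps; quantifying
    over P fixes the derivation, and with it A, before eps is chosen. *)
Definition bootstraps (P : nat -> R -> R -> Prop) : Prop :=
  [/\ forall s d A s' d' A', (s <= s')%N -> d' <= d -> A <= A' -> P s d A -> P s' d' A',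
      forall s, P s 0 0,
      P N 4 4,
      forall s d d0 d1 A, (s.+1 <= N)%N -> 0 <= A -> 0 <= d -> 0 <= d0 -> 0 <= d1 ->
        d <= 2 -> d <= (d1 + d0) / 2 -> d0 * Chi <= H ->
        P s.+2 d1 A -> P s.+1 d0 A -> P s.+1 d (nextA A) &
      forall s d d0 d1 dy A, (s.+2 <= N)%N -> 0 <= A -> 0 <= d -> 0 <= d0 -> 0 <= d1 -> 0 <= dy ->
        d <= 1 + (d0 + dy) / 2 -> d <= (2 + 2 * d0 + dy) / 3 -> d <= (2 + d1 + d0) / 3 ->
        d <= (d1 + d0) / 2 -> d <= 4 -> d0 * Chi <= H -> dy * Chi <= H ->
        P s.+3 d1 A -> P s.+2 d0 A -> P s.+1 dy A -> P s.+2 d (nextA A)].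

Definition reach s d : Prop := exists2 A, 0 <= A & forall P, bootstraps P -> P s d A.

Lemma nextA_ge0 (A : R) : 0 <= A -> 0 <= nextA A.
Proof. rewrite /nextA; lra. Qed.

Lemma reach_weaken s d s' d' : (s <= s')%N -> d' <= d -> reach s d -> reach s' d'.
Proof.
move=> ss dd [A A0 h]; exists A => // P B; have [W _ _ _ _] := B.
exact: W ss dd (lexx A) (h P B).
Qed.

Lemma reach0 s : reach s 0.
Proof. by exists 0 => // P [_ Z _ _ _]; exact: Z. Qed.

Lemma reach_step1 s d d0 d1 : (s.+1 <= N)%N -> 0 <= d -> 0 <= d0 -> 0 <= d1 ->
  d <= 2 -> d <= (d1 + d0) / 2 -> d0 * Chi <= H ->
  reach s.+2 d1 -> reach s.+1 d0 -> reach s.+1 d.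
Proof.
move=> sN d_0 d00 d10 d2 dd dH [A1 A10 h1] [A2 A20 h2].
have M1 : A1 <= A1 + A2 by lra.
have M2 : A2 <= A1 + A2 by lra.
exists (nextA (A1 + A2)); first by apply: nextA_ge0; lra.
move=> P B; have [W _ _ T1 _] := B; apply: (T1 s d d0 d1) => //; first lra.
  exact: W (leqnn _) (lexx _) M1 (h1 P B).
exact: W (leqnn _) (lexx _) M2 (h2 P B).
Qed.

Lemma reach_step2 s d d0 d1 dy : (s.+2 <= N)%N -> 0 <= d -> 0 <= d0 -> 0 <= d1 -> 0 <= dy ->
  d <= 1 + (d0 + dy) / 2 -> d <= (2 + 2 * d0 + dy) / 3 -> d <= (2 + d1 + d0) / 3 ->
  d <= (d1 + d0) / 2 -> d <= 4 -> d0 * Chi <= H -> dy * Chi <= H ->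
  reach s.+3 d1 -> reach s.+2 d0 -> reach s.+1 dy -> reach s.+2 d.
Proof.
move=> sN d_0 d00 d10 dy0 e1 e2 e3 e4 d4 dH dyH [A1 A10 h1] [A2 A20 h2] [A3 A30 h3].
have M1 : A1 <= A1 + A2 + A3 by lra.
have M2 : A2 <= A1 + A2 + A3 by lra.
have M3 : A3 <= A1 + A2 + A3 by lra.
exists (nextA (A1 + A2 + A3)); first by apply: nextA_ge0; lra.
move=> P B; have [W _ _ _ T2] := B; apply: (T2 s d d0 d1 dy) => //; first lra.
- exact: W (leqnn _) (lexx _) M1 (h1 P B).
- exact: W (leqnn _) (lexx _) M2 (h2 P B).
- exact: W (leqnn _) (lexx _) M3 (h3 P B).
Qed.

(** The first step with d0 = 0 halves the exponent 4 at each level down from N; this value lies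
    below all results and serves every s >= 1. *)
Definition weak_exponent : R := 4 / 2 ^+ N.

Lemma weak_exponent_bounds : 0 < weak_exponent <= 1 / 2.
Proof.
rewrite divr_gt0 ?exprn_gt0 //= ler_pdivrMr ?exprn_gt0 //.
apply: le_trans (_ : 1 / 2 * 2 ^+ 3 <= _); first lra.
by apply: ler_wpM2l; [lra | rewrite ler_eXn2l // ltr1n].
Qed.

Lemma reach_weak s : (1 <= s)%N -> reach s weak_exponent.
Proof.
move=> s1.
have G i : (i < N)%N -> reach (N - i) (4 / 2 ^+ i).
  elim: i => [|i IH] iN.
    by exists 4 => // P [_ _ B _ _]; rewrite subn0 expr0 divr1.
  have E : (N - i)%N = (N - i.+1).-1.+2 by move: iN; clear; lia.
  have E' : (N - i.+1)%N = (N - i.+1).-1.+1 by move: iN; clear; lia.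
  have := IH (ltnW iN); rewrite E E' /= => h.
  have p0 : 0 < (2 : R) ^+ i by rewrite exprn_gt0.
  have p1 : 1 <= (2 : R) ^+ i by rewrite exprn_ege1 // ler1n.
  have E2 : 4 / 2 ^+ i.+1 = 4 / 2 ^+ i / 2 :> R by rewrite exprS; field; rewrite gt_eqF.
  have q0 : 0 <= 4 / 2 ^+ i :> R by apply: divr_ge0 => //; apply: ltW.
  have q1 : 4 / 2 ^+ i <= 4 :> R by rewrite ler_pdivrMr // ler_peMr.
  have sN : ((N - i.+1).-1.+1 <= N)%N by rewrite -E' leq_subr.
  have zH : 0 * Chi <= H by rewrite mul0r; have := ChiH; have := Chi0; lra.
  by apply: (reach_step1 sN _ (lexx 0) q0 _ _ zH h (reach0 _)); rewrite E2 ?addr0 //; lra.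
have N0 : (0 < N)%N by apply: leq_trans N3.
apply: (@reach_weaken (N - N.-1) (4 / 2 ^+ N.-1)); last by apply: G; rewrite prednK.
  by move: N0 s1; clear; lia.
rewrite /weak_exponent ler_pM2l // lef_pV2 ?posrE ?exprn_gt0 //.
by rewrite ler_eXn2l ?ltr1n // leq_pred.
Qed.

(** The second step is iterated at fixed s, and d0 grows by dlt / 9 per round up to the cap 2 + dlt
    / 3. This increment is exactly what d <= (2 + d1 + d0) / 3 leaves at the cap; the conditions
    with dy = [weak_exponent] leave room because dlt <= dy. *)
Lemma reach_down s (dlt : R) : (s.+2 <= N)%N -> 0 < dlt -> dlt <= weak_exponent -> (2 + dlt) * Chi <= H ->
  reach s.+3 (2 + dlt) -> reach s.+2 (2 + dlt / 3).
Proof.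
move=> sN d0 dg dH h.
have /andP[g0 g1] := weak_exponent_bounds.
have gH : weak_exponent * Chi <= H.
  have : weak_exponent * Chi <= (1 / 2) * Chi by rewrite ler_wpM2r.
  by have := ChiH; have := Chi0; lra.
have it (m : nat) : reach s.+2 (Num.min (2 + dlt / 3) (m%:R * (dlt / 9))).
  elim: m => [|m IH].
    by apply: reach_weaken (reach0 s.+2) => //; rewrite mul0r ge_min lexx orbT.
  set x := Num.min _ _ in IH; set d := Num.min _ _.
  have x1 : x <= 2 + dlt / 3 by rewrite /x ge_min lexx.
  have d1 : d <= 2 + dlt / 3 by rewrite /d ge_min lexx.
  have md : 0 <= m%:R * (dlt / 9) by rewrite mulr_ge0 //; lra.
  have dS : m.+1%:R * (dlt / 9) = m%:R * (dlt / 9) + dlt / 9 by rewrite -natr1 mulrDl mul1r.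
  have dx : d <= x + dlt / 9.
    rewrite /d dS /x; case: (leP (2 + dlt / 3) (m%:R * _)) => c.
      by rewrite ge_min; apply/orP; left; lra.
    by rewrite ge_min lexx orbT.
  have x0 : 0 <= x by rewrite le_min md andbT; lra.
  have d_0 : 0 <= d by rewrite le_min dS; apply/andP; split; lra.
  apply: reach_step2 sN d_0 x0 _ (ltW g0) _ _ _ _ _ _ gH h IH (reach_weak (ltn0Sn s)) => //; try lra.
  by apply: le_trans dH; rewrite ler_wpM2r //; lra.
pose m := Num.bound ((2 + dlt / 3) / (dlt / 9)).
apply: reach_weaken (it m) => //.
rewrite le_min lexx /= -ler_pdivrMr; last lra.
by apply/ltW/archi_boundP; rewrite divr_ge0 //; lra.
Qed.

(** The mean of 2 + dlt and d exceeds d by at least dlt / 2 while d <= 2, so 2 is reached in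
    finitely many rounds; with dlt = 0 it would only be approached. *)
Lemma reach_one (dlt : R) : 0 < dlt -> reach 2 (2 + dlt) -> reach 1 2.
Proof.
move=> d0 h.
have it (m : nat) : reach 1 (Num.min 2 (m%:R * (dlt / 2))).
  elim: m => [|m IH].
    by apply: reach_weaken (reach0 1) => //; rewrite mul0r ge_min lexx orbT.
  set x := Num.min _ _ in IH; set d := Num.min _ _.
  have x1 : x <= 2 by rewrite /x ge_min lexx.
  have d1 : d <= 2 by rewrite /d ge_min lexx.
  have md : 0 <= m%:R * (dlt / 2) by rewrite mulr_ge0 //; lra.
  have dS : m.+1%:R * (dlt / 2) = m%:R * (dlt / 2) + dlt / 2 by rewrite -natr1 mulrDl mul1r.
  have dx : d <= x + dlt / 2.
    rewrite /d dS /x; case: (leP 2 (m%:R * (dlt / 2))) => c.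
      by rewrite ge_min; apply/orP; left; lra.
    by rewrite ge_min lexx orbT.
  have x0 : 0 <= x by rewrite le_min md andbT; lra.
  have d_0 : 0 <= d by rewrite le_min dS; apply/andP; split; lra.
  apply: reach_step1 (ltnW (ltnW N3)) d_0 x0 _ d1 _ _ h IH; try lra.
  by apply: le_trans (ltW ChiH); rewrite ler_wpM2r.
pose m := Num.bound (2 / (dlt / 2)).
apply: reach_weaken (it m) => //.
rewrite le_min lexx /= -ler_pdivrMr; last lra.
by apply/ltW/archi_boundP; rewrite divr_ge0 //; lra.
Qed.

Lemma schedule : exists2 dlt : R, 0 < dlt <= 1 & exists2 A : R, 0 <= A & forall P, bootstraps P ->
  P 2 (2 + dlt) A /\ P 1 2 A.
Proof.
have /andP[g0 g1] := weak_exponent_bounds.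
have C1 : 0 < Chi + 1 by have := Chi0; lra.
(* Chosen so that (2 + eta) Chi <= H; adding 1 covers Chi = 0. *)
pose eta := (H - 2 * Chi) / (Chi + 1).
have e0 : 0 < eta by rewrite divr_gt0 // subr_gt0.
have eH : (2 + eta) * Chi <= H.
  have : eta * (Chi + 1) = H - 2 * Chi by rewrite /eta divfK // gt_eqF.
  by have := ltW e0; lra.
pose dl := Num.min weak_exponent eta.
have dl0 : 0 < dl by rewrite lt_min g0.
have dlg : dl <= weak_exponent by rewrite ge_min lexx.
have dle : dl <= eta by rewrite ge_min lexx orbT.
have G i : (i.+1 < N)%N -> exists2 d, 0 < d <= dl & reach (N - i) (2 + d).
  elim: i => [|i IH] iN.
    exists dl; first by rewrite dl0 lexx.
    apply: (@reach_weaken N 4); rewrite ?subn0 //; first lra.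
    by exists 4 => // P [_ _ B _ _].
  have [d /andP[d0 d1]] := IH (ltnW iN).
  have E : (N - i)%N = (N - i.+1).-2.+3 by move: iN; clear; lia.
  have E' : (N - i.+1)%N = (N - i.+1).-2.+2 by move: iN; clear; lia.
  rewrite E E' /= => h; exists (d / 3); first by apply/andP; split; lra.
  apply: reach_down h => //; first by rewrite -E' leq_subr.
    exact: le_trans dlg.
  by apply: le_trans eH; rewrite ler_wpM2r //; lra.
have [d /andP[d0 d1]] : exists2 d, 0 < d <= dl & reach 2 (2 + d).
  have [d dd h] := G (N - 2)%N ltac:(move: N3; clear; lia); exists d => //.
  by move: h; rewrite subKn // ltnW.
move=> h; exists d; first by rewrite d0; lra.
have [A A0 hA] := h; have [A' A0' hA'] := reach_one d0 h.
have M1 : A <= A + A' by lra.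
have M2 : A' <= A + A' by lra.
exists (A + A'); first lra.
move=> P B; have [W _ _ _ _] := B; split.
  exact: W (leqnn _) (lexx _) M1 (hA P B).
exact: W (leqnn _) (lexx _) M2 (hA' P B).
Qed.

End Schedule.

(** * The sharp energy bound *)

Lemma expN_sum_bounded (R : realType) (c : R) : 0 < c ->
  exists2 G, 0 <= G & forall N, \sum_(i < N) expR (- (c * i%:R)) <= G.
Proof.
move=> c0; set q := expR (- c).
have q0 : 0 < q by rewrite expR_gt0.
have q1 : 0 < 1 - q by rewrite subr_gt0 /q -[X in _ < X]expR0 ltr_expR oppr_lt0.
exists (1 - q)^-1; first by rewrite invr_ge0 ltW.
move=> N; rewrite -[X in _ <= X]mul1r ler_pdivlMr //.
have Ei (i : nat) : expR (- (c * i%:R)) = q ^+ i by rewrite -expRM_natr mulNr.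
have -> : (\sum_(i < N) expR (- (c * i%:R))) * (1 - q) = 1 - q ^+ N.
  elim: N => [|N IH]; first by rewrite big_ord0 mul0r expr0 subrr.
  by rewrite big_ord_recr /= mulrDl IH Ei exprS; ring.
by rewrite gerBl exprn_ge0 // ltW.
Qed.

Section Sharp.
Variables (R : realType) (kk : nat).
Variables (p : 'I_kk.+1 -> R) (t : 'I_kk.+1 -> R[i]) (chi : 'I_kk.+1 -> R).
Variables (Chi H eps : R).
Hypothesis p_gt0 : forall i, 0 < p i.
Hypothesis p_sum : \sum_(i < kk.+1) p i = 1.
Hypothesis Chi0 : 0 < Chi.
Hypothesis ChiH : 2 * Chi < H.
Hypothesis eps0 : 0 < eps.
Variables (rho tau : R) (S : nat).
Hypotheses (rho0 : 0 <= rho) (rho1 : rho < 1) (tau1 : 1 <= tau).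
Hypothesis t_le : forall i, nm (t i) <= tau.
Hypothesis S3 : (3 <= S)%N.
Variables (b : R) (a0 : R[i]) (ac : 'I_kk -> R[i]).
Hypotheses (b0 : 0 < b) (b4 : b <= 1 / 4).
Hypothesis UB : forall y, inU y -> inB chi eps rho (lamY b a0 ac y).
Local Notation lam := (lamY b a0 ac).
Local Notation PsiF := (PsiF p t chi Chi H eps).
Local Notation PhiF := (PhiF p t chi Chi H eps).
Local Notation claim := (claim p t chi Chi H eps).
Local Notation aeClaim := (aeClaim p t chi Chi H eps b a0 ac).
Local Notation pt := (pt R kk).

Let S1 : (1 <= S)%N := ltnW (ltnW S3).
Let Chi0' : 0 <= Chi := ltW Chi0.
Let eps0' : 0 <= eps := ltW eps0.

Hypothesis sep : exists2 d : R, 0 < d &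
  forall l : 'I_kk.+1 -> R[i], (forall i, nm (l i) <= rho) ->
  forall u v, dif u v -> u != [::] -> v != [::] ->
  exists2 j, (j < S)%N & d <= nm (jetdif t l u v j).

(** By separation the energy with S jets vanishes once the radius is below d. For larger radii exp
    (4 (K - Chi n)) is at least d^4, and a large C suffices. The exponent 4 is a choice that the
    schedule can start from. *)
Lemma base_claim : aeClaim S 4 4.
Proof.
apply: aeClaim_all => y U; have [d d0 hd] := sep.
have B i : nm (lam y i) <= rho := (UB U i).2.
have [C [C0 C1 Cd]] : exists C : R, [/\ 0 <= C, 1 <= C & 1 <= C * d ^+ 4].
  exists (1 + d ^- 4); split; rewrite ?addr_ge0 ?invr_ge0 ?exprn_ge0 ?ltW //.
    by rewrite ltrDl invr_gt0 exprn_gt0.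
  have dn : d ^+ 4 != 0 by rewrite expf_neq0 // gt_eqF.
  by rewrite mulrDl (mulVf dn) mul1r ltrDr exprn_gt0.
exists C => n K K0.
(* For n = 0 the words are empty and separation says nothing, but the bound is at least 1. *)
case: (ltnP 0 n) => [n0|]; last first.
  rewrite leqn0 => /eqP ->; apply: le_trans (PsiF_le1 _ _ _ _ _ p_gt0 p_sum _ _ _ _ _) _.
  rewrite !mulr0 addr0 subr0; apply: mulr_ege1 => //.
  by rewrite -[X in X <= _]expR0 ler_expR mulr_ge0.
have -> : 4 * (K + eps * n%:R) - 4 * Chi * n%:R = 4 * eps * n%:R + 4%:R * (K - Chi * n%:R) by ring.
rewrite [expR (4 * eps * n%:R + _)]expRD expRM_natl.
have en : 1 <= expR (4 * eps * n%:R) by rewrite -[X in X <= _]expR0 ler_expR !mulr_ge0.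
case: (leP d (expR (K - Chi * n%:R))) => hr.
  apply: le_trans (PsiF_le1 _ _ _ _ _ p_gt0 p_sum _ _ _ _ _) _.
  rewrite mulrCA; apply: mulr_ege1 => //; apply: (le_trans Cd).
  by apply: ler_wpM2l => //; rewrite lerXn2r // nnegrE ?(ltW d0) ?expR_ge0.
apply: le_trans (_ : 0 <= _); last by rewrite !mulr_ge0 ?exprn_ge0 ?expR_ge0.
apply: (Ew_le_cst p_gt0 p_sum) => u su.
apply: (Ew_le_cst p_gt0 p_sum) => v sv.
case E : [&& _, _, _ & _] => //; move/and4P: E => [df _ _ /smallP sm].
have nz (w : seq 'I_kk.+1) : size w = n -> w != [::] by move=> sw; rewrite -size_eq0 sw -lt0n.
have [j jS hj] := hd _ B u v df (nz u su) (nz v sv).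
by have := le_lt_trans (le_trans hj (sm j jS)) hr; rewrite ltxx.
Qed.

Lemma bootstraps_ae : bootstraps S Chi H aeClaim.
Proof.
split.
- exact: aeClaim_weaken.
- exact: aeClaim0.
- exact: base_claim.
- move=> s d d0 d1 A; exact: (step1 p_gt0 p_sum Chi0' eps0 rho0 rho1 tau1 t_le S1 b0 b4 UB).
- move=> s d d0 d1 dy A; exact: (step2 p_gt0 p_sum Chi0' eps0 rho0 rho1 tau1 t_le S1 b0 b4 UB).
Qed.

Section Fixed.
Variables (dlt A : R).
Hypotheses (dlt0 : 0 < dlt) (A0 : 0 <= A).
Let A' := 3 * A + 2.
Let A2 := 7 * A' + 2.
Hypothesis eps1 : 14 * A' * eps <= dlt * Chi / 2.
Hypothesis eps2 : (1 + 3 * A2) * eps <= (H - 2 * Chi) / 2.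

Variable C : R.
Hypothesis C0 : 0 <= C.
Definition Xgood (y : pt) : Prop :=
  [/\ inU y, claim (lam y) 2 (2 + dlt) A C & claim (lam y) 1 2 A C].

Let A'0 : 0 <= A'. Proof. by rewrite /A'; have := A0; lra. Qed.
Let A20 : 0 <= A2. Proof. by rewrite /A2; have := A'0; lra. Qed.

(** Case B gains exp (- dlt Chi i) over exp (- 2 Chi n), and [eps1] keeps the losses at scale i
    below half of this gain: the sum over i converges and no factor exp (eps n) remains. Case A
    gains dlt Chi n / 2 in the same way. *)
Lemma sharp_Psi : exists2 C', 0 <= C' & forall L n K, (n <= L)%N -> 0 <= K ->
  AvgLe Xgood (fun y => PsiF (lam y) 1 L K (expR (K - Chi * n%:R)))
    (C' * expR (A2 * K - 2 * Chi * n%:R)).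
Proof.
have XU y : Xgood y -> inU y by case.
have XB y (Xy : Xgood y) : inB chi eps rho (lam y) := UB (XU y Xy).
have [Cp Cp1 HCp] := poly_le_expR S eps0.
have twoH : 2 * Chi <= H := ltW ChiH.
have twop : 0 <= 2 :> R by [].
have S1' : (1 <= S.+1)%N by [].
have [C1 CC1 H0] := claims_phi t p_gt0 p_sum eps0 S1 UB S1' twop twoH A0 C0.
have C10 := le_trans C0 CC1.
have AA : A <= A' by rewrite /A'; have := A0; lra.
have X1 y : Xgood y -> claim (lam y) 2 (2 + dlt) A' C1.
  by case=> _ c _; apply: claim_weaken c _ _ _ _ _.
have X0 y : Xgood y -> claimPhi p t chi Chi H eps (lam y) 1 2 A' C1 by case=> U _ c; exact: H0.
have [CA CA0 HA] := caseA_le p_gt0 p_sum Chi0' eps0' rho0 rho1 tau1 t_le Cp1 HCp XB A'0 C10 S1 X1 X0.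
have [CB CB0 HB] := caseB_le p_gt0 p_sum Chi0' eps0' rho0 rho1 tau1 t_le Cp1 HCp b0 b4 XU XB A'0 C10 S1 X1 X0.
have dC : 0 < dlt * Chi / 2 by rewrite divr_gt0 // mulr_gt0.
have [G G0 HG] := expN_sum_bounded dC.
exists (CA * expR (dlt * Chi + 2 * Chi) + CB * G); first by rewrite addr_ge0 // mulr_ge0 ?expR_ge0.
move=> L n K nL K0.
set e := expR (A2 * K - 2 * Chi * n%:R).
have e0 : 0 <= e by rewrite expR_ge0.
have i2n (i : nat) : (i < n./2)%N -> (i.*2 <= n)%N.
  move=> hi; rewrite -[n in (_ <= n)%N]odd_double_half.
  by apply: leq_trans (leq_addl _ _); rewrite leq_double ltnW.
have S2 := AvgLe_sum (fun i hi => HB L n K i nL K0 (i2n i hi)).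
have SA : AvgLe Xgood (caseA p t chi Chi H eps rho tau S b a0 ac 0 L K n) (CA * expR (dlt * Chi + 2 * Chi) * e).
  apply: AvgLe_cst; first by rewrite !mulr_ge0 ?expR_ge0.
  move=> y Xy; apply: le_trans (HA L n K nL K0 y Xy) _.
  rewrite -[X in _ <= X]mulrA; apply: ler_wpM2l => //; rewrite -expRD ler_expR.
  have n2n := half_le n.
  rewrite natrB //; set x := (n./2)%:R.
  have [x1 x2] := half_bounds R n; rewrite -/x in x1 x2.
  have n0 : 0 <= n%:R :> R by [].
  have h1 : 14 * A' * eps * n%:R <= dlt * Chi / 2 * n%:R by apply: ler_wpM2r.
  have h2 : 0 <= dlt * Chi * (2 * x + 1 - n%:R) by apply: mulr_ge0; [lra | rewrite subr_ge0].
  have h3 := ltW dC; have h4 : 0 <= dlt * Chi * n%:R by apply: mulr_ge0 => //; lra.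
  have h5 := Chi0'; rewrite /A2; lra.
apply: AvgLe_le (AvgLe_add SA S2).
  move=> y Xy.
  exact: (Psi_cases Chi H p_gt0 rho0 rho1 tau1 t_le XB L K n Xy S1).
rewrite [X in _ <= X]mulrDl lerD2l.
apply: le_trans (_ : \sum_(i < n./2) CB * e * expR (- (dlt * Chi / 2 * i%:R)) <= _).
  apply: ler_sum => i _; rewrite -[X in _ <= X]mulrA; apply: ler_wpM2l => //.
  rewrite -expRD ler_expR.
  have h1 : 14 * A' * eps * i%:R <= dlt * Chi / 2 * i%:R by apply: ler_wpM2r.
  rewrite /A2; lra.
rewrite -mulr_sumr -mulrA mulrCA [X in _ <= X]mulrC; apply: ler_wpM2l => //.
by apply: ler_wpM2l => //; exact: HG.
Qed.

(** By [eps2] the weights exp (- (H - 2 Chi) j) of the common prefixes win against the losses, so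
    the sum over j is bounded. The constant may depend on K, which stays fixed from here on. *)
Lemma sharp_Phi K : 0 <= K -> exists2 C', 0 <= C' & forall L n, (n <= L)%N ->
  AvgLe Xgood (fun y => PhiF (lam y) 1 L K (expR (- Chi * n%:R))) (C' * expR (- (2 * Chi * n%:R))).
Proof.
move=> K0; have [Cs Cs0 Hs] := sharp_Psi.
have [Cp Cp1 HCp] := poly_le_expR S eps0.
have [E2 c20] := expR_ln_ge0 (C2_ge1 S Cp1); set c2 := ln _ in E2 c20.
have g0 : 0 < (H - 2 * Chi) / 2 by have := ChiH; lra.
have [G G0 HG] := expN_sum_bounded g0.
pose M := Cs * expR (K + A2 * (c2 + 2 * K)).
have M0 : 0 <= M by rewrite mulr_ge0 ?expR_ge0.
exists (M * G + expR K); first by rewrite addr_ge0 ?mulr_ge0 ?expR_ge0.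
move=> L n nL.
pose Kj (j : nat) := c2 + 2 * K + 3 * eps * j%:R.
have Kj0 j : 0 <= Kj j by rewrite /Kj !addr_ge0 ?mulr_ge0.
have nj j : (n - j <= L - j)%N by exact: leq_sub2r.
have S2 := @AvgLe_sum _ _ Xgood n _ _ (fun j (hj : (j < n)%N) =>
   AvgLe_scale (expR_ge0 (- H * j%:R + eps * j%:R + K)) (Hs (L - j)%N (n - j)%N (Kj j) (nj j) (Kj0 j))).
have SK : AvgLe Xgood (fun=> expR (- H * n%:R + eps * n%:R + K)) (expR (- H * n%:R + eps * n%:R + K)).
  by apply: AvgLe_cst => //; exact: expR_ge0.
apply: AvgLe_le (AvgLe_add S2 SK).
  move=> y [U _ _].
  apply: le_trans (@pair_decomp _ _ p t chi Chi H eps p_gt0 p_sum rho S Cp Cp1 HCp (lam y) 1 n L K _ (UB U) _ nL (expR_ge0 _)) _ => //.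
  rewrite lerD2r; apply: ler_sum => j _; apply: ler_wpM2l; first exact: expR_ge0.
  have jn : (j <= n)%N by rewrite ltnW.
  apply: PsiF_mono => //.
    rewrite /Kj; have : 0 <= eps * j%:R by rewrite mulr_ge0.
    lra.
  rewrite -E2 -!expRD ler_expR natrB // /Kj; lra.
rewrite [X in _ <= X]mulrDl; apply: lerD.
  apply: le_trans (_ : \sum_(j < n) M * expR (- (2 * Chi * n%:R)) * expR (- ((H - 2 * Chi) / 2 * j%:R)) <= _).
    apply: ler_sum => j _; rewrite /M mulrCA -!(mulrA Cs); apply: ler_wpM2l => //.
    rewrite -!expRD ler_expR natrB ?(ltnW (ltn_ord j)) // /Kj.
    have : (1 + 3 * A2) * eps * j%:R <= (H - 2 * Chi) / 2 * j%:R by apply: ler_wpM2r.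
    lra.
  rewrite -mulr_sumr mulrAC; apply: ler_wpM2r; first exact: expR_ge0.
  by apply: ler_wpM2l => //; exact: HG.
rewrite -expRD ler_expR.
have : eps * n%:R <= (H - 2 * Chi) * n%:R.
  apply: ler_wpM2r => //; have := eps2; have : 0 <= A2 * eps by rewrite mulr_ge0.
  have := g0; lra.
lra.
Qed.

(** Infinitely many n, because a sharp average bound leaves no summable factor for
    Borel-Cantelli. *)
Definition freq_small K (y : pt) : Prop := exists M : nat, forall n1, exists2 n, (n1 <= n)%N &
  PhiF (lam y) 1 (2 * n) K (expR (- Chi * n%:R)) <= M%:R * expR (- (2 * Chi * n%:R)).

(** A Fatou argument: by [markov] at n1 alone, the points that fail for all n >= n1 have content at
    most C' / M. These sets increase with n1, and [content_cvg] covers their union. *)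
Lemma sharp_liminf K : 0 <= K -> nullY (fun y => Xgood y /\ ~ freq_small K y).
Proof.
move=> K0; have [C' C'0 H'] := sharp_Phi K0 => d d0.
pose M := (Num.bound (C' / (d / 2))).+1.
have M0 : 0 < M%:R :> R by rewrite ltr0n.
have MC : C' / M%:R <= d / 2.
  rewrite ler_pdivrMr // mulrC -ler_pdivrMr; last lra.
  apply/ltW; apply: lt_le_trans (archi_boundP _) _; first by rewrite divr_ge0 //; lra.
  by rewrite ler_nat.
pose Y n1 y := Xgood y /\ forall n, (n1 <= n)%N ->
  M%:R * expR (- (2 * Chi * n%:R)) < PhiF (lam y) 1 (2 * n) K (expR (- Chi * n%:R)).
have YU n y : Y n y -> inU y by case=> -[].
have Yinc n y : Y n y -> Y n.+1 y by case=> Xy h; split => // m /ltnW/h.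
have d2 : 0 < d / 2 by lra.
have Yc n : exists l0, forall l, (l0 <= l)%N -> content l (Y n) <= d / 2.
  have n2 : (n <= 2 * n)%N by rewrite leq_pmull.
  have t0 : 0 < M%:R * expR (- (2 * Chi * n%:R)) :> R by rewrite mulr_gt0 ?expR_gt0.
  have [l0 hl] := markov (H' _ _ n2) t0 (Y := Y n) (fun y h => conj h.1 (h.2 n (leqnn n))).
  exists l0 => l ll; apply: (le_trans (hl l ll)).
  by rewrite -mulf_div divff ?gt_eqF ?expR_gt0 // mulr1.
have [s cs vs] := content_cvg YU Yinc d2 Yc.
exists s; last by move=> N; apply: (le_trans (vs N)); lra.
move=> y [Xy nf]; apply: cs; apply: contrapT => nY; apply: nf; exists M => n1.
apply: contrapT => nn; apply: nY; exists n1; split => // n n1n; rewrite ltNge.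
by apply/negP => h; apply: nn; exists n.
Qed.

End Fixed.

Definition good (y : pt) : Prop := forall K : nat, freq_small K%:R y.

Lemma ae_good dlt A : 0 < dlt -> 0 <= A ->
  14 * (3 * A + 2) * eps <= dlt * Chi / 2 ->
  (1 + 3 * (7 * (3 * A + 2) + 2)) * eps <= (H - 2 * Chi) / 2 ->
  aeClaim 2 (2 + dlt) A -> aeClaim 1 2 A ->
  nullY (fun y => inU y /\ ~ good y).
Proof.
move=> d0 A0 e1 e2 H1 H0.
have nM M : nullY (fun y => exists K : nat, Xgood dlt A M%:R y /\ ~ freq_small K%:R y).
  by apply: nullY_bigcup => K; exact: (sharp_liminf d0 A0 e1 e2 (ler0n R M) (ler0n R K)).
apply: nullY_sub (nullY_U (nullY_U H1 H0) (nullY_bigcup nM)) => y [U nh].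
apply: contrapT => n.
have h1 : hasclaim p t chi Chi H eps b a0 ac 2 (2 + dlt) A y by apply: contrapT => nn; apply: n; left; left.
have h0 : hasclaim p t chi Chi H eps b a0 ac 1 2 A y by apply: contrapT => nn; apply: n; left; right.
have [M1 c1] := hasclaim_nat p_gt0 Chi0' eps0 A0 h1; have [M0 c0] := hasclaim_nat p_gt0 Chi0' eps0 A0 h0.
apply: nh => K; apply: contrapT => nf; apply: n; right; exists (maxn M1 M0), K; split => //; split => //.
  by apply: c1; rewrite leq_maxl.
by apply: c0; rewrite leq_maxr.
Qed.

End Sharp.

(** * Most words are typical *)

Lemma expR_quadratic (R : realType) (x : R) : x <= 1 / 2 -> expR x <= 1 + x + 2 * x ^+ 2.
Proof.
move=> x2; have h := expR_ge1Dx (- x).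
have x1 : 0 < 1 - x by lra.
have e : expR x * (1 - x) <= 1.
  by rewrite -[X in _ <= X](expRxMexpNx_1 x); apply: ler_wpM2l => //; exact: expR_ge0.
rewrite -(ler_pM2r x1); apply: (le_trans e).
have : 0 <= x ^+ 2 * (1 - 2 * x) by rewrite mulr_ge0 ?sqr_ge0 //; lra.
rewrite expr2; lra.
Qed.

Section TypicalMass.
Variables (R : realType) (k : nat) (p : 'I_k -> R).
Hypothesis p_gt0 : forall i, 0 < p i.
Hypothesis p_sum : \sum_(i < k) p i = 1.
Local Notation Ew := (Ew p).

Lemma Ew_take j n F : (j <= n)%N -> Ew n (fun u => F (take j u)) = Ew j F.
Proof.
move=> jn; rewrite -(subnKC jn) Ew_cat; apply: Ew_ext => u su.
under Ew_ext => v _ do rewrite take_size_cat //.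
exact: Ew_cst.
Qed.

Lemma Ew_expR (y : 'I_k -> R) n : Ew n (fun u => expR (wsum y u)) = (\sum_(i < k) p i * expR (y i)) ^+ n.
Proof.
elim: n => [|n IH] /=; first by rewrite /wsum big_nil expR0 expr0.
rewrite exprS mulr_suml; apply: eq_bigr => i _; rewrite -mulrA -IH -[X in _ = _ * X]EwZ; congr (_ * _).
by apply: Ew_ext => u _; rewrite /wsum big_cons expRD.
Qed.

(** Chernoff bound and a union over prefix lengths. With drift - e and increments at most B, theta =
    e / (4 B^2) makes the quadratic term 2 (theta B)^2 half of the linear gain theta e, so the
    exponential moment q is below 1 and its powers are summable. *)
Lemma exit_prob (y : 'I_k -> R) : \sum_(i < k) p i * y i < 0 ->
  exists2 theta, 0 < theta & exists2 G, 0 <= G & forall n K,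
    Ew n (fun u => (has (fun j => K < wsum y (take j u)) (iota 0 n.+1))%:R) <= G * expR (- (theta * K)).
Proof.
move=> neg; pose e := - \sum_(i < k) p i * y i.
have e0 : 0 < e by rewrite oppr_gt0.
pose B := 1 + \sum_(i < k) `|y i| + e.
have s0 : 0 <= \sum_(i < k) `|y i| by apply: sumr_ge0.
have yB i : `|y i| <= B.
  apply: le_trans (_ : \sum_(i < k) `|y i| <= _); last by rewrite /B; lra.
  by rewrite (bigD1 i) //= lerDl sumr_ge0.
have B0 : 0 < B by rewrite /B; lra.
have eB : e <= B by rewrite /B; lra.
pose th := e / (4 * B ^+ 2).
have B2 : 0 < 4 * B ^+ 2 by rewrite mulr_gt0 // exprn_gt0.
have th0 : 0 < th by rewrite divr_gt0.
have thE : th * (4 * B ^+ 2) = e by rewrite /th divfK // gt_eqF.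
have thB : th * B <= 1 / 4.
  rewrite -(ler_pM2r B0); have : th * B * B = e / 4 by rewrite -thE expr2; field.
  lra.
have hy i : expR (th * y i) <= 1 + th * y i + 2 * (th * B) ^+ 2.
  have ha : `|th * y i| <= th * B by rewrite normrM gtr0_norm // ler_pM2l.
  apply: le_trans (expR_quadratic _) _.
    by apply: le_trans (ler_norm _) _; lra.
  rewrite lerD2l; apply: ler_wpM2l => //.
  by rewrite -(real_normK (num_real (th * y i))) lerXn2r // nnegrE ?(le_trans _ ha).
set q := \sum_(i < k) p i * expR (th * y i).
have q0 : 0 <= q by apply: sumr_ge0 => i _; rewrite mulr_ge0 ?expR_ge0 // ltW.
have q1 : q <= 1 - th * e / 2.
  apply: le_trans (_ : \sum_(i < k) (p i * (1 + 2 * (th * B) ^+ 2) + th * (p i * y i)) <= _).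
    apply: ler_sum => i _; apply: le_trans (ler_wpM2l (ltW (p_gt0 i)) (hy i)) _; lra.
  rewrite big_split /= -mulr_suml -mulr_sumr p_sum mul1r.
  have -> : \sum_(i < k) p i * y i = - e by rewrite /e opprK.
  have : 2 * (th * B) ^+ 2 = th * e / 2 by rewrite -thE; field.
  lra.
have te : 0 < th * e by rewrite mulr_gt0.
have q1' : 0 < 1 - q by lra.
exists th => //; exists (1 - q)^-1; first by rewrite invr_ge0 ltW.
move=> n K.
apply: le_trans (_ : Ew n (fun u => \sum_(j < n.+1) expR (- (th * K)) * expR (wsum (fun i => th * y i) (take j u))) <= _).
  apply: (Ew_le p_gt0) => u su; case: hasP => [[j] | _]; last first.
    by apply: sumr_ge0 => j _; rewrite mulr_ge0 ?expR_ge0.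
  rewrite mem_iota /= add0n => jn Kj; rewrite (bigD1 (Ordinal jn)) //=.
  apply: le_trans (_ : expR (- (th * K)) * expR (wsum (fun i => th * y i) (take j u)) <= _); last first.
    by rewrite lerDl; apply: sumr_ge0 => i _; rewrite mulr_ge0 ?expR_ge0.
  rewrite -expRD -[X in X <= _]expR0 ler_expR.
  have -> : wsum (fun i => th * y i) (take j u) = th * wsum y (take j u) by rewrite /wsum mulr_sumr.
  by have := ler_wpM2l (ltW th0) (ltW Kj); lra.
rewrite Ew_sum.
apply: le_trans (_ : \sum_(j < n.+1) expR (- (th * K)) * q ^+ j <= _).
  apply: ler_sum => j _; rewrite EwZ.
  rewrite (Ew_take (fun u => expR (wsum (fun i => th * y i) u))) ?Ew_expR //.
  by rewrite -ltnS.
rewrite -mulr_sumr mulrC; apply: ler_wpM2r; first exact: expR_ge0.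
rewrite -[X in _ <= X]mul1r ler_pdivlMr //.
have -> : (\sum_(j < n.+1) q ^+ j) * (1 - q) = 1 - q ^+ n.+1.
  elim: (n.+1) => [|N IH]; first by rewrite big_ord0 mul0r expr0 subrr.
  by rewrite big_ord_recr /= mulrDl IH exprS; ring.
by rewrite gerBl exprn_ge0.
Qed.

Lemma exit_small (y : 'I_k -> R) (d : R) : \sum_(i < k) p i * y i < 0 -> 0 < d ->
  exists K0 : nat, forall n (K : nat), (K0 <= K)%N ->
    Ew n (fun u => (has (fun j => K%:R < wsum y (take j u)) (iota 0 n.+1))%:R) <= d.
Proof.
move=> neg d0; have [th th0 [G G0 H]] := exit_prob neg.
exists (Num.bound (G / d / th)) => n K KK; apply: (le_trans (H n _)).
rewrite expRN ler_pdivrMr ?expR_gt0 // -ler_pdivrMl // mulrC.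
have h1 : G / d <= th * K%:R.
  rewrite [X in _ <= X]mulrC -ler_pdivrMr //; apply: le_trans (_ : (Num.bound (G / d / th))%:R <= _).
    by apply/ltW/archi_boundP; rewrite !divr_ge0 // ltW.
  by rewrite ler_nat.
by apply: (le_trans h1); have := expR_ge1Dx (th * K%:R); lra.
Qed.

(** The two one-sided deviations are exits of walks with drift - eps. *)
Lemma dev_small (x : 'I_k -> R) (eps d : R) : 0 < eps -> 0 < d ->
  exists K0 : nat, forall n (K : nat), (K0 <= K)%N ->
    Ew n (fun u => (~~ dev x (\sum_(i < k) p i * x i) eps K%:R u)%:R) <= d.
Proof.
move=> e0 d0; set m := \sum_(i < k) p i * x i.
have d2 : 0 < d / 2 by lra.
have [K1 H1] : exists K0 : nat, forall n (K : nat), (K0 <= K)%N ->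
    Ew n (fun u => (has (fun j => K%:R < wsum (fun i => x i - (m + eps)) (take j u)) (iota 0 n.+1))%:R) <= d / 2.
  apply: exit_small => //.
  under eq_bigr do rewrite mulrBr; rewrite sumrB -mulr_suml p_sum mul1r -/m; lra.
have [K2 H2] : exists K0 : nat, forall n (K : nat), (K0 <= K)%N ->
    Ew n (fun u => (has (fun j => K%:R < wsum (fun i => (m - eps) - x i) (take j u)) (iota 0 n.+1))%:R) <= d / 2.
  apply: exit_small => //.
  under eq_bigr do rewrite mulrBr; rewrite sumrB -mulr_suml p_sum mul1r -/m; lra.
exists (maxn K1 K2) => n K; rewrite geq_max => /andP[k1 k2].
have := lerD (H1 n K k1) (H2 n K k2); rewrite -EwD -splitr => h; apply: le_trans h.
apply: (Ew_le p_gt0) => u su; cbv beta; case: (boolP (dev _ _ _ _ _)) => [_|/allPn[j]].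
  by rewrite /= addr_ge0.
rewrite su mem_iota add0n -ltNge => /andP[_ jn] nd.
have sj : size (take j u) = j by rewrite size_takel // su -ltnS.
have w1 c : wsum (fun i => x i - c) (take j u) = wsum x (take j u) - j%:R * c.
  by rewrite /wsum sumrB big_const_seq count_predT iter_addr_0 sj mulr_natl.
have w2 c : wsum (fun i => c - x i) (take j u) = j%:R * c - wsum x (take j u).
  by rewrite /wsum sumrB big_const_seq count_predT iter_addr_0 sj mulr_natl.
have [c|c] := ltP (eps * j%:R + K%:R) (wsum x (take j u) - j%:R * m).
  have -> : has (fun j => K%:R < wsum (fun i => x i - (m + eps)) (take j u)) (iota 0 n.+1).
    by apply/hasP; exists j; rewrite ?mem_iota //= w1; lra.
  by rewrite lerDl.
have -> : has (fun j => K%:R < wsum (fun i => (m - eps) - x i) (take j u)) (iota 0 n.+1).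
  apply/hasP; exists j; rewrite ?mem_iota //= w2.
  by move: nd; rewrite ltr_normr => /orP[|]; lra.
by rewrite lerDr.
Qed.

Lemma typ_mass (chi : 'I_k -> R) (eps d : R) : 0 < eps -> 0 < d ->
  exists K : nat, forall n,
    1 - d <= Ew n (fun u => (typ p chi (\sum_(i < k) p i * chi i) (- \sum_(i < k) p i * ln (p i)) eps K%:R u)%:R).
Proof.
move=> e0 d0; have d2 : 0 < d / 2 by lra.
have [K1 H1] := dev_small chi e0 d2; have [K2 H2] := dev_small (fun i => - ln (p i)) e0 d2.
exists (maxn K1 K2) => n.
have := lerD (H1 n _ (leq_maxl K1 K2)) (H2 n _ (leq_maxr K1 K2)); rewrite -EwD -splitr => h.
rewrite lerBlDl; apply: le_trans (lerD h (lexx _)).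
rewrite -EwD -[X in X <= _](Ew_cst p_sum n 1); apply: (Ew_le p_gt0) => u _.
have -> : - (\sum_(i < k) p i * ln (p i)) = \sum_(i < k) p i * - ln (p i).
  by rewrite -sumrN; apply: eq_bigr => i _; rewrite mulrN.
rewrite /typ; case: (dev chi _ _ _ _) => /=; case: (dev _ _ _ _ _) => /=; lra.
Qed.

End TypicalMass.

Local Open Scope classical_set_scope.

(** * Dyadic approximation in the plane *)

Section Grid.
Variable R : realType.

Definition fidx (q : nat) (x : R) : int := Num.floor (2 ^+ q * x).
Definition cidx q (z : R * R) : int * int := (fidx q z.1, fidx q z.2).

Lemma cidxE q z : cidx q z = (fidx q z.1, fidx q z.2).
Proof. by []. Qed.

Lemma fidx_itv q x : (fidx q x)%:~R <= 2 ^+ q * x < (fidx q x)%:~R + 1.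
Proof. by have := floor_itv (2 ^+ q * x); rewrite intrD. Qed.

Lemma fidx_ge q x (n : int) : (n <= fidx q x)%R = (n%:~R <= 2 ^+ q * x).
Proof. exact: floor_ge_int. Qed.

Lemma fidx_mono m q x x' : (m <= q)%N -> (fidx q x <= fidx q x')%R -> (fidx m x <= fidx m x')%R.
Proof.
move=> mq h; rewrite fidx_ge.
have D0 : 0 < (2 : R) ^+ (q - m) by rewrite exprn_gt0.
rewrite -(ler_pM2r D0) mulrAC -exprD subnKC //.
have /andP[h1 _] := fidx_itv q x'.
have h2 : ((fidx m x) * 2 ^+ (q - m) <= fidx q x)%R.
  rewrite fidx_ge intrM rmorphXn /=.
  have /andP[g _] := fidx_itv m x.
  by move: g; rewrite -(ler_pM2r D0) mulrAC -exprD subnKC.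
apply: le_trans h1; have := le_trans h2 h; rewrite -(ler_int R) intrM rmorphXn /=; exact.
Qed.

Lemma cidx_refine m q z z' : (m <= q)%N -> cidx q z = cidx q z' -> cidx m z = cidx m z'.
Proof.
move=> mq [e1 e2]; congr (_, _); apply/eqP; rewrite eq_le; apply/andP; split.
- by apply: (fidx_mono mq); rewrite e1.
- by apply: (fidx_mono mq); rewrite e1.
- by apply: (fidx_mono mq); rewrite e2.
- by apply: (fidx_mono mq); rewrite e2.
Qed.

Definition determined q (F : set (R * R)) : Prop :=
  forall z z', cidx q z = cidx q z' -> F z -> F z'.

Lemma determined_refine m q F : (m <= q)%N -> determined m F -> determined q F.
Proof. by move=> mq D z z' e; apply: D; exact: cidx_refine mq e. Qed.

Lemma measurable_fidx q (n : int) : measurable [set x : R | (fidx q x < n)%R].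
Proof.
have -> : [set x : R | (fidx q x < n)%R] = `]-oo, (2 ^- q * n%:~R)[%classic.
  have E x : (fidx q x < n)%R = (x < 2 ^- q * n%:~R).
    by rewrite [LHS]ltNge fidx_ge -ltNge ltr_pdivlMl // exprn_gt0.
  by apply/seteqP; split => x /=; rewrite in_itv /= E.
exact: measurable_itv.
Qed.

Section Approximation.
Variable mu : {measure set (R * R) -> \bar R}.
Hypothesis muT : (mu setT < +oo)%E.

Lemma mu_fin A : measurable A -> (mu A < +oo)%E.
Proof.
move=> mA; apply: le_lt_trans muT; apply: le_measure; rewrite ?inE //.
Qed.

(** Approximation by sets that depend only on the dyadic square at one scale. Such A form a
    sigma-algebra because mu is finite. *)
Definition approx (A : set (R * R)) : Prop := measurable A /\
  forall e : R, 0 < e -> exists q F, [/\ measurable F, determined q F &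
    (mu ((A `\` F) `|` (F `\` A)) <= e%:E)%E].

Lemma approx_determined q F : measurable F -> determined q F -> approx F.
Proof.
move=> mF D; split => // e e0; exists q, F; split => //.
by rewrite setDv setU0 measure0 lee_fin ltW.
Qed.

Lemma approxC A : approx A -> approx (~` A).
Proof.
move=> [mA h]; split; first exact: measurableC.
move=> e /h[q [F [mF D m]]]; exists q, (~` F); split; first exact: measurableC.
  by move=> z z' e' nF Fz; apply: nF; apply: D Fz.
suff -> : (~` A `\` ~` F) `|` (~` F `\` ~` A) = (A `\` F) `|` (F `\` A) by [].
by rewrite !setDE !setCK setUC [_ `&` A]setIC [_ `&` F]setIC.
Qed.

Lemma approxU A B : approx A -> approx B -> approx (A `|` B).
Proof.
move=> [mA hA] [mB hB]; split; first exact: measurableU.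
move=> e e0; have e2 : 0 < e / 2 by lra.
have [q [F [mF DF hF]]] := hA _ e2; have [q' [F' [mF' DF' hF']]] := hB _ e2.
exists (maxn q q'), (F `|` F'); split; first exact: measurableU.
  move=> z z' cz [Fz|Fz]; [left | right].
    by apply: determined_refine DF _ _ cz Fz; rewrite leq_maxl.
  by apply: determined_refine DF' _ _ cz Fz; rewrite leq_maxr.
have -> : e%:E = ((e / 2)%:E + (e / 2)%:E)%E by rewrite -EFinD -splitr.
apply: le_trans (leeD hF hF'); apply: le_trans (measureU2 _ _ _); last 2 first.
- by apply: measurableU; apply: measurableD.
- by apply: measurableU; apply: measurableD.
apply: le_measure; rewrite ?inE.
- by apply: measurableU; apply: measurableD => //; apply: measurableU.
- by apply: measurableU; apply: measurableU; apply: measurableD.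
move=> z [[[Az|Bz] n]|[[Fz|Fz] n]].
- by left; left; split => // Fz; apply: n; left.
- by right; left; split => // Fz; apply: n; right.
- by left; right; split => // Az; apply: n; left.
- by right; right; split => // Az; apply: n; right.
Qed.

Lemma tail_small (A : nat -> set (R * R)) (e : R) : (forall i, measurable (A i)) -> 0 < e ->
  exists N, (mu ((\bigcup_i A i) `\` \big[setU/set0]_(i < N) A i) <= e%:E)%E.
Proof.
move=> mA e0; pose F N := (\bigcup_i A i) `\` \big[setU/set0]_(i < N) A i.
have mF N : measurable (F N).
  by apply: measurableD; [exact: bigcupT_measurable | exact: bigsetU_measurable].
have F0 : \bigcap_N F N = set0.
  apply/seteqP; split => // z h; have [[i _ Ai] _] := h 0%N I.
  by have [_ ] := h i.+1 I; apply; rewrite big_ord_recr /=; right.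
have cv : (mu \o F) n @[n --> \oo] --> mu (\bigcap_N F N).
  apply: nonincreasing_cvg_mu => //.
  - exact: mu_fin.
  - by rewrite F0.
  - apply/nonincreasing_seqP => n; apply/subsetPset => z [h1 h2]; split => // h3; apply: h2.
    by rewrite big_ord_recr /=; left.
rewrite F0 measure0 in cv; case/fine_cvgP: cv => [[N1 _ fN] cv].
have /cvgr0Pnorm_lt /(_ _ e0) [N2 _ hN2] := cv.
exists (maxn N1 N2); have := fN (maxn N1 N2) (leq_maxl _ _); have := hN2 (maxn N1 N2) (leq_maxr _ _).
rewrite /= => h1 h2; rewrite -(fineK h2) lee_fin; apply: ltW; exact: le_lt_trans (ler_norm _) h1.
Qed.

Lemma approx_bigcup (A : nat -> set (R * R)) : (forall i, approx (A i)) -> approx (\bigcup_i A i).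
Proof.
move=> hA; have mA i : measurable (A i) := (hA i).1.
split; first exact: bigcupT_measurable.
move=> e e0; have e2 : 0 < e / 2 by lra.
have [N hN] := tail_small mA e2.
have BN : approx (\big[setU/set0]_(i < N) A i).
  elim: (N) => [|n IH]; last by rewrite big_ord_recr /=; exact: approxU.
  by rewrite big_ord0; exact: (@approx_determined 0).
have [q [F [mF DF hF]]] := BN.2 _ e2.
exists q, F; split => //.
have -> : e%:E = ((e / 2)%:E + (e / 2)%:E)%E by rewrite -EFinD -splitr.
have mU : measurable (\bigcup_i A i) by exact: bigcupT_measurable.
have mB := BN.1.
apply: le_trans (leeD hN hF); apply: le_trans (measureU2 _ _ _); last 2 first.
- exact: measurableD.
- by apply: measurableU; apply: measurableD.
apply: le_measure; rewrite ?inE.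
- by apply: measurableU; apply: measurableD.
- by apply: measurableU; [exact: measurableD | apply: measurableU; apply: measurableD].
move=> z [[Uz n]|[Fz n]].
  have [Bz|nB] := pselect ((\big[setU/set0]_(i < N) A i) z); last by left.
  by right; left.
right; right; split => // Bz; apply: n.
move: Bz; elim: (N) => [|m IH]; first by rewrite big_ord0.
by rewrite big_ord_recr /= => -[/IH|h] //; exists m.
Qed.

Lemma approx_sigma : sigma_algebra setT approx.
Proof.
split; first exact: (@approx_determined 0).
- by move=> A hA; rewrite setTD; exact: approxC.
- exact: approx_bigcup.
Qed.

Lemma approxI A B : approx A -> approx B -> approx (A `&` B).
Proof.
move=> hA hB; rewrite -[A `&` B]setCK setCI; apply: approxC; apply: approxU; exact: approxC.
Qed.

Lemma ray_union (x : R) : `]-oo, x[%classic = \bigcup_q [set y : R | (fidx q y < fidx q x)%R].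
Proof.
apply/seteqP; split => y /=; rewrite in_itv /=; last first.
  move=> [q _ /=]; rewrite ltNge => n; rewrite ltNge; apply/negP => xy; move/negP: n; apply.
  rewrite fidx_ge; have /andP[h _] := fidx_itv q x; apply: (le_trans h).
  by rewrite ler_pM2l // exprn_gt0.
move=> yx; have d0 : 0 < x - y by rewrite subr_gt0.
pose q := Num.bound (2 / (x - y)); exists q => //=.
have h1 : 2 / (x - y) < q%:R by apply: archi_boundP; rewrite divr_ge0 // ltW.
have h2 : q%:R <= 2 ^+ q :> R by rewrite -natrX ler_nat ltnW // ltn_expl.
have h3 : 2 <= 2 ^+ q * (x - y) by rewrite -ler_pdivrMr //; exact: ltW (lt_le_trans h1 h2).
have /andP[_ a] := fidx_itv q x; have /andP[b _] := fidx_itv q y.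
by rewrite -(ltr_int R); lra.
Qed.

Lemma approx_cylinder (pr : R * R -> R) (A : set R) :
  (forall q z z', cidx q z = cidx q z' -> fidx q (pr z) = fidx q (pr z')) ->
  measurable_fun setT pr -> measurable A -> approx (pr @^-1` A).
Proof.
move=> hpr mpr.
have mE : @measurable _ (measurableTypeR R) = <<s (@measurable_realfun.RGenInftyO.G R) >> by exact: measurable_realfun.RGenInftyO.measurableE.
have sub : <<s (@measurable_realfun.RGenInftyO.G R) >> `<=` [set A : set R | approx (pr @^-1` A)].
  apply: smallest_sub.
    have [h0 hC hU] := approx_sigma; split => /=.
    - by rewrite preimage_set0.
    - by move=> B hB; rewrite setTD preimage_setC; exact: approxC.
    - by move=> B hB; rewrite preimage_bigcup; exact: hU.
  move=> _ [x ->] /=; rewrite ray_union preimage_bigcup; apply: approx_bigcup => q.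
  apply: (@approx_determined q).
    rewrite -[_ @^-1` _]setTI; apply: mpr => //; exact: measurable_fidx.
  by move=> z z' /hpr e /=; rewrite e.
by move=> mA; apply: sub; rewrite -mE.
Qed.

Lemma approx_measurable A : measurable A -> approx A.
Proof.
have sub : <<s [set B `*` C | B in @measurable _ (measurableTypeR R) & C in @measurable _ (measurableTypeR R)] >> `<=` approx.
  apply: smallest_sub; first exact: approx_sigma.
  move=> _ [B mB] [C mC] <-.
  have -> : B `*` C = (fst @^-1` B) `&` (snd @^-1` C) :> set (R * R) by [].
  apply: approxI; apply: approx_cylinder => //.
  - by move=> q z z' [].
  - by move=> q z z' [].
by move=> mA; apply: sub; rewrite -measurable_prod_measurableType.
Qed.

End Approximation.
End Grid.

(** * Counting dyadic squares *)

Section Counting.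
Variable R : realType.

(* R carries two convertible measurable structures with different displays; leb2 is made a measure on R * R again. *)
Let lebm0 : {measure set (measurableTypeR R * measurableTypeR R) -> \bar R} :=
  [the {measure set (measurableTypeR R * measurableTypeR R) -> \bar R} of
    (@lebesgue_measure R \x @lebesgue_measure R)%E].
Definition lebf : set (R * R) -> \bar R := @leb2 R.
Let lebf0 : lebf set0 = 0%E. Proof. exact: (measure0 lebm0). Qed.
Let lebf_ge0 A : (0 <= lebf A)%E. Proof. exact: (measure_ge0 lebm0). Qed.
Let lebf_additive : semi_sigma_additive lebf.
Proof. exact: (@measure_semi_sigma_additive _ _ _ lebm0). Qed.
HB.instance Definition _ := isMeasure.Build _ (R * R)%type R lebf lebf0 lebf_ge0 lebf_additive.
Definition lebm : {measure set (R * R) -> \bar R} := lebf.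

Lemma lebmX (A B : set R) : measurable A -> measurable B ->
  lebm (A `*` B) = (lebesgue_measure A * lebesgue_measure B)%E.
Proof.
exact: (@product_measure1E _ _ (measurableTypeR R) (measurableTypeR R) R (@lebesgue_measure R) (@lebesgue_measure R) A B).
Qed.

Local Notation cidx := (@cidx R).
Local Notation fidx := (@fidx R).

Definition cell2 (q : nat) (c : int * int) : set (R * R) := [set z | cidx q z = c].

Lemma fidx_eq q (n : int) : [set x : R | fidx q x = n] = `[2 ^- q * n%:~R, 2 ^- q * (n + 1)%:~R[%classic.
Proof.
have p0 : 0 < (2 : R) ^+ q by rewrite exprn_gt0.
have E x : (fidx q x == n) = (2 ^- q * n%:~R <= x < 2 ^- q * (n + 1)%:~R).
  rewrite ler_pdivrMl // ltr_pdivlMl // -fidx_ge.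
  have -> : (2 ^+ q * x < (n + 1)%:~R) = ~~ (n + 1 <= fidx q x) by rewrite fidx_ge -ltNge.
  by apply/idP/idP; move: (fidx q x) => m; lia.
apply/seteqP; split => x /=; rewrite in_itv /= -E; first by move=> ->.
by move/eqP.
Qed.

Lemma cell2E q c : cell2 q c = [set x | fidx q x = c.1] `*` [set x | fidx q x = c.2].
Proof.
apply/seteqP; split => [[x y] | [x y]] /=; rewrite /cell2 /= cidxE /=.
  by move=> <-.
by case: c => c1 c2 /= [-> ->].
Qed.

Lemma measurable_cell2 q c : measurable (cell2 q c).
Proof. by rewrite cell2E !fidx_eq; apply: measurableX; exact: measurable_itv. Qed.

Lemma leb2_cell2 q c : lebm (cell2 q c) = ((4 ^+ q)^-1)%:E.
Proof.
have p0 : 0 < (2 : R) ^- q by rewrite invr_gt0 exprn_gt0.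
have one n : lebesgue_measure [set x : R | fidx q x = n] = ((2 ^- q)%:E : \bar R).
  rewrite fidx_eq lebesgue_measure_itv /= lte_fin ltr_pM2l // ltr_int ltrDl ltr01.
  by rewrite -EFinD -mulrBr intrD addrAC subrr add0r mulr1.
rewrite cell2E lebmX; last 2 first.
- by rewrite fidx_eq; exact: measurable_itv.
- by rewrite fidx_eq; exact: measurable_itv.
rewrite (_ : (_ * _)%E = ((2 ^- q)%:E * (2 ^- q)%:E)%E); last by congr (_ * _)%E; exact: one.
by rewrite -EFinM -invfM -exprMn -natrM.
Qed.

Definition cells2 q (s : seq (int * int)) : set (R * R) := [set z | cidx q z \in s].

Lemma cells2_cons q c s : cells2 q (c :: s) = cell2 q c `|` cells2 q s.
Proof.
apply/seteqP; split => z; rewrite /cells2 /cell2 /= inE.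
  by case/orP => [/eqP|]; [left | right].
by case=> [->|->]; rewrite ?eqxx ?orbT.
Qed.

Lemma measurable_cells2 q s : measurable (cells2 q s).
Proof.
elim: s => [|c s IH]; last by rewrite cells2_cons; apply: measurableU => //; exact: measurable_cell2.
by rewrite (_ : cells2 q [::] = set0) //; apply/seteqP; split => z.
Qed.

Lemma leb2_cells2 q s : uniq s -> lebm (cells2 q s) = ((size s)%:R / 4 ^+ q)%:E.
Proof.
elim: s => [_|c s IH /= /andP[cs us]].
  have -> : cells2 q [::] = set0 by apply/seteqP; split => z.
  by rewrite mul0r; exact: measure0.
have dU : lebm (cell2 q c `|` cells2 q s) = (lebm (cell2 q c) + lebm (cells2 q s))%E.
  apply: measureU; [exact: measurable_cell2 | exact: measurable_cells2 | ].
  by apply/seteqP; split => // z []; rewrite /cell2 /cells2 /= => ->; exact/negP.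
by rewrite cells2_cons dU IH // leb2_cell2 -EFinD -[(size s).+1%:R]nat1r mulrDl mul1r.
Qed.

Definition box2 (N : nat) : set (R * R) := `[- N%:R, N%:R[%classic `*` `[- N%:R, N%:R[%classic.

Lemma measurable_box2 N : measurable (box2 N).
Proof. by apply: measurableX; exact: measurable_itv. Qed.

Lemma leb2_box2 N : (lebm (box2 N) < +oo)%E.
Proof.
rewrite lebmX ?lebesgue_measure_itv //=; try exact: measurable_itv.
by case: ifP => _; rewrite ?mul0e ?mule0 // -!EFinD -EFinM ltry.
Qed.

Definition axis (N q : nat) : seq int := [seq (Posz i - Posz (N * 2 ^ q)%N)%R | i <- iota 0 (2 * N * 2 ^ q)].
Definition grid N q : seq (int * int) := [seq (i, j) | i <- axis N q, j <- axis N q].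
(** If F is [determined] at scale q, these squares lie in F, so their number measures the area of F
    in the box. *)
Definition hits F N q : seq (int * int) := [seq c <- grid N q | `[< exists2 z, F z & cidx q z = c >]].

Lemma axis_uniq N q : uniq (axis N q).
Proof. by rewrite map_inj_uniq ?iota_uniq // => i j /addIr []. Qed.

Lemma hits_uniq F N q : uniq (hits F N q).
Proof. by rewrite filter_uniq // allpairs_uniq ?axis_uniq // => -[a b] [c d]. Qed.

Lemma mem_axis N q x : (- (N%:R : R) <= x < N%:R) = (fidx q x \in axis N q).
Proof.
have p0 : 0 < (2 : R) ^+ q by rewrite exprn_gt0.
have E1 : (- N%:R <= x) = (- Posz (N * 2 ^ q) <= fidx q x).
  by rewrite fidx_ge rmorphN /= -pmulrn natrM natrX -mulNr mulrC ler_pM2l.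
have E2 : (x < N%:R) = (fidx q x < Posz (N * 2 ^ q)).
  by rewrite [RHS]ltNge fidx_ge -ltNge -pmulrn natrM natrX mulrC ltr_pM2r.
rewrite E1 E2; apply/idP/mapP => [h|[ j ]].
  exists (absz (fidx q x + Posz (N * 2 ^ q)%N)%R); last by move: h; lia.
  by rewrite mem_iota add0n; move: h; lia.
by rewrite mem_iota add0n => h ->; move: h; lia.
Qed.

Lemma mem_grid N q z : box2 N z <-> cidx q z \in grid N q.
Proof.
rewrite /box2 /= !in_itv /= !(mem_axis _ q); split.
  by case=> h1 h2; apply/allpairsP; exists (fidx q z.1, fidx q z.2).
by case/allpairsP => -[a b] /= [h1 h2 [-> ->]].
Qed.

Lemma hits_in F N q z : F z -> box2 N z -> cidx q z \in hits F N q.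
Proof.
move=> Fz /(mem_grid _ q) bz; rewrite mem_filter bz andbT.
by apply/asboolP; exists z.
Qed.

Lemma hits_vol F N q : measurable F -> determined q F ->
  (((size (hits F N q))%:R / 4 ^+ q)%:E <= lebm (F `&` box2 N))%E.
Proof.
move=> mF D; rewrite -leb2_cells2 ?hits_uniq //; apply: le_measure; rewrite ?inE.
- exact: measurable_cells2.
- by apply: measurableI => //; exact: measurable_box2.
move=> z; rewrite /cells2 /= mem_filter => /andP[/asboolP[z' Fz' cz] gz]; split.
  exact: D cz Fz'.
exact/(mem_grid _ q).
Qed.


Lemma fidx_close q (x x' : R) : `|x - x'| <= 2 ^- q -> (`|fidx q x - fidx q x'| <= 1)%R.
Proof.
have p0 : 0 < (2 : R) ^+ q by rewrite exprn_gt0.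
rewrite ler_norml => /andP[/(ler_wpM2l (ltW p0)) + /(ler_wpM2l (ltW p0))].
rewrite mulrN mulfV ?gt_eqF // mulrBr => h1 h2.
have /andP[a1 a2] := fidx_itv q x; have /andP[b1 b2] := fidx_itv q x'.
have g1 : (fidx q x < fidx q x' + 2)%R by rewrite -(ltr_int R) intrD; lra.
have g2 : (fidx q x' < fidx q x + 2)%R by rewrite -(ltr_int R) intrD; lra.
by move: g1 g2; lia.
Qed.

Lemma fidx_same q (x x' : R) : fidx q x = fidx q x' -> `|x - x'| <= 2 ^- q.
Proof.
have p0 : 0 < (2 : R) ^+ q by rewrite exprn_gt0.
move=> e; have /andP[a1 a2] := fidx_itv q x; have /andP[b1 b2] := fidx_itv q x'.
rewrite -e in b1 b2; rewrite -(ler_pM2l p0) mulfV ?gt_eqF //.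
rewrite -[X in X * `|_|](gtr0_norm p0) -normrM mulrBr ler_norml; apply/andP; split; lra.
Qed.

Lemma fidx_sub m q (x : R) : (m <= q)%N ->
  exists2 r, (r < 2 ^ (q - m))%N & fidx q x = (fidx m x * Posz (2 ^ (q - m))%N + Posz r)%R.
Proof.
move=> mq; set D := (2 ^ (q - m))%N.
have D0 : 0 < (D%:R : R) by rewrite ltr0n expn_gt0.
have E : 2 ^+ q * x = 2 ^+ m * x * D%:R by rewrite natrX mulrAC -exprD subnKC.
have /andP[a1 a2] := fidx_itv m x; have /andP[b1 b2] := fidx_itv q x.
have h1 : (fidx m x * Posz D <= fidx q x)%R by rewrite fidx_ge E intrM -pmulrn ler_pM2r.
have h2 : (fidx q x < (fidx m x + 1) * Posz D)%R.
  rewrite -(ltr_int R); apply: (le_lt_trans b1).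
  by rewrite E intrM intrD -pmulrn ltr_pM2r.
exists (absz (fidx q x - fidx m x * Posz D)%R); move: h1 h2; rewrite mulrDl mul1r.
  move: (fidx m x * Posz D)%R => w; lia.
move: (fidx m x * Posz D)%R => w; lia.
Qed.

Definition shifts : seq (int * int) := [seq (a, b) | a <- [:: -1; 0; 1], b <- [:: -1; 0; 1]].
Definition nbr (s : seq (int * int)) : seq (int * int) :=
  [seq (c.1 + d.1, c.2 + d.2)%R | c <- s, d <- shifts].

Lemma size_nbr s : size (nbr s) = (size s * 9)%N.
Proof. by rewrite size_allpairs. Qed.

Lemma in_nbr q s z z' : cidx q z \in s -> `|z.1 - z'.1| <= 2 ^- q -> `|z.2 - z'.2| <= 2 ^- q ->
  cidx q z' \in nbr s.
Proof.
move=> zs /fidx_close h1 /fidx_close h2; apply/allpairsP.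
exists (cidx q z, (fidx q z'.1 - fidx q z.1, fidx q z'.2 - fidx q z.2)%R); split => //=; last first.
  by rewrite !cidxE ![(_ + (_ - _))%R]addrC !subrK.
apply/allpairsP; exists (fidx q z'.1 - fidx q z.1, fidx q z'.2 - fidx q z.2)%R; split => //=.
  by rewrite !inE; move: h1; move: (fidx q z.1) (fidx q z'.1); lia.
by rewrite !inE; move: h2; move: (fidx q z.2) (fidx q z'.2); lia.
Qed.

Definition subs m q (s : seq (int * int)) : seq (int * int) :=
  [seq (c.1 * Posz (2 ^ (q - m))%N + Posz r.1, c.2 * Posz (2 ^ (q - m))%N + Posz r.2)%R
     | c <- s, r <- [seq (i, j) | i <- iota 0 (2 ^ (q - m)), j <- iota 0 (2 ^ (q - m))]].

Lemma size_subs m q s : size (subs m q s) = (size s * (2 ^ (q - m) * 2 ^ (q - m)))%N.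
Proof. by rewrite !size_allpairs size_iota. Qed.

Lemma in_subs m q s z : (m <= q)%N -> cidx m z \in s -> cidx q z \in subs m q s.
Proof.
move=> mq zs; have [r1 h1 e1] := fidx_sub z.1 mq; have [r2 h2 e2] := fidx_sub z.2 mq.
apply/allpairsP; exists (cidx m z, (r1, r2)); split => //=; last by rewrite cidxE e1 e2.
by apply/allpairsP; exists (r1, r2); split => //=; rewrite mem_iota add0n.
Qed.

Lemma box2_exhaust (z : R * R) : exists N, box2 N z.
Proof.
exists (Num.bound (`|z.1| + `|z.2|)).
have h1 : `|z.1| + `|z.2| < (Num.bound (`|z.1| + `|z.2|))%:R by rewrite archi_boundP // addr_ge0.
have := normr_ge0 z.1; have := normr_ge0 z.2.
have := ler_norm z.1; have := ler_norm z.2; have := ler_norm (- z.1); have := ler_norm (- z.2).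
by rewrite !normrN => *; split; rewrite /= in_itv /=; apply/andP; split; lra.
Qed.

Lemma box2_tight (mu : {measure set (R * R) -> \bar R}) (d : R) : (mu setT < +oo)%E -> 0 < d ->
  exists N, (mu (~` box2 N) <= d%:E)%E.
Proof.
move=> muT d0; have [N hN] := tail_small muT measurable_box2 d0; exists N.
apply: le_trans hN; apply: le_measure; rewrite ?inE.
- by apply: measurableC; exact: measurable_box2.
- apply: measurableD; first by apply: bigcupT_measurable; exact: measurable_box2.
  by apply: bigsetU_measurable => i _; exact: measurable_box2.
move=> z nz; split.
  by have [n1 h1] := box2_exhaust z; exists n1.
move: nz; apply: contra_not; elim: N => [|N IH]; first by rewrite big_ord0.
have mono : box2 N `<=` box2 N.+1.
  move=> y; rewrite /box2 /= !in_itv /= -natr1 => -[/andP[a1 a2] /andP[a3 a4]].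
  by split; apply/andP; split; lra.
by rewrite big_ord_recr /= => -[/IH|]; exact: mono.
Qed.

End Counting.

(** * Absolute continuity *)

Section Pushforward.
Variable R : realType.

Definition toC (z : R * R) : R[i] := Complex z.1 z.2.
Definition toP (z : R[i]) : R * R := (complex.Re z, complex.Im z).

Lemma toCD z w : toC (Defs.cadd z w) = toC z + toC w.
Proof. by []. Qed.

Lemma toCM z w : toC (cmul z w) = toC z * toC w.
Proof. by []. Qed.

Lemma toCK : cancel toC toP.
Proof. by case. Qed.

Lemma nm_toC_le z : nm (toC z) <= `|z.1| + `|z.2|.
Proof. exact: nm_cpx. Qed.

Lemma toP_close (z w : R[i]) (d : R) : nm (z - w) <= d ->
  `|(toP z).1 - (toP w).1| <= d /\ `|(toP z).2 - (toP w).2| <= d.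
Proof. by move=> h; split; [move: (nm_Re (z - w)) | move: (nm_Im (z - w))]; case: z w h => ? ? [? ?] h /le_trans; apply. Qed.

Variables (k : nat) (lam t : 'I_k -> R * R).

Fixpoint word_map (u : seq 'I_k) (z : R * R) : R * R :=
  if u is i :: u' then simil (lam i) (t i) (word_map u' z) else z.

Local Notation lamC := (fun i => toC (lam i)).
Local Notation tC := (fun i => toC (t i)).

Lemma word_map_toC u z : toC (word_map u z) = jet tC lamC u 0 + lamw lamC u * toC z.
Proof.
elim: u => [|i u IH] /=; first by rewrite /lamw big_nil mul1r add0r.
rewrite /simil toCD toCM IH /lamw big_cons addr0 mul1r; ring.
Qed.

Lemma measurable_simil l s : measurable_fun setT (@simil R l s).
Proof.
have m1 : measurable_fun setT (fst : R * R -> R) by exact: measurable_fst.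
have m2 : measurable_fun setT (snd : R * R -> R) by exact: measurable_snd.
apply: measurable_fun_pair => /=.
  apply: measurable_funD; last exact: measurable_cst.
  by apply: measurable_funB; apply: measurable_funM => //; exact: measurable_cst.
apply: measurable_funD; last exact: measurable_cst.
by apply: measurable_funD; apply: measurable_funM => //; exact: measurable_cst.
Qed.

Lemma measurable_preimage_simil l s A : measurable A -> measurable (@simil R l s @^-1` A).
Proof. by move=> mA; rewrite -[_ @^-1` _]setTI; exact: measurable_simil. Qed.

Lemma measurable_preimage_word_map u A : measurable A -> measurable (word_map u @^-1` A).
Proof.
elim: u A => [//|i u IH] A mA; have := IH _ (measurable_preimage_simil (lam i) (t i) mA); exact.
Qed.

Variables (p : 'I_k -> R) (nu : probability (R * R)%type R).
Hypothesis ss : self_similar lam t p nu.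
Hypothesis p_gt0 : forall i, 0 < p i.
Hypothesis p_sum : \sum_(i < k) p i = 1.
Local Notation E := (Ew p).

Definition nu_mass (A : set (R * R)) : R := fine (nu A).

Lemma nu_massE A : measurable A -> nu A = (nu_mass A)%:E.
Proof. by move=> mA; rewrite fineK // fin_num_measure. Qed.

Lemma nu_mass_le1 A : measurable A -> nu_mass A <= 1.
Proof. by move=> mA; rewrite -lee_fin -nu_massE // probability_le1. Qed.

Lemma nu_mass_ge0 A : 0 <= nu_mass A.
Proof. exact: fine_ge0. Qed.

Lemma nu_mass_le A B : measurable A -> measurable B -> A `<=` B -> nu_mass A <= nu_mass B.
Proof. by move=> mA mB AB; rewrite -lee_fin -!nu_massE //; apply: le_measure; rewrite ?inE. Qed.

Lemma nu_mass_step A : measurable A -> nu_mass A = \sum_(i < k) p i * nu_mass (simil (lam i) (t i) @^-1` A).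
Proof.
move=> mA; apply: EFin_inj; rewrite -nu_massE // ss // -sumEFin; apply: eq_bigr => i _.
by rewrite EFinM -nu_massE //; exact: measurable_preimage_simil.
Qed.

Lemma nu_mass_words L A : measurable A -> nu_mass A = E L (fun u => nu_mass (word_map u @^-1` A)).
Proof.
elim: L A => [//|L IH] A mA; rewrite nu_mass_step //=; apply: eq_bigr => i _.
by rewrite IH //; exact: measurable_preimage_simil.
Qed.


Lemma expN_small (c x : R) : 0 < c -> 0 < x -> exists n1 : nat, forall n, (n1 <= n)%N -> expR (- (c * n%:R)) <= x.
Proof.
move=> c0 x0; exists (Num.bound (x^-1 / c)) => n nn.
have h : x^-1 <= c * n%:R.
  rewrite [X in _ <= X]mulrC -ler_pdivrMr //; apply: le_trans (_ : (Num.bound (x^-1 / c))%:R <= _).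
    by apply/ltW/archi_boundP; rewrite divr_ge0 // ?invr_ge0 ltW.
  by rewrite ler_nat.
rewrite expRN -[x]invrK lef_pV2 ?posrE ?expR_gt0 ?invr_gt0 //.
by apply: (le_trans h); have := expR_ge1Dx (c * n%:R); lra.
Qed.

Section Density.
Variables (chi : 'I_k -> R) (eps rho : R).
Local Notation Chi := (\sum_(i < k) p i * chi i).
Local Notation H := (- \sum_(i < k) p i * ln (p i)).
Local Notation typ := (typ p chi Chi H eps).
Hypothesis eps0 : 0 < eps.
Hypothesis epsChi : 4 * eps < 2 * Chi.
Hypothesis B : inB chi eps rho lamC.
Hypothesis good : forall K : nat, exists M : nat, forall n1, exists2 n, (n1 <= n)%N &
  PhiF p tC chi Chi H eps lamC 1 (2 * n) K%:R (expR (- Chi * n%:R)) <= M%:R * expR (- (2 * Chi * n%:R)).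

Local Notation pi u := (toP (jet tC lamC u 0)).

(* Summing a <= a^2 / (2 T) + T / 2 over the cells of D bounds the mass by the correlation energy. *)
Lemma energy_bound K L q r (D : seq (int * int)) (T : R) : uniq D -> 0 < T -> 2 * 2 ^- q <= r ->
  E L (fun u => (typ K u && (cidx q (pi u) \in D))%:R) <=
    PhiF p tC chi Chi H eps lamC 1 L K r / (2 * T) + (size D)%:R * T / 2.
Proof.
move=> uD T0 qr.
pose a d := E L (fun u => (typ K u && (cidx q (pi u) == d))%:R).
apply: le_trans (_ : \sum_(d <- D) a d <= _).
  rewrite /a -Ew_sum; apply: (Ew_le p_gt0) => u _.
  case: (typ K u) => /=; last by rewrite sumr_ge0.
  case D0 : (_ \in D); last by rewrite sumr_ge0.
  by rewrite (bigD1_seq _ D0 uD) /= eqxx lerDl sumr_ge0.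
apply: le_trans (_ : \sum_(d <- D) (a d ^+ 2 / (2 * T) + T / 2) <= _).
  apply: ler_sum => d _.
  have := sqr_ge0 (a d - T); rewrite sqrrB => h.
  have -> : a d ^+ 2 / (2 * T) + T / 2 = (a d ^+ 2 + T ^+ 2) / (2 * T) by field; rewrite gt_eqF.
  rewrite ler_pdivlMr ?mulr_gt0 //.
  have : a d * (2 * T) = (a d * T) *+ 2 by ring.
  lra.
rewrite big_split /= big_const_seq count_predT iter_addr_0 -mulr_suml; apply: lerD; last first.
  by rewrite -[_ *+ _]mulr_natl mulrA.
apply: ler_wpM2r; first by rewrite invr_ge0 mulr_ge0 // ltW.
apply: le_trans (_ : \sum_(d <- D) E L (fun u => E L (fun v =>
   (typ K u && (cidx q (pi u) == d))%:R * (typ K v && (cidx q (pi v) == d))%:R)) <= _).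
  apply: ler_sum => d _; rewrite /a expr2 -EwZ le_eqVlt; apply/orP; left; apply/eqP.
  by apply: Ew_ext => u _; rewrite EwZ mulrC.
rewrite -Ew_sum; apply: (Ew_le p_gt0) => u _; rewrite -Ew_sum; apply: (Ew_le p_gt0) => v _.
have [e|ne] := eqVneq (cidx q (pi u)) (cidx q (pi v)); last first.
  rewrite big1 // => d _; case: eqP => [<-|_]; last by rewrite andbF mul0r.
  by rewrite [_ == cidx q (pi u)]eq_sym (negbTE ne) andbF mulr0.
case tu : (typ K u) => /=; last by rewrite big1 // => d _; rewrite mul0r.
case tv : (typ K v) => /=; last by rewrite big1 // => d _; rewrite mulr0.
have -> : small tC lamC r 1 u v.
  apply/smallP => l; rewrite ltnS leqn0 => /eqP ->.
  have [e1 e2] := e; have h1 := fidx_same e1; have h2 := fidx_same e2.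
  apply: le_trans qr; move: h1 h2; case: (jet _ _ u 0) => a1 b1; case: (jet _ _ v 0) => a2 b2 /= h1 h2.
  by apply: le_trans (nm_cpx (a1 - a2) (b1 - b2)) _; lra.
have [cD|cD] := boolP (cidx q (pi u) \in D).
  rewrite (bigD1_seq _ cD uD) /= -e eqxx mulr1 big1 ?addr0 // => d.
  by rewrite eq_sym => /negbTE ->; rewrite mul0r.
rewrite big_seq big1 // => d dD; case: eqP => [h|_]; last by rewrite mul0r.
by move: cD; rewrite h dD.
Qed.

(** The point is that C is independent of N, q and F. The three d stand for untypical words, for the
    mass of nu outside the box of size n0 and for the energy. F lives at scale q; the energy bound
    is used at a finer scale m fitted to a radius r = exp (- Chi n). *)
Lemma box_bound (d : R) : 0 < d -> exists2 C, 0 <= C & forall N q F, measurable F -> determined q F ->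
  nu_mass (F `&` box2 N) <= 3 * d + C * ((size (hits F N q))%:R / 4 ^+ q).
Proof.
move=> d0.
have [K HK] := typ_mass p_gt0 p_sum chi eps0 d0.
have nuT : (nu setT < +oo)%E by rewrite probability_setT ltry.
have [n0 Hn0] := box2_tight nuT d0.
have {}Hn0 : nu_mass (~` box2 n0) <= d.
  by rewrite -lee_fin -nu_massE //; apply: measurableC; exact: measurable_box2.
have [M HM] := good K.
(* The energy term is at most M r^2 / (2 T) with r^2 <= 16 / 4^m and T = tau / 4^m, that is 8 M /
   tau <= d; the 1 keeps tau positive when M = 0. *)
pose tau : R := (8 * M%:R + 1) / d.
have tau0 : 0 < tau by rewrite divr_gt0 // ltr_wpDl // mulr_ge0.
(* Each hit square has 9 neighbours, itself included, with 4^(m - q) subsquares each, of weight T /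
   2. *)
exists (9 / 2 * tau); first by rewrite mulr_ge0 // ?ltW //; lra.
move=> N q F mF DF; set J := size (hits F N q).
have Chi0 : 0 < Chi by have := epsChi; have := eps0; lra.
have q0 : 0 < (2 : R) ^- q by rewrite invr_gt0 exprn_gt0.
pose V : R := 2 * n0%:R + 1.
have V0 : 0 < V by rewrite ltr_wpDl // mulr_ge0.
have [n1 Hn1] := expN_small Chi0 q0.
have c20 : 0 < 2 * Chi - 4 * eps by have := epsChi; lra.
have [n2 Hn2] := expN_small c20 (divr_gt0 q0 (mulr_gt0 V0 (expR_gt0 K%:R))).
have [n nn HPhi] := HM (maxn n1 n2).
have nn1 : (n1 <= n)%N by apply: leq_trans nn; rewrite leq_maxl.
have nn2 : (n2 <= n)%N by apply: leq_trans nn; rewrite leq_maxr.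
set r := expR (- Chi * n%:R) in HPhi.
have r0 : 0 < r by rewrite expR_gt0.
have rq : r <= 2 ^- q by have := Hn1 n nn1; rewrite /r mulNr.
have r1 : r / 2 <= 1.
  have : (2 : R) ^- q <= 1 by rewrite invf_le1 ?exprn_gt0 // exprn_ege1 // ler1n.
  by lra.
have [m /andP[m1 m2]] := dyadic_scale (divr_gt0 r0 (ltr0Sn R 1)) r1.
have m0 : 0 < (2 : R) ^- m by rewrite invr_gt0 exprn_gt0.
have qm : (q <= m)%N.
  have : (2 : R) ^- m <= 2 ^- q by lra.
  by rewrite lef_pV2 ?posrE ?exprn_gt0 // ler_eXn2l // ltr1n.
pose s1 := nbr (hits F N q); pose D := undup (subs q m s1).
pose T : R := tau / 4 ^+ m.
have T0 : 0 < T by rewrite divr_gt0 // exprn_gt0.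
have qr : 2 * 2 ^- m <= r by lra.
have W1 := energy_bound K%:R (2 * n) (undup_uniq (subs q m s1)) T0 qr.
rewrite -/D in W1.
have W : E (2 * n) (fun u => (typ K%:R u && (cidx q (pi u) \in s1))%:R) <= d + 9 / 2 * tau * (J%:R / 4 ^+ q).
  apply: le_trans (_ : E (2 * n) (fun u => (typ K%:R u && (cidx m (pi u) \in D))%:R) <= _).
    apply: (Ew_le p_gt0) => u _; case: (typ _ u) => //=; case c : (_ \in s1) => //.
    by rewrite /D mem_undup (in_subs qm c).
  apply: (le_trans W1); apply: lerD.
    have T2 : 0 < 2 * T by apply: mulr_gt0.
    rewrite ler_pdivrMr //; apply: (le_trans HPhi).
    have -> : expR (- (2 * Chi * n%:R)) = r ^+ 2.
      by rewrite /r -expRM_natl; congr expR; ring.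
    have r4 : r ^+ 2 <= 16 / 4 ^+ m.
      have -> : 16 / 4 ^+ m = (4 * 2 ^- m) ^+ 2 :> R.
        have -> : (4 : R) ^+ m = (2 ^+ m) ^+ 2 by rewrite -exprM mulnC exprM; congr (_ ^+ _); ring.
        by field; rewrite expf_neq0.
      by rewrite lerXn2r ?nnegrE ?(ltW r0) //; lra.
    apply: le_trans (ler_wpM2l (ler0n R M) r4) _.
    have -> : d * (2 * T) = (d * tau) * (2 / 4 ^+ m) by rewrite /T; ring.
    have -> : d * tau = 8 * M%:R + 1 by rewrite /tau mulrC divfK // gt_eqF.
    have : 0 <= (4 : R) ^- m by rewrite invr_ge0 exprn_ge0.
    lra.
  have sD : (size D <= J * 9 * (2 ^ (m - q) * 2 ^ (m - q)))%N.
    by apply: leq_trans (size_undup _) _; rewrite size_subs size_nbr.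
  apply: le_trans (_ : (J * 9 * (2 ^ (m - q) * 2 ^ (m - q)))%N%:R * T / 2 <= _).
    by rewrite !ler_wpM2r ?(ltW T0) // ler_nat.
  rewrite !natrM natrX /T le_eqVlt; apply/orP; left; apply/eqP.
  have -> : (4 : R) ^+ m = 4 ^+ q * (2 ^+ (m - q) * 2 ^+ (m - q)).
    rewrite -exprMn; have -> : 2 * 2 = 4 :> R by ring.
    by rewrite -exprD subnKC.
  have x0 : (2 : R) ^+ (m - q) != 0 by rewrite expf_neq0.
  have y0 : (4 : R) ^+ q != 0 by rewrite expf_neq0 // pnatr_eq0.
  move: x0 y0; move: ((2 : R) ^+ (m - q)) ((4 : R) ^+ q) => x y x0 y0; field.
  by rewrite x0 y0.
have mFB : measurable (F `&` box2 N) by apply: measurableI => //; exact: measurable_box2.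
rewrite (nu_mass_words (2 * n) mFB).
apply: le_trans (_ : E (2 * n) (fun u => (1 - (typ K%:R u)%:R) + (d + (typ K%:R u && (cidx q (pi u) \in s1))%:R)) <= _).
  apply: (Ew_le p_gt0) => u su.
  have mg := measurable_preimage_word_map u mFB.
  case tu : (typ K%:R u) => /=; last first.
    by rewrite subr0; apply: le_trans (nu_mass_le1 mg) _; lra.
  rewrite subrr add0r; case c : (_ \in s1) => /=.
    by apply: le_trans (nu_mass_le1 mg) _; lra.
  rewrite addr0; apply: le_trans Hn0; apply: nu_mass_le => //; first by apply: measurableC; exact: measurable_box2.
  move=> z [Fz bz] zb; move/negP: c; apply.
  (* The image of z differs from the coded point by [lamw] times z, at most 2^-q for z in the box,
     so the coded point lies in a neighbour of a hit square. *)
  have close : nm (toC (word_map u z) - jet tC lamC u 0) <= 2 ^- q.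
    rewrite word_map_toC addrAC subrr add0r nmM.
    have /andP[_ lu] := lamw_typ B tu; rewrite su in lu.
    have nz : nm (toC z) <= V.
      apply: le_trans (nm_toC_le z) _; move: zb; rewrite /box2 /= !in_itv /= => -[/andP[b1 b2] /andP[b3 b4]].
      have : `|z.1| <= n0%:R by rewrite ler_norml b1 ltW.
      have : `|z.2| <= n0%:R by rewrite ler_norml b3 ltW.
      by rewrite /V; lra.
    apply: le_trans (ler_pM (nm_ge0 _) (nm_ge0 _) lu nz) _.
    have := Hn2 n nn2; rewrite ler_pdivlMr ?mulr_gt0 ?expR_gt0 // => h.
    apply: le_trans h; rewrite [V * _]mulrC mulrA; apply: ler_wpM2r; first exact: ltW.
    rewrite -expRD ler_expR natrM; lra.
  have [e1 e2] := toP_close close; rewrite toCK in e1 e2.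
  by apply: in_nbr (hits_in q Fz bz) e1 e2.
rewrite EwD EwD (Ew_cst p_sum).
have : E (2 * n) (fun u => 1 - (typ K%:R u)%:R) <= d.
  have h := EwD p (2 * n) (fun u => 1 - (typ K%:R u)%:R) (fun u => (typ K%:R u)%:R).
  have e1 : E (2 * n) (fun u => 1 - (typ K%:R u)%:R + (typ K%:R u)%:R) = 1.
    by rewrite -[RHS](Ew_cst p_sum (2 * n) 1); apply: Ew_ext => u _; rewrite subrK.
  by rewrite e1 in h; have := HK (2 * n)%N; lra.
by move: W; lra.
Qed.

(** A null set A is approximated by a dyadic F for nu and Lebesgue measure at once, through their
    sum; restricting Lebesgue measure to a box makes the sum finite. F then has small area in the
    box, and [box_bound] gives small nu-mass. *)
Lemma self_similar_ac : nu `<< @leb2 R.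
Proof.
have nuT : (nu setT < +oo)%E by rewrite probability_setT ltry.
have inbox N A : measurable A -> @lebm R A = 0%E -> nu (A `&` box2 N) = 0%E.
  move=> mA A0; have mb := @measurable_box2 R N.
  have mAb : measurable (A `&` box2 N) by exact: measurableI.
  pose mu : {measure set (R * R) -> \bar R} := measure_add nu (mrestr (@lebm R) mb).
  have muE X : mu X = (nu X + @lebm R (X `&` box2 N))%E by exact: measure_addE.
  have muT : (mu setT < +oo)%E by rewrite muE setTI lte_add_pinfty // leb2_box2.
  suff main : forall d : R, 0 < d -> nu_mass (A `&` box2 N) <= 4 * d.
    rewrite nu_massE //; congr (_%:E); apply: le_anti; rewrite nu_mass_ge0 andbT.
    rewrite leNgt; apply/negP => h; have := main _ (divr_gt0 h (ltr0Sn R 7)); lra.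
  move=> d d0; have [C C0 HC] := box_bound d0.
  have e0 : 0 < d / (C + 1) by rewrite divr_gt0 // ltr_wpDl.
  have eC : C * (d / (C + 1)) + d / (C + 1) = d by field; rewrite gt_eqF // ltr_wpDl.
  have [q [F [mF DF hF]]] := (approx_measurable muT mA).2 _ e0.
  have mD : measurable ((A `\` F) `|` (F `\` A)) by apply: measurableU; apply: measurableD.
  rewrite muE in hF.
  have h1 : nu_mass ((A `\` F) `|` (F `\` A)) <= d / (C + 1).
    rewrite -lee_fin -nu_massE //; apply: le_trans hF; rewrite leeDl //.
  have mFb : measurable (F `&` box2 N) by exact: measurableI.
  have h2 : (@lebm R (F `&` box2 N) <= (d / (C + 1))%:E)%E.
    apply: le_trans (_ : @lebm R (((A `\` F) `|` (F `\` A)) `&` box2 N) <= _)%E; last first.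
      by apply: le_trans hF; rewrite leeDr.
    apply: le_trans (_ : @lebm R (A `|` ((A `\` F `|` F `\` A) `&` box2 N)) <= _)%E; last first.
      apply: le_trans (_ : @lebm R A + @lebm R ((A `\` F `|` F `\` A) `&` box2 N) <= _)%E.
        by apply: measureU2 => //; exact: measurableI.
      by rewrite A0 add0e.
    apply: le_measure; rewrite ?inE //; first by apply: measurableU => //; exact: measurableI.
    move=> z [Fz bz]; have [Az|nA] := pselect (A z); first by left.
    by right; split => //; right.
  have h3 := HC N q F mF DF.
  have h4 : (size (hits F N q))%:R / 4 ^+ q <= d / (C + 1).
    by rewrite -lee_fin; apply: le_trans h2; exact: hits_vol.
  have h5 : nu_mass (A `&` box2 N) <= nu_mass (F `&` box2 N) + nu_mass ((A `\` F) `|` (F `\` A)).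
    rewrite -lee_fin EFinD -!nu_massE //; apply: le_trans (measureU2 _ _ _) => //.
    apply: le_measure; rewrite ?inE //; first exact: measurableU.
    move=> z [Az bz]; have [Fz|nF] := pselect (F z); first by left.
    by right; left.
  have := ler_wpM2l C0 h4; lra.
apply/(null_content_dominatesP nu (@lebm R)) => A mA A0.
have mAb N : measurable (A `&` @box2 R N) by apply: measurableI => //; exact: measurable_box2.
have AE : A `<=` \bigcup_N (A `&` box2 N) by move=> z Az; have [N bz] := box2_exhaust z; exists N.
apply/eqP; rewrite -measure_le0; apply: le_trans (measure_sigma_subadditive nu mAb mA AE) _.
by rewrite eseries0 // => N _ _; exact: inbox.
Qed.

End Density.
End Pushforward.

(** * Null sets of parameters *)

Section Null.
Variables (R : realType) (k : nat).
Hypothesis k0 : (0 < k)%N.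
Local Notation V := ('I_k -> R * R).
Implicit Types E : set V.

Lemma leb_null_sub E E' : E `<=` E' -> leb_null E' -> leb_null E.
Proof. by move=> EE h e /h[a [b [ab [c v]]]]; exists a, b; split => //; split => // x /EE/c. Qed.

Lemma box_vol_ge0 (a b : V) : (forall i, (a i).1 <= (b i).1 /\ (a i).2 <= (b i).2) -> 0 <= box_vol a b.
Proof. by move=> h; apply: prodr_ge0 => i _; have [h1 h2] := h i; rewrite mulr_ge0 // subr_ge0. Qed.

Lemma sum_pairs (v : nat * nat -> R) N : (forall x, 0 <= v x) -> exists I, 
  \sum_(n < N) (if @pickle_inv (nat * nat)%type n is Some x then v x else 0) <=
  \sum_(i < I) \sum_(j < I) v (nat_of_ord i, nat_of_ord j).
Proof.
move=> v0.
have [I HI] : exists I, forall n x, (n < N)%N -> @pickle_inv (nat * nat)%type n = Some x -> (x.1 < I)%N /\ (x.2 < I)%N.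
  elim: N => [|N [I HI]]; first by exists 0%N.
  case e : (@pickle_inv (nat * nat)%type N) => [x|]; last first.
    exists I => n x; rewrite ltnS leq_eqVlt => /orP[/eqP ->|]; first by rewrite e.
    exact: HI.
  exists (I + x.1.+1 + x.2.+1)%N => n x'; rewrite ltnS leq_eqVlt => /orP[/eqP ->|nN h].
    by rewrite e => -[<-]; split; lia.
  by have := HI n x' nN h; lia.
exists I.
apply: le_trans (_ : \sum_(n < N) \sum_(i < I) \sum_(j < I)
    (pickle (nat_of_ord i, nat_of_ord j) == n)%:R * v (nat_of_ord i, nat_of_ord j) <= _).
  apply: ler_sum => n _; case e : (pickle_inv _) => [[i j]|]; last first.
    by apply: sumr_ge0 => i _; apply: sumr_ge0 => j _; rewrite mulr_ge0.
  have [/= iI jI] := HI n _ (ltn_ord n) e.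
  rewrite (bigD1 (Ordinal iI)) //= (bigD1 (Ordinal jI)) //=.
  have -> : pickle (i, j) == n by have := @pickle_invK (nat * nat)%type n; rewrite e /= => ->.
  rewrite mul1r -addrA lerDl addr_ge0 // sumr_ge0 // => i' _; rewrite ?mulr_ge0 //.
  by apply: sumr_ge0 => j' _; rewrite mulr_ge0.
rewrite exchange_big /=; apply: ler_sum => i _; rewrite exchange_big /=; apply: ler_sum => j _.
rewrite -mulr_suml ler_piMl // -(natr_sum R) lern1.
have [h|h] := ltnP (pickle (nat_of_ord i, nat_of_ord j)) N.
  rewrite (bigD1 (Ordinal h)) //= eqxx big1 // => n /negP ne; apply/eqP; rewrite eqb0.
  by apply/negP => /eqP e; apply: ne; apply/eqP/val_inj.
by rewrite big1 // => n _; apply/eqP; rewrite eqb0 gtn_eqF // (leq_trans (ltn_ord n)).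
Qed.

(** Pairs of indices are listed by their code. Numbers that code no pair receive a degenerate box,
    of volume 0 because k > 0. *)
Lemma leb_null_family E : (forall eps : R, 0 < eps -> exists a b : nat -> nat -> V,
    (forall m j i, (a m j i).1 <= (b m j i).1 /\ (a m j i).2 <= (b m j i).2) /\
    (forall x, E x -> exists m j, in_box (a m j) (b m j) x) /\
    forall I J, \sum_(m < I) \sum_(j < J) box_vol (a m j) (b m j) <= eps) -> leb_null E.
Proof.
move=> H eps e0; have [a [b [ab [cov vol]]]] := H eps e0.
pose z : V := fun=> (0, 0).
pose f (c : nat -> nat -> V) n := if @pickle_inv (nat * nat)%type n is Some x then c x.1 x.2 else z.
exists (f a), (f b); split.
  by move=> n i; rewrite /f; case: (pickle_inv _).
split.
  move=> x /cov[m [j h]]; exists (pickle (m, j)) => //=.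
  by rewrite /f pickleK_inv.
move=> N; have [|I hI] := @sum_pairs (fun x => box_vol (a x.1 x.2) (b x.1 x.2)) N.
  by move=> x; apply: box_vol_ge0.
apply: le_trans (vol I I); apply: le_trans hI; apply: ler_sum => n _.
rewrite /f; case: (pickle_inv _) => //.
by rewrite /box_vol (bigD1 (Ordinal k0)) //= subrr mul0r mul0r.
Qed.

Lemma leb_null_bigcup (F : nat -> set V) : (forall n, leb_null (F n)) -> leb_null (\bigcup_n F n).
Proof.
move=> H; apply: leb_null_family => eps e0.
have p0 n : 0 < eps * 2 ^- n.+1 by rewrite mulr_gt0 // invr_gt0 exprn_gt0.
have ex n : exists ab : (nat -> V) * (nat -> V),
    (forall j i, (ab.1 j i).1 <= (ab.2 j i).1 /\ (ab.1 j i).2 <= (ab.2 j i).2) /\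
    (F n `<=` \bigcup_j [set x | in_box (ab.1 j) (ab.2 j) x]) /\
    (forall N, \sum_(j < N) box_vol (ab.1 j) (ab.2 j) <= eps * 2 ^- n.+1).
  by have [a [b h]] := H n _ (p0 n); exists (a, b).
have [g hg] := choice ex.
exists (fun n => (g n).1), (fun n => (g n).2); split; first by move=> m; exact: (hg m).1.
split; first by move=> x [m _ /((hg m).2.1)[j _ h]]; exists m, j.
move=> I J; apply: le_trans (_ : \sum_(m < I) eps * 2 ^- m.+1 <= _).
  by apply: ler_sum => m _; exact: (hg m).2.2.
by rewrite -mulr_sumr ler_piMr ?geo_sum // ltW.
Qed.

Lemma leb_null0 : @leb_null R k set0.
Proof.
apply: leb_null_family => eps e0; exists (fun _ _ _ => (0, 0)), (fun _ _ _ => (0, 0)).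
split => //; split => // I J; rewrite big1 ?ltW // => i _; rewrite big1 // => j _.
by rewrite /box_vol (bigD1 (Ordinal k0)) //= subrr mul0r mul0r.
Qed.

(* Dyadic cells form a countable basis. *)
Lemma leb_null_local E : (forall x, E x -> exists2 d : R, 0 < d &
    leb_null [set y | E y /\ forall i, `|(y i).1 - (x i).1| <= d /\ `|(y i).2 - (x i).2| <= d]) ->
  leb_null E.
Proof.
move=> H.
pose T := (nat * {ffun 'I_k -> int * int})%type.
pose C (c : T) := [set y | E y /\ forall i, cidx c.1 (y i) = c.2 i].
pose F n := if unpickle n is Some c then [set y | leb_null (C c) /\ C c y] else set0.
apply: (@leb_null_sub _ (\bigcup_n F n)); last first.
  apply: leb_null_bigcup => n; rewrite /F; case: (unpickle n) => [c|]; last exact: leb_null0.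
  have [h|h] := pselect (leb_null (C c)); first by apply: leb_null_sub h => y [].
  by apply: leb_null_sub leb_null0 => y [].
move=> x Ex; have [d d0 hd] := H x Ex.
have [q hq] := dyadic_small d0.
pose c : T := (q, [ffun i => cidx q (x i)]).
exists (pickle c) => //; rewrite /F pickleK; split; last by split => // i; rewrite ffunE.
apply: leb_null_sub hd => y [Ey hy]; split => // i.
have := hy i; rewrite ffunE => -[e1 e2].
by split; apply: le_trans (hq q (leqnn q)); exact: fidx_same.
Qed.

End Null.

Lemma sum_onth (R : realType) (T : Type) (f : T -> R) (s : seq T) J : (forall c, 0 <= f c) ->
  \sum_(j < J) (if onth s j is Some c then f c else 0) <= \sum_(c <- s) f c.
Proof.
move=> f0; elim: s J => [|c s IH] J.
  by rewrite big_nil big1 // => j _; rewrite onth0n.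
rewrite big_cons; case: J => [|J]; first by rewrite big_ord0 addr_ge0 // sumr_ge0.
by rewrite big_ord_recl /= lerD2l; exact: IH.
Qed.

Lemma pos_lower_bound (R : realType) (I : finType) (f : I -> R) : (forall i, 0 < f i) ->
  exists2 c, 0 < c & forall i, c <= f i.
Proof.
move=> f0; pose g i := 1 + (f i)^-1.
have g0 i : 0 < (f i)^-1 by rewrite invr_gt0.
have s0 : 0 <= \sum_i (f i)^-1 by apply: sumr_ge0 => i _; exact: ltW.
have S0 : 0 < 1 + \sum_i (f i)^-1 by lra.
exists (1 + \sum_i (f i)^-1)^-1; first by rewrite invr_gt0.
move=> i; rewrite -[f i]invrK lef_pV2 ?posrE //.
rewrite (bigD1 i) //=.
have : 0 <= \sum_(j | j != i) (f j)^-1 by apply: sumr_ge0 => j _; exact: ltW.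
by lra.
Qed.

Section Transfer.
Variables (R : realType) (kk : nat).
Variables (b : R) (a0 : R[i]) (ac : 'I_kk -> R[i]).
Hypotheses (b0 : 0 < b) (b4 : b <= 1 / 4).
Hypothesis a01 : nm a0 <= 1.
Hypothesis ac1 : forall j, nm (ac j) <= 1.
Local Notation lam := (lamY b a0 ac).
Local Notation pt := (pt R kk).
Local Notation V := ('I_kk.+1 -> R * R).

Definition fac (y : pt) (i : 'I_kk.+1) : R[i] := if unlift ord0 i is Some j then aY b ac y j else a0.
Definition fac0 (i : 'I_kk.+1) : R[i] := if unlift ord0 i is Some j then ac j else a0.

Lemma fac0_le i : nm (fac0 i) <= 1.
Proof. by rewrite /fac0; case: unlift. Qed.

Lemma fac_sub0 y i : inU y -> nm (fac y i - fac0 i) <= 2 * b.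
Proof.
move=> [_ U]; rewrite /fac /fac0; case: (unlift ord0 i) => [j|]; last first.
  by rewrite subrr nm0 mulr_ge0 // ltW.
rewrite /aY addrAC subrr add0r; apply: le_trans (nm_cpx _ _) _.
have [/andP[h1 h2] /andP[h3 h4]] := U j.
rewrite !normrM (gtr0_norm b0).
have k1 : `|2 * (y.2 j).1 - 1| <= 1 by rewrite ler_norml; apply/andP; split; lra.
have k2 : `|2 * (y.2 j).2 - 1| <= 1 by rewrite ler_norml; apply/andP; split; lra.
have := ler_wpM2l (ltW b0) k1; have := ler_wpM2l (ltW b0) k2; lra.
Qed.

Lemma zY_sub1 (y : pt) : inU y -> nm (zY b y - 1) <= 2 * b.
Proof.
move=> [[/andP[h1 h2] /andP[h3 h4]] _].
have -> : zY b y - 1 = cpx (b * (2 * y.1.1 - 1)) (b * (2 * y.1.2 - 1)).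
  by apply/eqP; rewrite eq_complex /=; apply/andP; split; apply/eqP; ring.
apply: le_trans (nm_cpx _ _) _; rewrite !normrM (gtr0_norm b0).
have k1 : `|2 * y.1.1 - 1| <= 1 by rewrite ler_norml; apply/andP; split; lra.
have k2 : `|2 * y.1.2 - 1| <= 1 by rewrite ler_norml; apply/andP; split; lra.
have := ler_wpM2l (ltW b0) k1; have := ler_wpM2l (ltW b0) k2; lra.
Qed.

Lemma fac_le y i : inU y -> nm (fac y i) <= 2.
Proof.
move=> U; have := nmD (fac y i - fac0 i) (fac0 i); rewrite subrK.
have := fac_sub0 i U; have := fac0_le i; have := b4; lra.
Qed.

Lemma lamY_center y i : inU y -> nm (lam y i - fac0 i) <= 6 * b.
Proof.
move=> U; have -> : lam y i - fac0 i = (zY b y - 1) * fac y i + (fac y i - fac0 i).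
  by rewrite /lamY -/(fac y i); ring.
apply: le_trans (nmD _ _) _; rewrite nmM.
have h : nm (zY b y - 1) * nm (fac y i) <= 2 * b * 2.
  by apply: ler_pM; rewrite ?nm_ge0 // ?zY_sub1 // fac_le.
have := fac_sub0 i U; lra.
Qed.

Lemma lamY_lip y y' i d : inU y -> inU y' -> 0 <= d ->
  `|y'.1.1 - y.1.1| <= d -> `|y'.1.2 - y.1.2| <= d ->
  (forall j, `|(y'.2 j).1 - (y.2 j).1| <= d /\ `|(y'.2 j).2 - (y.2 j).2| <= d) ->
  nm (lam y' i - lam y i) <= 4 * d.
Proof.
move=> U U' d0 h1 h2 h3.
have -> : lam y' i - lam y i = (zY b y' - zY b y) * fac y' i + zY b y * (fac y' i - fac y i).
  by rewrite /lamY -/(fac y i) -/(fac y' i); ring.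
have hb : 0 <= 2 * b <= 1 / 2 by have := b4; have := b0; move=> *; apply/andP; split; lra.
have small (x : R) : `|x| <= d -> `|2 * b * x| <= d / 2.
  move=> hx; rewrite normrM ger0_norm; last by case/andP: hb.
  case/andP: hb => hb1 hb2; apply: le_trans (ler_pM hb1 (normr_ge0 _) hb2 hx) _; lra.
have z1 : nm (zY b y' - zY b y) <= d.
  rewrite zY_sub; apply: le_trans (nm_cpx _ _) _.
  have := small _ h1; have := small _ h2; lra.
have f1 : nm (fac y' i - fac y i) <= d.
  rewrite /fac; case: (unlift ord0 i) => [j|]; last by rewrite subrr nm0.
  rewrite aY_sub; apply: le_trans (nm_cpx _ _) _; have [g1 g2] := h3 j.
  have := small _ g1; have := small _ g2; lra.
have /andP[_ z2] := zY_bound b0 b4 U.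
apply: le_trans (nmD _ _) _; rewrite !nmM.
have := ler_pM (nm_ge0 _) (nm_ge0 _) z1 (fac_le i U').
have := ler_pM (nm_ge0 _) (nm_ge0 _) z2 f1; lra.
Qed.

(* The chart is Lipschitz, so a dyadic cell is mapped into a box of comparable volume. *)
Lemma leb_null_chart (Y : pt -> Prop) : (forall y, Y y -> inU y) -> nullY Y ->
  leb_null [set l : V | exists2 y, Y y & forall i, toC (l i) = lam y i].
Proof.
move=> YU nY; apply: (leb_null_family (ltn0Sn kk)) => eps e0.
(* A cell of level l is mapped into a box of side 8 / 2^l, of area 64 / 4^l in each complex
   coordinate. *)
pose W : R := (64 ^+ kk.+1).
have W0 : 0 < W by rewrite exprn_gt0.
have [s cs vs] := nY (eps / W) (divr_gt0 e0 W0).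
have ex (c : tcell kk) : exists y : pt, (exists2 y' : pt, inU y' & intc c y') -> inU y /\ intc c y.
  have [[y' U i]|n] := EM (exists2 y' : pt, inU y' & intc c y').
    by exists y'.
  by exists ((0, 0), fun=> (0, 0)).
have [g hg] := choice ex.
pose w (c : tcell kk) : R := 4 * 2 ^- (tag c).
have w0 c : 0 <= w c by rewrite mulr_ge0 // invr_ge0 exprn_ge0.
pose lo (c : tcell kk) (i : 'I_kk.+1) := ((toP (lam (g c) i)).1 - w c, (toP (lam (g c) i)).2 - w c).
pose hi (c : tcell kk) (i : 'I_kk.+1) := ((toP (lam (g c) i)).1 + w c, (toP (lam (g c) i)).2 + w c).
pose z : V := fun=> (0, 0).
exists (fun m j => if onth (s m) j is Some c then lo c else z),
       (fun m j => if onth (s m) j is Some c then hi c else z); split.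
  move=> m j i; case: onth => [c|] //; rewrite /lo /hi /=; have := w0 c; split; lra.
split.
  move=> l [y Yy ly]; have [m [j jm hj]] := cs y Yy.
  exists m, j; case e : (onth (s m) j) => [c|]; last by have := onthTE (s m) j; rewrite e jm.
  have ic : intc c y by rewrite -(@onth_nth _ c _ _ _ e); exact: hj.
  have U := YU y Yy; have [Ug ig] := hg c (ex_intro2 _ _ y U ic).
  have same : idx (tag c) y = idx (tag c) (g c) by rewrite ic ig.
  have d0 : 0 <= (2 : R) ^- (tag c) by rewrite invr_ge0 exprn_ge0.
  have [[U1 U2] U3] := U; have [[V1 V2] V3] := Ug.
  have s1 : idx1 (tag c) y.1.1 = idx1 (tag c) (g c).1.1 := congr1 (fun x => x.1.1) same.
  have s2 : idx1 (tag c) y.1.2 = idx1 (tag c) (g c).1.2 := congr1 (fun x => x.1.2) same.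
  have cl i := @lamY_lip (g c) y i _ Ug U d0 (idx1_close U1 V1 s1) (idx1_close U2 V2 s2).
  move=> i; have [|h1 h2] := toP_close (cl i _).
    move=> i'; have := congr1 (fun x : cell kk (tag c) => x.2 i') same; rewrite !ffunE => -[q1 q2].
    have [U4 U5] := U3 i'; have [V4 V5] := V3 i'.
    by split; apply: idx1_close => //; exact: ord_inj.
  move: h1 h2; rewrite -ly toCK /lo /hi -/(w c) /= !ler_norml => /andP[g1 g2] /andP[g3 g4].
  by split; apply/andP; split; lra.
move=> I J; apply: le_trans (_ : \sum_(m < I) W * @svol R kk (s m) <= _); last first.
  by rewrite -mulr_sumr mulrC -ler_pdivlMr.
apply: ler_sum => m _; rewrite /svol mulr_sumr.
have tv c : 0 <= W * @tvol R kk c by rewrite mulr_ge0 ?(ltW W0) // invr_ge0 ltW // ncell_gt0.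
apply: le_trans (sum_onth (s m) J tv); apply: ler_sum => j _; case: onth => [c|]; last first.
  by rewrite /box_vol (bigD1 ord0) //= subrr mul0r mul0r.
have p0 : (4 : R) ^+ tag c != 0 by rewrite expf_neq0 // pnatr_eq0.
rewrite /box_vol (eq_bigr (fun=> 64 / 4 ^+ tag c)).
  by rewrite prodr_const card_ord /tvol /ncell /W exprMn exprVn.
move=> i _; rewrite /lo /hi /= /w.
have -> : (4 : R) ^+ tag c = 2 ^+ tag c * 2 ^+ tag c by rewrite -exprMn; congr (_ ^+ _); ring.
have : (2 : R) ^+ tag c != 0 by rewrite expf_neq0.
by move: (2 ^+ tag c) => x x0; field.
Qed.

(** z = l_0 / a0 and a_j = l_j / z. Their distances to 1 and [ac j] are at most b / 2, half the size
    of the chart, so y stays inside the half-open cube. *)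
Lemma chart_onto (l : V) : a0 != 0 ->
  (forall i, nm (toC (l i) - fac0 i) <= b * nm a0 / 8) ->
  exists2 y, inU y & forall i, toC (l i) = lam y i.
Proof.
move=> a0n H; have n0 : 0 < nm a0 by rewrite nm_gt0.
pose z := toC (l ord0) / a0.
have H0 : nm (z - 1) <= b / 8.
  have -> : z - 1 = (toC (l ord0) - a0) / a0 by rewrite /z; field.
  rewrite nmM nmV ler_pdivrMr //; have := H ord0; rewrite /fac0 unlift_none; lra.
have zn : 1 / 2 <= nm z.
  have := nm_tri 1 z; rewrite nm1 nmBC.
  by have := b4; lra.
have z0 : z != 0 by apply: contraTneq zn => ->; rewrite nm0; lra.
pose a j := toC (l (lift ord0 j)) / z.
have Ha j : nm (a j - ac j) <= b / 2.
  have -> : a j - ac j = ((toC (l (lift ord0 j)) - ac j) - ac j * (z - 1)) / z by rewrite /a; field.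
  rewrite nmM nmV ler_pdivrMr; last lra.
  apply: le_trans (nmB _ _) _; rewrite nmM.
  have h1 := H (lift ord0 j); rewrite /fac0 liftK in h1.
  have h2 : nm (ac j) * nm (z - 1) <= 1 * (b / 8) by apply: ler_pM; rewrite ?nm_ge0.
  have h3 : b * nm a0 <= b * 1 by apply: ler_wpM2l => //; exact: ltW.
  have h4 : b * (1 / 2) <= b * nm z by apply: ler_wpM2l => //; exact: ltW.
  lra.
pose co (x : R) := (x / b + 1) / 2.
have coK x : b * (2 * co x - 1) = x by rewrite /co; field; rewrite gt_eqF.
have coU x : `|x| <= b / 2 -> 0 <= co x < 1.
  rewrite ler_norml => /andP[x1 x2].
  have y1 : - (1 / 2) <= x / b by rewrite ler_pdivlMr //; lra.
  have y2 : x / b <= 1 / 2 by rewrite ler_pdivrMr //; lra.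
  by rewrite /co; apply/andP; split; lra.
pose y : pt := ((co (complex.Re (z - 1)), co (complex.Im (z - 1))),
  fun j => (co (complex.Re (a j - ac j)), co (complex.Im (a j - ac j)))).
have zE : zY b y = z.
  rewrite /zY /= !coK; case: (z) => u v; apply/eqP; rewrite eq_complex /=.
  by apply/andP; split; apply/eqP; ring.
have aE j : aY b ac y j = a j.
  rewrite /aY /= !coK; case: (a j) => u v; case: (ac j) => u' v'; apply/eqP; rewrite eq_complex /=.
  by apply/andP; split; apply/eqP; ring.
have b8 : b / 8 <= b / 2 by have := b0; lra.
exists y.
  split; first by split; apply: coU; [apply: le_trans (nm_Re _) _ | apply: le_trans (nm_Im _) _]; exact: le_trans b8.
  by move=> j; split; apply: coU; [apply: le_trans (nm_Re _) _ | apply: le_trans (nm_Im _) _].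
move=> i; rewrite /lamY zE; case: (unliftP ord0 i) => [j|] ->; last by rewrite /z divfK.
by rewrite aE /a mulrC divfK.
Qed.

End Transfer.

(** * Conclusion *)

Section Main.
Variables (R : realType) (kk : nat) (t : 'I_kk.+1 -> R * R) (p : 'I_kk.+1 -> R).
Hypothesis t_inj : injective t.
Hypothesis p_gt0 : forall i, 0 < p i.
Hypothesis p_sum : \sum_(i < kk.+1) p i = 1.

Definition bad (l : 'I_kk.+1 -> R * R) : Prop :=
  region p l /\ exists2 nu : probability (R * R)%type R, self_similar l t p nu & ~ (nu `<< @leb2 R).

Local Notation tC := (fun i => toC (t i)).

Lemma sep_t : exists2 c : R, 0 < c & forall i j, i != j -> c <= nm (tC i - tC j).
Proof.
pose f (x : 'I_kk.+1 * 'I_kk.+1) : R := if x.1 == x.2 then 1 else nm (tC x.1 - tC x.2).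
have [|c c0 hc] := @pos_lower_bound R _ f.
  move=> [i j]; rewrite /f /=; case: eqVneq => [_|ij]; first exact: ltr01.
  rewrite nm_gt0 // subr_eq0; apply: contra_neq ij => e; apply: t_inj.
  by rewrite -(toCK (t i)) e toCK.
by exists c => // i j /negbTE ij; have := hc (i, j); rewrite /f /= ij.
Qed.

Section Point.
Variable lam0 : 'I_kk.+1 -> R * R.
Hypothesis reg0 : region p lam0.
Local Notation n0 i := (nm (toC (lam0 i))).
Local Notation chi := (fun i => - ln (nm (toC (lam0 i)))).
Local Notation Chi := (\sum_(i < kk.+1) p i * chi i).
Local Notation H := (- \sum_(i < kk.+1) p i * ln (p i)).

Let n0_itv i : 0 < n0 i < 1.
Proof. by have [h _] := reg0; exact: h. Qed.

Let Chi0 : 0 < Chi.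
Proof.
have h i : 0 < p i * chi i.
  by have /andP[a1 a2] := n0_itv i; rewrite mulr_gt0 // oppr_gt0 ln_lt0 // a1.
rewrite big_ord_recl /=; apply: ltr_pwDl; first exact: h.
by apply: sumr_ge0 => i _; exact: ltW.
Qed.

(** The hypothesis on the similarity dimension, whose numerator and denominator are - H and -
    Chi. *)
Let ChiH : 2 * Chi < H.
Proof.
have [_] := reg0; rewrite /sim_dim.
have -> : \sum_(i < kk.+1) p i * ln (cabs (lam0 i)) = - Chi.
  by rewrite -sumrN; apply: eq_bigr => i _; rewrite mulrN opprK.
by rewrite invrN mulrN -mulNr ltr_pdivlMr.
Qed.

Lemma local_null : exists2 d : R, 0 < d &
  leb_null [set l | bad l /\ forall i, `|(l i).1 - (lam0 i).1| <= d /\ `|(l i).2 - (lam0 i).2| <= d].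
Proof.
have [c c0 sep] := sep_t.
pose tau : R := 1 + \sum_(i < kk.+1) nm (tC i).
have tau1 : 1 <= tau by rewrite /tau lerDl sumr_ge0 // => i _; exact: nm_ge0.
have t_le i : nm (tC i) <= tau.
  rewrite /tau (bigD1 i) //=.
  have : 0 <= \sum_(j < kk.+1 | j != i) nm (tC j) by apply: sumr_ge0 => j _; exact: nm_ge0.
  by lra.
have [c1 c10 hc1] : exists2 c1 : R, 0 < c1 & forall i, c1 <= 1 - n0 i.
  by apply: pos_lower_bound => i; rewrite subr_gt0; case/andP: (n0_itv i).
(* Half of the distance to the unit circle is reserved for the size of the chart. *)
pose rho : R := 1 - c1 / 2.
have rho1 : rho < 1 by rewrite /rho; lra.
have rho0 : 0 <= rho.
  by have := hc1 ord0; have /andP[] := n0_itv ord0; rewrite /rho; lra.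
have tau0 : 0 <= tau := le_trans ler01 tau1.
have [Sb [ds ds0 hds]] := base_separated rho0 rho1 tau0 c0 t_le sep.
pose S := (Sb + 3)%N.
have S3 : (3 <= S)%N by rewrite leq_addl.
have sepS : exists2 d : R, 0 < d & forall l : 'I_kk.+1 -> R[i], (forall i, nm (l i) <= rho) ->
    forall u v, dif u v -> u != [::] -> v != [::] -> exists2 j, (j < S)%N & d <= nm (jetdif tC l u v j).
  exists ds => // l Bl u v duv u0 v0; have [j jS hj] := hds l Bl u v duv u0 v0.
  by exists j => //; apply: leq_trans jS _; exact: leq_addr.
have [dlt /andP[dlt0 _] [A A0 sch]] := schedule S3 (ltW Chi0) ChiH.
(* Sum of the coefficients of eps in the smallness conditions, so that the single choice eps = g / Q
   satisfies all of them. [dlt] and [A] were obtained without reference to eps. *)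
pose Q : R := 1 + 14 * (3 * A + 2) + 3 * (7 * (3 * A + 2) + 2).
have Q4 : 4 <= Q by rewrite /Q; lra.
have Q0 : 0 < Q by lra.
pose g : R := Num.min (dlt * Chi / 2) (Num.min ((H - 2 * Chi) / 2) Chi).
have g0 : 0 < g.
  by rewrite !lt_min Chi0 !divr_gt0 ?mulr_gt0 // subr_gt0 ChiH.
have [g1 g2 g3] : [/\ g <= dlt * Chi / 2, g <= (H - 2 * Chi) / 2 & g <= Chi].
  by rewrite /g !ge_min !lexx !orbT.
pose eps := g / Q.
have eps0 : 0 < eps by rewrite divr_gt0.
have epsQ : Q * eps = g by rewrite /eps mulrC divfK // gt_eqF.
have A3 : 0 <= (3 * A + 2) * eps by rewrite mulr_ge0 ?(ltW eps0) //; lra.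
have E1 : 14 * (3 * A + 2) * eps <= dlt * Chi / 2.
  by apply: le_trans g1; rewrite -epsQ /Q; lra.
have E2 : (1 + 3 * (7 * (3 * A + 2) + 2)) * eps <= (H - 2 * Chi) / 2.
  by apply: le_trans g2; rewrite -epsQ /Q; lra.
have E3 : 4 * eps < 2 * Chi.
  have : 4 * eps <= Q * eps by rewrite ler_wpM2r // ltW.
  by have := Chi0; lra.
have x1 : expR (- eps) < 1 by rewrite -[X in _ < X]expR0 ltr_expR oppr_lt0.
have [c2 c20 hc2] : exists2 c2 : R, 0 < c2 & forall i, c2 <= n0 i * (1 - expR (- eps)).
  by apply: pos_lower_bound => i; rewrite mulr_gt0 ?subr_gt0 //; case/andP: (n0_itv i).
(* The chart moves each ratio by at most 6 b: at most c1 / 2 keeps it below rho, and at most c2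
   keeps the logarithm of its modulus within eps. *)
pose b : R := Num.min (1 / 4) (Num.min (c1 / 12) (c2 / 6)).
have b0 : 0 < b by rewrite !lt_min; apply/and3P; split; lra.
have [b4 bc1 bc2] : [/\ b <= 1 / 4, b <= c1 / 12 & b <= c2 / 6].
  by rewrite /b !ge_min !lexx !orbT.
pose a0 := toC (lam0 ord0); pose ac j := toC (lam0 (lift ord0 j)).
have a01 : nm a0 <= 1 by apply: ltW; case/andP: (n0_itv ord0).
have ac1 j : nm (ac j) <= 1 by apply: ltW; case/andP: (n0_itv (lift ord0 j)).
have facE i : fac0 a0 ac i = toC (lam0 i).
  by rewrite /fac0; case: unliftP => [j ->|->].
have UB y : inU y -> inB chi eps rho (lamY b a0 ac y).
  move=> U i; have h := lamY_center b0 b4 a01 ac1 i U; rewrite facE in h.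
  have h1 := nm_tri (lamY b a0 ac y i) (toC (lam0 i)).
  have h2 := nm_tri (toC (lam0 i)) (lamY b a0 ac y i); rewrite nmBC in h2.
  have /andP[p0 p1] := n0_itv i.
  have eE s : expR (- chi i + s) = n0 i * expR s by rewrite expRD opprK lnK // posrE.
  rewrite -[- chi i - eps]/(- chi i + - eps) !eE.
  have k1 := hc2 i; have k2 := hc1 i.
  have k3 : n0 i * (2 - expR (- eps)) <= n0 i * expR eps.
    apply: ler_wpM2l; first exact: ltW.
    by have := expR_ge1Dx eps; have := expR_ge1Dx (- eps); lra.
  by rewrite /rho; split; first (apply/andP; split); lra.
have ae := bootstraps_ae H p_gt0 p_sum Chi0 eps0 rho0 rho1 tau1 t_le S3 b0 b4 UB sepS.
have [ae2 ae1] := sch _ ae.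
have nG := ae_good p_gt0 p_sum Chi0 ChiH eps0 rho0 rho1 tau1 t_le S3 b0 b4 UB dlt0 A0 E1 E2 ae2 ae1.
have a0n : a0 != 0.
  by apply: contraTneq (n0_itv ord0) => e; rewrite -/a0 e nm0 ltxx.
have na0 : 0 < nm a0 by rewrite nm_gt0.
(* A coordinatewise distance d gives modulus at most 2 d = b |a0| / 8, the radius in
   [chart_onto]. *)
exists (b * nm a0 / 16); first by rewrite divr_gt0 // mulr_gt0.
apply: leb_null_sub (leb_null_chart b0 b4 a01 ac1 _ nG); last by move=> y [].
move=> l [[rl [nu ss nac]] hl].
have [|y U ly] := chart_onto b0 b4 a01 ac1 a0n (l := l).
  move=> i; rewrite facE; have [h1 h2] := hl i.
  have -> : toC (l i) - toC (lam0 i) = toC ((l i).1 - (lam0 i).1, (l i).2 - (lam0 i).2) by [].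
  by apply: le_trans (nm_toC_le _) _ => /=; lra.
exists y => //; split => // gd; apply: nac.
have le : (fun i => toC (l i)) = lamY b a0 ac y by apply: funext.
apply: (self_similar_ac ss p_gt0 p_sum eps0 E3 (rho := rho)).
  by rewrite le; exact: UB.
by move=> K; have := gd K; rewrite /freq_small -le.
Qed.

End Point.

Lemma bad_null : leb_null bad.
Proof.
apply: (leb_null_local (ltn0Sn kk)) => l [rl _]; exact: local_null rl.
Qed.

End Main.

Theorem theorem1p1 (R : realType) (k : nat) (t : 'I_k -> R * R) (p : 'I_k -> R) :
  (2 <= k)%N ->
  injective t ->
  (forall i, 0 < p i) ->
  \sum_(i < k) p i = 1 ->
  exists E : set ('I_k -> R * R),
    E `<=` region p /\ leb_null E /\
    forall lam, region p lam -> ~ E lam ->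
      forall nu : probability (R * R)%type R,
        self_similar lam t p nu -> nu `<< @leb2 R.
Proof.
case: k t p => [//|kk] t p _ t_inj p_gt0 p_sum.
exists (bad t p); split; first by move=> l [].
split; first exact: bad_null.
by move=> l rl nb nu ss; apply: contrapT => nac; apply: nb; split => //; exists nu.
Qed.
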